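(* For all $1\le k\le g+1$, for the subsequence $n(j)=j(g+1)+k$, $$\liminf_{j\to\infty}\kappa_{n(j)}^{1/n(j)}\ge\lambda_k^{1/(g+1)}$$ (with $(+\infty)^{1/(g+1)}=+\infty$).
   Context: $\overline{\mathbb{C}}$ is the Riemann sphere and $\overline{\mathbb{R}}=\mathbb{R}\cup\{\infty\}$. $\mu$ is a Borel probability measure on $\overline{\mathbb{R}}$ with support $\operatorname{supp}\mu\subset\overline{\mathbb{R}}$, and $\mathsf{E}=\operatorname{ess\,supp}\mu$ is $\operatorname{supp}\mu$ with its isolated points removed; it is assumed that $\mathsf{E}\ne\emptyset$. Let $g\ge 0$ be an integer and $\mathbf{C}=(\mathbf{c}_1,\dots,\mathbf{c}_{g+1})$ a sequence of pairwise distinct points of $\overline{\mathbb{R}}\setminus\operatorname{supp}\mu$. Define $r_0=1$ and, for $n=j(g+1)+k$ with $j\ge 0$, $1\le k\le g+1$, $r_n(z)=(\mathbf{c}_k-z)^{-(j+1)}$ if $\mathbf{c}_k\in\mathbb{R}$ and $r_n(z)=z^{j+1}$ if $\mathbf{c}_k=\infty$. Let $\mathcal{L}_n=\operatorname{span}\{r_\ell: 0\le\ell\le n\}$. The orthonormal rational functions $\{\tau_n\}_{n\ge0}$ are obtained by applying the Gram–Schmidt process to $\{r_n\}_{n\ge 0}$ in $L^2(d\mu)$, and $\kappa_n>0$ is the constant such that $\tau_n-\kappa_n r_n\in\mathcal{L}_{n-1}$. If $\mathsf{E}$ is not polar, $G_{\mathsf{E}}(z,w)$ denotes the Green function of $\overline{\mathbb{C}}\setminus\mathsf{E}$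 with pole at $w$, $\gamma_{\mathsf{E}}^k=\lim_{z\to\mathbf{c}_k}(G_{\mathsf{E}}(z,\mathbf{c}_k)+\log|z-\mathbf{c}_k|)$ if $\mathbf{c}_k\neq\infty$, $\gamma_{\mathsf{E}}^k=\lim_{z\to\infty}(G_{\mathsf{E}}(z,\infty)-\log|z|)$ if $\mathbf{c}_k=\infty$, and $\log\lambda_k=\gamma_{\mathsf{E}}^k+\sum_{1\le\ell\le g+1,\,\ell\ne k}G_{\mathsf{E}}(\mathbf{c}_k,\mathbf{c}_\ell)$. If $\mathsf{E}$ is polar, $\lambda_k=+\infty$. *)

(* Defs.v *)
From HB Require Import structures.
From mathcomp Require Import all_boot all_order all_algebra.
From mathcomp Require Import all_classical all_reals all_analysis.
Set Implicit Arguments.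
Unset Strict Implicit.
Unset Printing Implicit Defensive.
Import Order.TTheory GRing.Theory Num.Theory.
Import numFieldNormedType.Exports.
Local Open Scope classical_set_scope.
Local Open Scope ring_scope.

(* The circle R u {oo} and the Riemann sphere C u {oo}, with C identified with
   R * R as a real vector space; [None] is the point at infinity. *)
Notation Rhat R := (one_point_compactification (R : realType)).
Notation Chat R := (one_point_compactification ((R : realType) * R)%type).
Notation borelRhat R := (g_sigma_algebraType (@open (Rhat R))).

Section Sphere.
Context {R : realType}.
Implicit Types (z : (R * R)%type) (p w : Chat R) (x : Rhat R).

Definition to_sphere x : Chat R := omap (fun a : R => (a, 0 : R)) x.

Definition cmod z : R := Num.sqrt (z.1 ^+ 2 + z.2 ^+ 2).

(* 1 / z = conj z / |z|^2 *)
Definition cinv z : (R * R)%type :=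
  (z.1 / (z.1 ^+ 2 + z.2 ^+ 2), - z.2 / (z.1 ^+ 2 + z.2 ^+ 2)).

Definition chart_oo z : Chat R := if z == 0 then None else Some (cinv z).

Definition axis (b : bool) : (R * R)%type := if b then (0, 1) else (1, 0).

(* [f] is of class C^2 with vanishing Laplacian in a neighborhood of [z0]. *)
Definition plane_harmonic_at (f : (R * R)%type -> R) (z0 : (R * R)%type) : Prop :=
  \forall z \near z0,
    [/\ forall i, derivable f z (axis i),
        forall i j, derivable ('D_(axis i) f) z (axis j),
        forall i j, {for z, continuous ('D_(axis j) ('D_(axis i) f))} &
        'D_(axis false) ('D_(axis false) f) z +
        'D_(axis true) ('D_(axis true) f) z = 0].

Definition harmonic_at (u : Chat R -> R) p : Prop :=
  match p with
  | Some z => plane_harmonic_at (fun z' => u (Some z')) z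
  | None => plane_harmonic_at (fun z' => u (chart_oo z')) 0
  end.

(* log |z - w|, resp. - log |z| when w = oo: the logarithm of the modulus of a
   local coordinate at [w].  It is only used for p near w, p <> w, where the
   last case does not occur. *)
Definition log_coord w p : R :=
  match w, p with
  | Some a, Some z => ln (cmod (z - a))
  | None, Some z => - ln (cmod z)
  | _, None => 0
  end.

Definition green_candidate (K : set (Chat R)) w (u : Chat R -> R) : Prop :=
  [/\ forall p, ~ K p -> p <> w -> harmonic_at u p,
      forall p, ~ K p -> p <> w -> 0 <= u p &
      exists M : R, \forall p \near w^', `|u p + log_coord w p| <= M].

(* The Green function of the complement of [K] with pole at [w]: the smallest
   nonnegative harmonic function with a logarithmic pole at [w].  Its values on
   [K] and at [w] are irrelevant. *)
Definition is_green (K : set (Chat R)) w (u : Chat R -> R) : Prop :=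
  green_candidate K w u /\
  forall v, green_candidate K w v -> forall p, ~ K p -> p <> w -> u p <= v p.

Definition green (E : set (Rhat R)) (p w : Chat R) : R :=
  xget (fun=> 0) [set u | is_green (to_sphere @` E) w u] p.

(* the constant gamma_E at the point w *)
Definition robin_const (E : set (Rhat R)) w : R :=
  lim ((green E p w + log_coord w p) @[p --> w^']).

(* [lne] is used because [ln 0 = 0], whereas the kernel is +oo on the
   diagonal. *)
Definition log_energy (nu : {measure set (measurableTypeR R) -> \bar R}) :
    \bar R :=
  (\int[nu]_s \int[nu]_t (- lne (`|s - t|%R)%:E))%E.

(* A compact subset of E \cap C lies on the real line, so that only measures on
   R are needed. *)
Definition polar (E : set (Rhat R)) : Prop :=
  forall (nu : {finite_measure set (measurableTypeR R) -> \bar R}) (K : set R),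
    compact K -> K `<=` [set s | E (Some s)] ->
    nu (~` K) = 0%E -> nu [set: R] <> 0%E -> log_energy nu = +oo%E.

Definition lambda (E : set (Rhat R)) (g : nat) (c : 'I_g.+1 -> Rhat R)
    (k : 'I_g.+1) : \bar R :=
  if `[< polar E >] then +oo%E
  else (expR (robin_const E (to_sphere (c k)) +
    \sum_(l < g.+1 | l != k) green E (to_sphere (c k)) (to_sphere (c l))))%:E.

End Sphere.

Section OrthonormalRationalFunctions.
Context {R : realType}.
Variable mu : probability (borelRhat R) R.

Definition msupport : set (Rhat R) :=
  [set x | forall U : set (Rhat R), open U -> U x -> (0 < mu U)%E].

Definition ess_support : set (Rhat R) := msupport `\` isolated msupport.

Variables (g : nat) (c : 'I_g.+1 -> Rhat R).

(* The points c_1, ..., c_(g+1) are [c 0], ..., [c g]; hence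
   n = j (g + 1) + k with 1 <= k <= g + 1 is [m.+1] with m = j (g + 1) + (k - 1).
   The value at the pole c_k, which lies outside the support, is irrelevant. *)
Definition rfun (n : nat) (x : Rhat R) : R :=
  if n is m.+1 then
    match c (inord (m %% g.+1)), x with
    | Some a, Some s => (a - s) ^- (m %/ g.+1).+1
    | Some _, None => 0
    | None, Some s => s ^+ (m %/ g.+1).+1
    | None, None => 0
    end
  else 1.

(* the linear span of r_0, ..., r_(n-1) *)
Definition rspan (n : nat) : set (Rhat R -> R) :=
  [set f | exists a : nat -> R,
     f = (fun x => \sum_(0 <= l < n) a l * rfun l x)].

Definition inner (f h : Rhat R -> R) : R := \int[mu]_x (f x * h x).

Definition normalize (f : Rhat R -> R) : Rhat R -> R :=
  fun x => f x / Num.sqrt (inner f f).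

(* [:: tau_0; ...; tau_(n-1)] *)
Fixpoint gram_schmidt (n : nat) : seq (Rhat R -> R) :=
  if n is m.+1 then
    let s := gram_schmidt m in
    rcons s (normalize
      (fun x => rfun m x - \sum_(t <- s) inner (rfun m) t * t x))
  else [::].

Definition tau (n : nat) : Rhat R -> R :=
  nth (fun=> 0) (gram_schmidt n.+1) n.

(* [rspan n] is the space L_(n-1). *)
Definition is_leading_coef (n : nat) (kappa : R) : Prop :=
  0 < kappa /\ rspan n (fun x => tau n x - kappa * rfun n x).

End OrthonormalRationalFunctions.

(* Main.v *)
Require Import Defs.
From HB Require Import structures.
From mathcomp Require Import all_boot all_order all_algebra.
From mathcomp Require Import all_classical all_reals all_analysis.
From mathcomp Require Import measurable_realfun.
From mathcomp Require Import ring lra zify.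
Import Order.TTheory GRing.Theory Num.Theory.
Import numFieldNormedType.Exports.
Local Open Scope classical_set_scope.
Local Open Scope ring_scope.
Set Implicit Arguments.
Unset Strict Implicit.
Unset Printing Implicit Defensive.

(** The constant kappa_n is an extremal quantity: 1 / kappa_n is the distance
    in L^2(mu) from r_n to the span of its predecessors, so every function
    f = a r_n + (lower terms) satisfies |a| <= kappa_n ||f||
    ([leading_coef_extremal]).  A lower bound for kappa_n therefore needs one
    trial function which is bounded on supp mu and has a large coefficient a.

    The trial functions are products, over the poles c_l, of powers of
    polynomials in the coordinate zeta_l with pole at c_l (zeta_l is
    1 / (c_l - x), or x when c_l = oo).  Suppose Q_l has degree at most N, is
    bounded by 1 on supp mu up to finitely many points, and let A_l be
    |Q_l(zeta_l(c_k))| for l <> k and the modulus of the leading coefficient of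
    Q_k for l = k.  Partial fractions ([zeta_partial_fractions],
    [pole_expansion_prod]) show that prod_l Q_l(zeta_l)^q, times a fixed
    polynomial in zeta_k which vanishes at the exceptional points, is a trial
    function for n = j(g+1)+k with qN close to j, and that |a| = prod_l A_l^q.
    Since n is about j(g+1), the lower limit of kappa_n^(1/n) is at least
    (prod_l A_l)^(1/(N(g+1))) ([kappa_lower], [limn_einf_kappa_lower]).  It
    remains to choose the Q_l with (1/N) sum_l log A_l as close to
    log lambda_k as desired ([exists_trial_polynomials]).

    The Q_l come from near-Fekete points, that is, points of
    supp mu at distance less than 1/(m+1) from E whose discriminant is within a
    constant factor of the supremum.  Deleting one suitable point and
    normalizing gives a polynomial which is at most 1 on these points of
    supp mu, and only finitely many points of supp mu are left out because E
    is the set of limit points of supp mu.  Lagrange interpolation shows that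
    the normalized polynomial cannot be small away from E
    ([fekete_polynomial]).  With log_m = (1/degree) log|Q_l(zeta_l)|, the
    potential log_m is asymptotically nonnegative off E and harmonic off E and
    c_l, and along an ultrafilter its limit is a harmonic function with the
    logarithmic pole of a Green function.  A maximum principle
    ([potential_le_candidate]) makes it the smallest one, so the limit is the
    Green function and the limit of (1/degree) log(leading coefficient) is the
    Robin constant ([fekete_approximates_green]), provided these numbers stay
    bounded.

    Boundedness is exactly what non-polarity means.  A measure of finite energy
    on E can be restricted to a set of positive measure so that its potential
    becomes bounded everywhere, and integrating log|Q_l| against it bounds the leading
    coefficients ([nonpolar_robin_bounded]).  Conversely, bounded leading
    coefficients produce, as limit of the distributions of the Fekete points, a
    measure on E with bounded potential ([bounded_robin_nonpolar]).  So for
    polar E the leading coefficients are unbounded, the factors for l <> k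
    contribute almost nonnegative logarithms, and every bound is reached. *)

(** * Near-Fekete points and their polynomials *)

Section Fekete.
Context {R : realType}.

Definition node_prod n (t : 'I_n -> R) (i : 'I_n) (x : R) : R :=
  \prod_(m < n | m != i) `|x - t m|.

Definition discriminant n (t : 'I_n -> R) : R := \prod_(i < n) node_prod t i (t i).

Definition replace_node n (t : 'I_n -> R) (i : 'I_n) (x : R) : 'I_n -> R :=
  fun m => if m == i then x else t m.

Lemma node_prod_ge0 n (t : 'I_n -> R) i x : 0 <= node_prod t i x.
Proof. by apply: prodr_ge0 => m _. Qed.

Lemma discriminant_split n (t : 'I_n -> R) i x :
  discriminant (replace_node t i x) = node_prod t i x ^+ 2 *
    \prod_(a < n | a != i) \prod_(m < n | (m != a) && (m != i)) `|t a - t m|.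
Proof.
rewrite /discriminant (bigD1 i) //= expr2 -mulrA; congr (_ * _).
  rewrite /node_prod /replace_node eqxx; apply: eq_bigr => m mi.
  by rewrite (negbTE mi).
rewrite [node_prod t i x]/node_prod -big_split /=; apply: eq_bigr => a ai.
rewrite /node_prod (bigD1 i) ?(eq_sym i) //= /replace_node (negbTE ai) eqxx.
rewrite distrC; congr (_ * _); apply: eq_bigr => m /andP[ma mi].
by rewrite (negbTE mi).
Qed.

Lemma replace_node_same n (t : 'I_n -> R) i : replace_node t i (t i) = t.
Proof. by apply/funext => m; rewrite /replace_node; case: eqP => // ->. Qed.

(** The left-hand side is the interpolation polynomial of the constant 1. *)
Lemma lagrange_sum n (t : 'I_n.+1 -> R) (x : R) : injective t ->
  \sum_(i < n.+1) \prod_(m < n.+1 | m != i) ((x - t m) / (t i - t m)) = 1.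
Proof.
move=> tI; set d := fun i => \prod_(m < n.+1 | m != i) (t i - t m).
have d0 i : d i != 0.
  by apply/prodf_neq0 => m mi; rewrite subr_eq0 (inj_eq tI) eq_sym.
pose p : {poly R} :=
  \sum_(i < n.+1) (d i)^-1 *: \prod_(m < n.+1 | m != i) ('X - (t m)%:P).
have pE y : p.[y] = \sum_(i < n.+1) \prod_(m < n.+1 | m != i) ((y - t m) / (t i - t m)).
  rewrite horner_sum; apply: eq_bigr => i _; rewrite hornerZ horner_prod.
  rewrite prodf_div mulrC; congr (_ * _); apply: eq_bigr => m _.
  by rewrite hornerXsubC.
rewrite -pE; suff -> : p = 1 by rewrite hornerC.
apply/eqP; rewrite -subr_eq0; apply/negPn/negP => p1.
have := max_poly_roots (rs := codom t) p1.
rewrite size_codom card_ord.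
have -> : all (root (p - 1)) (codom t).
  apply/allP => _ /codomP[j ->]; rewrite rootE hornerD hornerN hornerC pE subr_eq0.
  rewrite (bigD1 j) //= big1 => [|m mj]; last by rewrite divff // subr_eq0 (inj_eq tI) eq_sym.
  rewrite big1 ?addr0 // => m mj.
  by rewrite (bigD1 j) 1?eq_sym //= subrr mul0r mul0r.
rewrite map_inj_uniq // enum_uniq => /(_ isT isT).
apply/negP; rewrite -leqNgt (leq_trans (size_polyD _ _)) // geq_max.
rewrite size_polyN size_poly1 andbT; apply: (leq_trans (size_sum _ _ _)).
apply/bigmax_leqP => i _; apply: (leq_trans (size_scale_leq _ _)).
rewrite size_prod; last by move=> m _; rewrite polyXsubC_eq0.
under eq_bigr do rewrite size_XsubC.
have -> : #|[pred m : 'I_n.+1 | m != i]| = n.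
  by have := cardC1 i; rewrite card_ord /=; apply: etrans; apply: eq_card.
have -> : (\sum_(i0 < n.+1 | i0 != i) 2)%N = (n * 2)%N.
  rewrite sum_nat_const; congr (_ * _)%N.
  by have := cardC1 i; rewrite card_ord /=; apply: etrans; apply: eq_card.
lia.
Qed.

(** Points whose discriminant exceeds a quarter of its supremum over F.  Moving
    one point changes the discriminant by the square of a ratio of node
    products, so each node product is within a factor 2 of its maximum. *)
Lemma exists_near_fekete (F : set R) (B : R) n : infinite_set F ->
    (forall x, F x -> `|x| <= B) ->
  exists t : 'I_n.+1 -> R, [/\ injective t, forall i, F (t i) &
    forall i x, F x -> node_prod t i x <= 2 * node_prod t i (t i)].
Proof.
move=> Finf FB.
pose A := [set w | exists2 t : 'I_n.+1 -> R, (forall i, F (t i)) & w = discriminant t].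
have [t0 t0F t0I] : exists2 t : 'I_n.+1 -> R, (forall i, F (t i)) & injective t.
  have [C CF nC] := infinite_set_fset n.+1 Finf.
  exists (fun i : 'I_n.+1 => nth 0 (finmap.enum_fset C) i) => [i|i j /eqP].
    by apply: CF; rewrite /= mem_nth // (leq_trans (ltn_ord i)).
  rewrite nth_uniq ?finmap.fset_uniq // ?(leq_trans (ltn_ord _)) //.
  by move/eqP/ord_inj.
have disc_gt0 t : injective t -> 0 < discriminant t.
  move=> tI; apply: prodr_gt0 => i _; apply: prodr_gt0 => m mi.
  by rewrite normr_gt0 subr_eq0 (inj_eq tI) eq_sym.
have Aub : has_ubound A.
  exists (\prod_(i < n.+1) \prod_(m < n.+1 | m != i) (2 * B)) => _ [t tF ->].
  apply: ler_prod => i _; rewrite node_prod_ge0 /=.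
  apply: ler_prod => m _; rewrite normr_ge0 /=.
  rewrite (le_trans (ler_normB _ _)) // mulr_natl mulr2n lerD ?FB //.
have Asup : has_sup A by split=> //; exists (discriminant t0), t0.
have A0 : 0 < sup A.
  by apply: lt_le_trans (disc_gt0 _ _ t0I) _; apply: ub_le_sup => //; exists t0.
have [_ [t tF ->] tA] : exists2 w, A w & sup A - 3 / 4 * sup A < w.
  by apply: sup_adherent => //; rewrite mulr_gt0 // divr_gt0.
have t0' : 0 < discriminant t.
  by apply: lt_trans tA; lra.
have tI : injective t.
  move=> i j tij; apply/eqP/negPn/negP => ij; move: t0'.
  by rewrite /discriminant (bigD1 i) //= {1}/node_prod (bigD1 j) ?(eq_sym j) //= tij subrr normr0 !mul0r ltxx.
exists t; split => // i x Fx.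
have tA' : discriminant (replace_node t i x) <= 4 * discriminant t.
  have : discriminant (replace_node t i x) <= sup A.
    apply: ub_le_sup => //; exists (replace_node t i x) => // m.
    by rewrite /replace_node; case: ifP.
  lra.
move: tA'; rewrite -{2}(replace_node_same t i) !discriminant_split.
set c := \prod_(a < n.+1 | _) _.
have c0 : 0 < c.
  apply: prodr_gt0 => a _; apply: prodr_gt0 => m /andP[ma _].
  by rewrite normr_gt0 subr_eq0 (inj_eq tI) eq_sym.
rewrite mulrA ler_pM2r // => h.
rewrite -ler_sqr ?nnegrE ?mulr_ge0 ?node_prod_ge0 //.
by rewrite exprMn (le_trans h) //; lra.
Qed.

Lemma cmod_ge0 (z : R * R) : 0 <= cmod z.
Proof. exact: sqrtr_ge0. Qed.

Lemma normr1_le_cmod (z : R * R) : `|z.1| <= cmod z.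
Proof.
by rewrite /cmod -sqrtr_sqr ler_wsqrtr // lerDl sqr_ge0.
Qed.

(** The node polynomial of n points out of n+1 near-Fekete points.  The deleted
    point is the one with the smallest node product D0, and the factor
    1 / (2 D0) makes the polynomial at most 1 on F.  The lower bound comes from
    Lagrange interpolation of 1: at every point some Lagrange polynomial is at
    least 1 / (n+1), and exchanging the deleted node costs a factor d / D. *)
Lemma fekete_polynomial (F : set R) (B : R) n : infinite_set F ->
    (forall x, F x -> `|x| <= B) ->
  exists (A : R) (s : seq R), [/\ 0 < A, size s = n, {in s, forall x, F x},
    forall x, F x -> A * \prod_(t <- s) `|x - t| <= 1 &
    forall (z : R * R) (d D : R), 0 < d ->
      (forall x, F x -> d <= cmod (z - (x, 0)) <= D) ->
      d / (2 * n.+1%:R * D) <= A * \prod_(t <- s) cmod (z - (t, 0))].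
Proof.
move=> Finf FB.
have [t [tI tF tmax]] := exists_near_fekete n Finf FB.
have dgt0 i : 0 < node_prod t i (t i).
  by apply: prodr_gt0 => m mi; rewrite normr_gt0 subr_eq0 (inj_eq tI) eq_sym.
have [i0 _ i0min] := arg_minP (fun i => node_prod t i (t i)) (erefl (xpredT (@ord0 n))).
set D0 := node_prod t i0 (t i0).
pose s := [seq t m | m <- enum (predC1 i0)].
have sE (f : R -> R) : \prod_(u <- s) f u = \prod_(m < n.+1 | m != i0) f (t m).
  by rewrite big_map big_enum.
exists (2 * D0)^-1, s; split.
- by rewrite invr_gt0 mulr_gt0 ?dgt0.
- by rewrite size_map -cardE cardC1 card_ord.
- by move=> x /mapP[m _ ->].
- move=> x Fx; rewrite sE mulrC ler_pdivrMr ?mul1r ?mulr_gt0 ?dgt0 //.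
  exact: tmax.
- move=> z d D d0 zF; rewrite sE.
  set x := z.1.
  have D_gt0 : 0 < D.
    by apply: lt_le_trans d0 _; have /andP[] := zF _ (tF i0); exact: le_trans.
  (* otherwise the n+1 Lagrange polynomials at Re z would sum to less than 1 *)
  have [i iP] : exists i, (n.+1%:R)^-1 * node_prod t i (t i) <= node_prod t i x.
    apply/not_existsP => h.
    have /(congr1 Num.norm) := lagrange_sum x tI.
    rewrite normr1 => l1.
    have : 1 < 1 :> R.
      rewrite -[X in X < _]l1; apply: le_lt_trans (ler_norm_sum _ _ _) _.
      have e1 : 1 = \sum_(i < n.+1) (n.+1%:R)^-1 :> R.
        by rewrite sumr_const card_ord -[RHS]mulr_natr mulVf // pnatr_eq0.
      rewrite [X in _ < X]e1; apply: ltr_sum; first by apply/hasP; exists ord0 => //; exact: mem_index_enum.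
      move=> i _; rewrite normr_prod.
      have -> : \prod_(m < n.+1 | m != i) `|(x - t m) / (t i - t m)| =
          node_prod t i x / node_prod t i (t i).
        by rewrite /node_prod -prodf_div; apply: eq_bigr => m _; rewrite normrM normfV.
      by rewrite ltr_pdivrMr // ltNge; apply/negP/h.
    by rewrite ltxx.
  pose c m := cmod (z - (t m, 0)).
  have xc m : `|x - t m| <= c m by exact: (normr1_le_cmod (z - (t m, 0))).
  have cd m : d <= c m by have /andP[] := zF _ (tF m).
  have cD m : c m <= D by have /andP[] := zF _ (tF m).
  have c0 m : 0 < c m by exact: lt_le_trans (cd m).
  have h1 : (n.+1%:R)^-1 * D0 <= \prod_(m < n.+1 | m != i) c m.
    apply: le_trans (le_trans iP _).
      by rewrite ler_pM2l ?invr_gt0 ?ltr0n //; exact: i0min.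
    by apply: ler_prod => m _; rewrite normr_ge0 xc.
  (* exchange the node t i for the deleted node t i0 *)
  have h2 : d / D * \prod_(m < n.+1 | m != i) c m <= \prod_(m < n.+1 | m != i0) c m.
    rewrite mulrAC ler_pdivrMr //.
    have e j : \prod_(m < n.+1 | m != j) c m = (\prod_m c m) / c j.
      by rewrite [in RHS](bigD1 j) //= mulrAC mulfV ?mul1r // gt_eqF.
    rewrite !e; set p := \prod_m _.
    have p0 : 0 < p by apply: prodr_gt0.
    rewrite mulrCA -mulrA ler_pM2l // mulrC.
    apply: (@le_trans _ _ 1); first by rewrite ler_pdivrMl ?mulr1.
    by rewrite ler_pdivlMl ?mulr1.
  rewrite ler_pdivlMl ?mulr_gt0 ?dgt0 //; apply: le_trans h2.
  apply: le_trans (_ : d / D * ((n.+1%:R)^-1 * D0) <= _); last first.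
    by rewrite ler_pM2l // divr_gt0.
  rewrite le_eqVlt; apply/orP; left; apply/eqP.
  have n0 : n.+1%:R != 0 :> R by rewrite pnatr_eq0.
  move: (n.+1%:R : R) n0 => N N0.
  by field; rewrite N0 gt_eqF.
Qed.

End Fekete.

(** * Partial derivatives in the plane *)

Section AxisDerivatives.
Context {R : realType}.
Implicit Types (f g : R * R -> R) (z : R * R).

Definition axis_line (b : bool) z (s : R) : R * R :=
  if b then (z.1, s) else (s, z.2).

Definition coord (b : bool) z : R := if b then z.2 else z.1.

Lemma axis_line_coord b z : axis_line b z (coord b z) = z.
Proof. by case: b z => -[]. Qed.

Lemma axis_quotientE b f z :
  (fun h : R => h^-1 *: ((f \o shift z) (h *: axis b) - f z)) =
  (fun h : R => h^-1 *: (((fun s => f (axis_line b z s)) \o shift (coord b z)) (h *: 1) -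
     f (axis_line b z (coord b z)))).
Proof.
apply/funext => h; rewrite axis_line_coord; congr (_ *: (_ - _)) => /=.
congr f; case: b z => -[x y]; rewrite /axis_line /coord /=; congr (_, _) => /=;
  by rewrite /GRing.scale /= ?mulr1 ?mulr0 ?add0r.
Qed.

Lemma is_derive_axisE b f z d :
  is_derive z (axis b) f d <->
  is_derive (coord b z) 1 (fun s => f (axis_line b z s)) d.
Proof.
have e := axis_quotientE b f z.
split=> -[h1 h2]; split.
- by rewrite /derivable -e.
- by rewrite /derive -e.
- by rewrite /derivable e.
- by rewrite /derive e.
Qed.

(** A derivative read off from a quadratic error bound.  Such bounds survive
    pointwise limits, which is how derivatives of limit functions are found. *)
Lemma is_derive_quadratic f z b d (C r : R) : 0 < r ->
    (forall h, `|h| < r -> `|f (axis_line b z (coord b z + h)) - f z - h * d| <= C * h ^+ 2) ->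
  is_derive z (axis b) f d.
Proof.
move=> r0 fC; apply/is_derive_axisE.
have cv : (fun h : R => h^-1 *: (((fun s => f (axis_line b z s)) \o shift (coord b z)) (h *: 1) -
     f (axis_line b z (coord b z)))) @ 0^' --> d.
  apply/cvgrPdist_le => /= e e0.
  near=> h.
  have h0 : h != 0 by near: h; exact: nbhs_dnbhs_neq.
  have hr : `|h| < Num.min r (e / (`|C| + 1)).
    near: h; apply: nbhs_dnbhs.
    apply/nbhs_ballP; exists (Num.min r (e / (`|C| + 1))) => /=.
      by rewrite lt_min r0 divr_gt0 // ltr_wpDl.
    by move=> u; rewrite /ball /= sub0r normrN.
  move: hr; rewrite lt_min => /andP[hr he].
  rewrite axis_line_coord /= /GRing.scale /= mulr1 addrC [h + _]addrC.
  set q := f _ - f z.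
  have -> : - (h^-1 * q) + d = - (h^-1 * (q - h * d)) by field.
  rewrite normrN normrM normfV ler_pdivrMl ?normr_gt0 //.
  apply: le_trans (fC _ hr) _; rewrite -real_normK ?num_real // expr2 mulrCA.
  rewrite ler_pM2l ?normr_gt0 //.
  apply: le_trans (_ : (`|C| + 1) * `|h| <= _).
    by rewrite ler_wpM2r // (le_trans (ler_norm _)) // lerDl.
  by move/ltW: he; rewrite ler_pdivlMr ?ltr_wpDl // mulrC.
split; first by apply/cvg_ex; exists d.
exact: cvg_lim cv.
Unshelve. all: by end_near. Qed.

(** Squares, rather than discs, because the mean value theorem is applied
    along one axis after the other. *)
Definition box z (r : R) z' := `|z'.1 - z.1| < r /\ `|z'.2 - z.2| < r.

Lemma box_nbhs z r : 0 < r -> \forall z' \near z, box z r z'.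
Proof.
move=> r0; exists (ball z.1 r, ball z.2 r) => /=.
  by split; apply: nbhsx_ballx.
by move=> z' [/= h1 h2]; split; rewrite distrC.
Qed.

Lemma nbhs_box (P : set (R * R)) z : nbhs z P ->
  exists2 r, 0 < r & forall z', box z r z' -> P z'.
Proof.
move=> [[A B] [/= /nbhs_ballP[r1 /= r10 rA] /nbhs_ballP[r2 /= r20 rB]] ABP].
exists (Num.min r1 r2); first by rewrite lt_min r10.
move=> z' []; rewrite !lt_min => /andP[h1 _] /andP[_ h2].
by apply: ABP; split => /=; [apply: rA|apply: rB]; rewrite /ball /= distrC.
Qed.

(** The point c stays on the segment, so that it inherits both membership in the
    square and closeness to z. *)
Lemma mvt_axis b f g z z0 (r M : R) s : (forall z', box z0 r z' -> is_derive z' (axis b) f (g z')) ->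
    (forall z', box z0 r z' -> `|g z'| <= M) ->
    box z0 r z -> box z0 r (axis_line b z s) ->
  exists2 c, (exists2 u, c = axis_line b z u & `|u - coord b z| <= `|s - coord b z|) /\ box z0 r c &
    f (axis_line b z s) - f z = g c * (s - coord b z).
Proof.
move=> fg gM zb sb.
have inbox u : Num.min s (coord b z) <= u <= Num.max s (coord b z) -> box z0 r (axis_line b z u).
  move: zb sb; rewrite /box /coord /axis_line => -[z1 z2] [s1 s2].
  case: b fg s1 s2 => _ /= s1 s2 /andP[]; rewrite ge_min le_max => h1 h2; split => //;
  rewrite ltr_norml; move: z1 z2 s1 s2; rewrite !ltr_norml;
  move=> /andP[? ?] /andP[? ?] /andP[? ?] /andP[? ?];
  apply/andP; split; case/orP: h1 => ?; case/orP: h2 => ?; lra.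
have dF u : Num.min s (coord b z) <= u <= Num.max s (coord b z) ->
    is_derive u 1 (fun s => f (axis_line b z s)) (g (axis_line b z u)).
  move=> /inbox/fg/is_derive_axisE.
  have -> : coord b (axis_line b z u) = u by rewrite /coord /axis_line; case: b {inbox fg sb}.
  suff -> : axis_line b (axis_line b z u) = axis_line b z by [].
  by apply/funext => v; rewrite /axis_line; case: b {inbox fg sb}.
have cF u v : Num.min s (coord b z) <= u -> v <= Num.max s (coord b z) ->
    {within `[u, v], continuous (fun s => f (axis_line b z s))}.
  move=> ? ?; apply: derivable_within_continuous => w /[!in_itv] /= /andP[? ?].
  by case: (dF w) => //; apply/andP; split; lra.
have [sz|zs] := leP s (coord b z).
- have [] := @MVT_segment _ (fun s => f (axis_line b z s)) (fun u => g (axis_line b z u)) s (coord b z) sz.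
  + move=> x /[!in_itv] /= /andP[h1 h2]; apply: dF.
    by rewrite ge_min le_max (ltW h1) (ltW h2) ?orbT.
  + by apply: cF; rewrite ?ge_min ?le_max lexx ?orbT.
  move=> c; rewrite in_itv /= => /andP[sc cz]; rewrite axis_line_coord => e.
  exists (axis_line b z c).
    split; last by apply: inbox; rewrite ge_min sc le_max cz orbT.
    exists c => //; rewrite ler0_norm ?subr_le0 // ler0_norm ?subr_le0 //; lra.
  by rewrite -opprB e -mulrN opprB.
- have [] := @MVT_segment _ (fun s => f (axis_line b z s)) (fun u => g (axis_line b z u)) (coord b z) s (ltW zs).
  + move=> x /[!in_itv] /= /andP[h1 h2]; apply: dF.
    by rewrite ge_min le_max (ltW h1) (ltW h2) ?orbT.
  + by apply: cF; rewrite ?ge_min ?le_max lexx ?orbT.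
  move=> c; rewrite in_itv /= => /andP[sc cz]; rewrite axis_line_coord => e.
  exists (axis_line b z c) => //.
    split; last by apply: inbox; rewrite ge_min sc le_max cz orbT.
    exists c => //; rewrite ger0_norm ?subr_ge0 // ger0_norm ?subr_ge0 //; last exact: ltW.
    lra.
Qed.

Lemma lipschitz_box f z0 r M : (forall b, exists2 g, (forall z', box z0 r z' -> is_derive z' (axis b) f (g z')) &
    (forall z', box z0 r z' -> `|g z'| <= M)) ->
  forall z z', box z0 r z -> box z0 r z' -> `|f z' - f z| <= M * (`|z'.1 - z.1| + `|z'.2 - z.2|).
Proof.
move=> fg z z' zb z'b.
have zz'b : box z0 r (z'.1, z.2) by case: zb z'b => ? ? [].
have [g1 g1f g1M] := fg false.
have [g2 g2f g2M] := fg true.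
have [c1 [_ c1b] e1] := mvt_axis (s := z'.1) g1f g1M zb zz'b.
have [c2 [_ c2b] e2] := mvt_axis (z := (z'.1, z.2)) (s := z'.2) g2f g2M zz'b z'b.
move: e1 e2; rewrite /axis_line /coord /= -surjective_pairing => e1 e2.
have -> : f z' - f z = (f z' - f (z'.1, z.2)) + (f (z'.1, z.2) - f z) by rewrite addrA subrK.
rewrite e1 e2 (le_trans (ler_normD _ _)) // !normrM mulrDr addrC.
by rewrite lerD // ler_wpM2r ?g1M ?g2M.
Qed.

Lemma quadratic_of_lipschitz b f g z0 r M z h :
    (forall z', box z0 r z' -> is_derive z' (axis b) f (g z')) ->
    (forall z', box z0 r z' -> `|g z'| <= M) ->
    (forall z z', box z0 r z -> box z0 r z' -> `|g z' - g z| <= M * (`|z'.1 - z.1| + `|z'.2 - z.2|)) ->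
    box z0 r z -> box z0 r (axis_line b z (coord b z + h)) ->
  `|f (axis_line b z (coord b z + h)) - f z - h * g z| <= M * h ^+ 2.
Proof.
move=> fg gM gL zb hb.
have [c [[u cE cu] cb] ->] := mvt_axis fg gM zb hb.
have -> : coord b z + h - coord b z = h by lra.
have -> : g c * h - h * g z = (g c - g z) * h by lra.
move: cu; have -> : coord b z + h - coord b z = h by lra.
move=> cu.
rewrite normrM -(real_normK (num_real h)) expr2 mulrA ler_wpM2r //.
apply: le_trans (gL _ _ zb cb) _; rewrite ler_wpM2l //.
  by apply: le_trans (gM _ zb).
rewrite cE /axis_line; case: b cu {fg hb cE} => /=; rewrite subrr normr0 ?addr0 ?add0r //.
Qed.

End AxisDerivatives.

(** * The logarithm of the modulus of an affine function *)

Section AxisInverse.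
Context {R : realType}.

Lemma is_derive_axisV (f : R * R -> R) (z : R * R) i d : f z != 0 ->
  is_derive z (axis i) f d ->
  is_derive z (axis i) (fun z => (f z)^-1) (- (f z) ^- 2 * d).
Proof.
move=> fz /is_derive_axisE h; apply/is_derive_axisE.
have fz' : f (axis_line i z (coord i z)) != 0 by rewrite axis_line_coord.
by apply: is_derive_eq (is_deriveV fz' h) _; rewrite axis_line_coord.
Qed.

End AxisInverse.

Section InversePowers.
Context {R : realType}.
Variables a b : R.
Implicit Types z : R * R.

Definition lin_re z : R := a * z.1 + b.
Definition lin_im z : R := a * z.2.
Definition lin_sq z : R := lin_re z ^+ 2 + lin_im z ^+ 2.

Definition inv_re z : R := lin_re z / lin_sq z.
Definition inv_im z : R := - lin_im z / lin_sq z.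

(** Real and imaginary parts of (a z + b)^-n: up to sign, these are the partial
    derivatives of log|a z + b|. *)
Fixpoint inv_pow (n : nat) z : R * R :=
  if n is m.+1 then
    let q := inv_pow m z in
    (q.1 * inv_re z - q.2 * inv_im z, q.1 * inv_im z + q.2 * inv_re z)
  else (1, 0).

Definition log_lin z : R := ln (lin_sq z) / 2.

Lemma is_derive_lin (x k : R) : is_derive x 1 (fun s : R => a * s + k) a.
Proof.
have h : is_derive x 1 ((a \*: id + cst k) : R -> R) (a *: 1 + 0).
  exact: is_deriveD.
by apply: is_derive_eq h _; rewrite addr0 /GRing.scale /= mulr1.
Qed.

Lemma is_derive_lin_sq z i :
  is_derive z (axis i) lin_sq (2 * a * (if i then lin_im z else lin_re z)).
Proof.
apply/is_derive_axisE.
case: i; rewrite /lin_sq /lin_re /lin_im /axis_line /coord /=.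
- have h : is_derive z.2 1 ((cst ((a * z.1 + b) ^+ 2) + (fun s : R => a * s + 0) ^+ 2) : R -> R)
      (0 + (2%:R * (a * z.2 + 0) ^+ 1) *: a).
    by apply: is_deriveD; apply: is_deriveX; exact: is_derive_lin.
  have -> : (fun s : R => (a * z.1 + b) ^+ 2 + (a * s) ^+ 2) =
      ((cst ((a * z.1 + b) ^+ 2) + (fun s : R => a * s + 0) ^+ 2) : R -> R).
    by apply/funext => s; rewrite /= -[in LHS](addr0 (a * s)).
  by apply: is_derive_eq h _; rewrite /GRing.scale /=; lra.
- have h : is_derive z.1 1 ((fun s : R => a * s + b) ^+ 2 + cst ((a * z.2) ^+ 2) : R -> R)
      ((2%:R * (a * z.1 + b) ^+ 1) *: a + 0).
    by apply: is_deriveD; apply: is_deriveX; exact: is_derive_lin.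
  by apply: is_derive_eq h _; rewrite /GRing.scale /=; lra.
Qed.

Lemma is_derive_lin_re z i : is_derive z (axis i) lin_re (if i then 0 else a).
Proof.
apply/is_derive_axisE; case: i; rewrite /lin_re /axis_line /coord /=.
  exact: is_derive_cst.
exact: is_derive_lin.
Qed.

Lemma is_derive_lin_im z i : is_derive z (axis i) lin_im (if i then a else 0).
Proof.
apply/is_derive_axisE; case: i; rewrite /lin_im /axis_line /coord /=; last exact: is_derive_cst.
have := is_derive_lin z.2 0.
suff -> : (fun s : R => a * s + 0) = (fun s : R => a * s) by [].
by apply/funext => s; rewrite addr0.
Qed.

Lemma is_derive_log_lin z i : 0 < lin_sq z ->
  is_derive z (axis i) log_lin (if i then - a * inv_im z else a * inv_re z).
Proof.
move=> z0; apply/is_derive_axisE.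
have /is_derive_axisE h := is_derive_lin_sq z i.
have : is_derive (coord i z) 1 ((2^-1 \*: (@ln R \o (fun s => lin_sq (axis_line i z s)))) : R -> R)
    (2^-1 *: ((lin_sq z)^-1 * (2 * a * (if i then lin_im z else lin_re z)))).
  apply: is_deriveZ; apply: is_derive1_comp.
  by rewrite axis_line_coord; exact: is_derive1_ln.
have -> : (2^-1 \*: (@ln R \o (fun s => lin_sq (axis_line i z s))) : R -> R) =
    (fun s => log_lin (axis_line i z s)).
  by apply/funext => s; rewrite /log_lin /= /GRing.scale /= mulrC.
move=> h2; apply: is_derive_eq h2 _.
by rewrite /GRing.scale /= /inv_im /inv_re; case: i {h}; field; rewrite gt_eqF.
Qed.

Lemma is_derive_inv_re z i : lin_sq z != 0 ->
  is_derive z (axis i) inv_re (a * if i then (inv_pow 2 z).2 else - (inv_pow 2 z).1).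
Proof.
move=> z0.
have h := is_deriveM (is_derive_lin_re z i) (is_derive_axisV z0 (is_derive_lin_sq z i)).
apply: is_derive_eq h _.
rewrite /= /GRing.scale /= /inv_re /inv_im.
by case: i; move: z0; rewrite /lin_sq /lin_re /lin_im => z0; field.
Qed.

Lemma is_derive_inv_im z i : lin_sq z != 0 ->
  is_derive z (axis i) inv_im (a * if i then - (inv_pow 2 z).1 else - (inv_pow 2 z).2).
Proof.
move=> z0.
have h := is_deriveM (is_deriveN (is_derive_lin_im z i)) (is_derive_axisV z0 (is_derive_lin_sq z i)).
apply: is_derive_eq h _.
rewrite -[(- lin_im) z]/(- lin_im z) /= /GRing.scale /= /inv_re /inv_im.
by case: i; move: z0; rewrite /lin_sq /lin_re /lin_im => z0; field.
Qed.

Lemma is_derive_inv_pow z i n : lin_sq z != 0 ->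
  is_derive z (axis i) (fun z => (inv_pow n z).1)
    (n%:R * a * if i then (inv_pow n.+1 z).2 else - (inv_pow n.+1 z).1) /\
  is_derive z (axis i) (fun z => (inv_pow n z).2)
    (n%:R * a * if i then - (inv_pow n.+1 z).1 else - (inv_pow n.+1 z).2).
Proof.
move=> z0; elim: n => [|n [h1 h2]].
  by rewrite !mul0r; split; exact: is_derive_cst.
have c1 := is_derive_inv_re i z0.
have c2 := is_derive_inv_im i z0.
split.
- have h := is_deriveB (is_deriveM h1 c1) (is_deriveM h2 c2).
  apply: is_derive_eq h _; rewrite /GRing.scale /= -natr1.
  by case: i {h1 h2 c1 c2}; move: (inv_pow n z) => -[u v] /=; ring.
- have h := is_deriveD (is_deriveM h1 c2) (is_deriveM h2 c1).
  apply: is_derive_eq h _; rewrite /GRing.scale /= -natr1.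
  by case: i {h1 h2 c1 c2}; move: (inv_pow n z) => -[u v] /=; ring.
Qed.

Lemma inv_pow_sq n z : lin_sq z != 0 ->
  (inv_pow n z).1 ^+ 2 + (inv_pow n z).2 ^+ 2 = (lin_sq z) ^- n.
Proof.
move=> z0; elim: n => [|n IH]; first by rewrite /= expr0 invr1; ring.
rewrite [in RHS]exprS invfM -IH /= /inv_re /inv_im; move: z0.
case: (inv_pow n z) => u v /=.
by rewrite /lin_sq; move: (lin_re z) (lin_im z) => x y z0; field.
Qed.

(** The square of the modulus of (a z + b)^-n is |a z + b|^-2n. *)
Lemma inv_pow_bound n z d : 0 < d -> d ^+ 2 <= lin_sq z ->
  `|(inv_pow n z).1| <= d ^- n /\ `|(inv_pow n z).2| <= d ^- n.
Proof.
move=> d0 dz.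
have z0 : 0 < lin_sq z by apply: lt_le_trans dz; exact: exprn_gt0.
have h : (inv_pow n z).1 ^+ 2 + (inv_pow n z).2 ^+ 2 <= (d ^- n) ^+ 2.
  rewrite inv_pow_sq ?gt_eqF // exprVn -exprM mulnC exprM.
  by rewrite lef_pV2 ?posrE ?exprn_gt0 // lerXn2r // nnegrE ltW // exprn_gt0.
have dn : 0 <= d ^- n by rewrite invr_ge0 exprn_ge0 // ltW.
split; rewrite -ler_sqr ?nnegrE // real_normK ?num_real // (le_trans _ h) //.
  by rewrite lerDl sqr_ge0.
by rewrite lerDr sqr_ge0.
Qed.

End InversePowers.

(** * Limits of harmonic functions along ultrafilters *)

Section UltraLimits.
Context {R : realType}.
Variables (U : set_system nat) (UU : UltraFilter U).

(** Ultrafilters replace the extraction of subsequences: every bounded sequence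
    converges along a given one. *)
Lemma bounded_ultra_cvg (x : nat -> R) (M : R) : (\forall m \near U, `|x m| <= M) ->
  exists l : R, x m @[m --> U] --> l.
Proof.
move=> xM.
have := @segment_compact R (-M) M; rewrite compact_ultra => /(_ (fmap x U)).
have UxU : UltraFilter (fmap x U).
  split; first exact: fmap_proper_filter.
  move=> G PG xG.
  rewrite eqEsubset; split => // A GA /=.
  have [//|nA] := in_ultra_setVsetC (x @^-1` A) UU.
  have : G (~` A) by apply: xG.
  by move/(filterI GA); rewrite setICr => /filter_not_empty.
move/(_ UxU); case.
  by near=> m; rewrite /= in_itv /= -ler_norml; near: m.
by move=> l [_ xl]; exists l.
Unshelve. all: by end_near. Qed.

Lemma ultra_lim_norm_le (x : nat -> R) (l M : R) :
  x m @[m --> U] --> l -> (\forall m \near U, `|x m| <= M) -> `|l| <= M.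
Proof.
move=> xl xM.
apply: (closed_cvg [set y : R | `|y| <= M] _ _ _ xl) => //.
have -> : [set y : R | `|y| <= M] = `[- M, M]%classic.
  by apply/seteqP; split => y; rewrite /= in_itv /= ler_norml.
exact: interval_closed.
Qed.

End UltraLimits.

Section TameHarmonic.
Context {R : realType}.
Implicit Types (f : R * R -> R) (z : R * R).

(** First and second derivatives of f on a square, all controlled by the one
    constant M; with M fixed, this amount of regularity passes to pointwise
    limits. *)
Definition tame_data z0 (r M : R) f (g : bool -> R * R -> R) (h : bool -> bool -> R * R -> R) :=
  forall z, box z0 r z ->
  [/\ forall i, is_derive z (axis i) f (g i z),
      forall i j, is_derive z (axis j) (g i) (h i j z),
      forall i j, `|g i z| <= M /\ `|h i j z| <= M,
      h false false z + h true true z = 0 &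
      forall z' i j, box z0 r z' -> `|h i j z' - h i j z| <= M * (`|z'.1 - z.1| + `|z'.2 - z.2|)].

Definition tame_harmonic z0 r M f := exists g h, tame_data z0 r M f g h.

Lemma tame_harmonicW z0 r r' M M' f : r' <= r -> M <= M' ->
  tame_harmonic z0 r M f -> tame_harmonic z0 r' M' f.
Proof.
move=> rr MM [g [h gh]]; exists g, h => z [z1 z2].
have W z' : box z0 r' z' -> box z0 r z'.
  by case=> ? ?; split; apply: lt_le_trans rr.
have [? ? bd ? lip] := gh z (W z (conj z1 z2)).
split => // [i j|z' i j z'b].
  by have [? ?] := bd i j; split; apply: le_trans MM.
by apply: le_trans (lip _ _ _ (W _ z'b)) _; rewrite ler_wpM2r // addr_ge0.
Qed.

Lemma tame_harmonic_cst z0 r (c : R) : tame_harmonic z0 r 0 (fun=> c).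
Proof.
exists (fun _ _ => 0), (fun _ _ _ => 0) => z _; split => //.
- by move=> i; exact: is_derive_cst.
- by move=> i j; exact: is_derive_cst.
- by rewrite normr0.
- by rewrite addr0.
- by move=> *; rewrite subrr normr0 mul0r.
Qed.

Lemma tame_harmonicD z0 r M1 M2 f1 f2 : tame_harmonic z0 r M1 f1 -> tame_harmonic z0 r M2 f2 ->
  tame_harmonic z0 r (M1 + M2) (fun z => f1 z + f2 z).
Proof.
move=> [g1 [h1 gh1]] [g2 [h2 gh2]].
exists (fun i z => g1 i z + g2 i z), (fun i j z => h1 i j z + h2 i j z) => z zb.
have [fg1 dg1 bd1 lap1 lip1] := gh1 z zb.
have [fg2 dg2 bd2 lap2 lip2] := gh2 z zb.
split.
- by move=> i; exact: (is_deriveD (fg1 i) (fg2 i)).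
- by move=> i j; exact: (is_deriveD (dg1 i j) (dg2 i j)).
- move=> i j; have [? ?] := bd1 i j; have [? ?] := bd2 i j.
  by split; apply: le_trans (ler_normD _ _) _; exact: lerD.
- by rewrite addrACA lap1 lap2 addr0.
- move=> z' i j z'b; rewrite opprD addrACA mulrDl.
  by apply: le_trans (ler_normD _ _) _; rewrite lerD ?lip1 ?lip2.
Qed.

Lemma tame_harmonicZ z0 r M f (c : R) : tame_harmonic z0 r M f ->
  tame_harmonic z0 r (`|c| * M) (fun z => c * f z).
Proof.
move=> [g [h gh]].
exists (fun i z => c * g i z), (fun i j z => c * h i j z) => z zb.
have [fg dg bd lap lip] := gh z zb.
split.
- by move=> i; exact: (is_deriveZ c (fg i)).
- by move=> i j; exact: (is_deriveZ c (dg i j)).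
- move=> i j; have [? ?] := bd i j.
  by rewrite !normrM !ler_wpM2l.
- by rewrite -mulrDr lap mulr0.
- move=> z' i j z'b; rewrite -mulrBr normrM -mulrA ler_wpM2l //.
  exact: lip.
Qed.

Lemma tame_harmonic_sum (T : eqType) (s : seq T) z0 r M (F : T -> R * R -> R) :
  {in s, forall t, tame_harmonic z0 r M (F t)} ->
  tame_harmonic z0 r ((size s)%:R * M) (fun z => \sum_(t <- s) F t z).
Proof.
elim: s => [|t s IH] sF.
  rewrite mul0r; under eq_fun do rewrite big_nil; exact: tame_harmonic_cst.
rewrite /= -natr1 mulrDl mul1r addrC.
under eq_fun do rewrite big_cons.
apply: tame_harmonicD; first by apply: sF; rewrite mem_head.
by apply: IH => u us; apply: sF; rewrite in_cons us orbT.
Qed.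

Lemma box_axis_line z0 r z i : box z0 r z ->
  exists2 e, 0 < e & forall h, `|h| < e -> box z0 r (axis_line i z (coord i z + h)).
Proof.
move=> [z1 z2].
exists (Num.min (r - `|z.1 - z0.1|) (r - `|z.2 - z0.2|)).
  by rewrite lt_min !subr_gt0 z1.
move=> h; rewrite lt_min !ltrBrDl => /andP[h1 h2].
rewrite /axis_line /coord; case: i; split => //=.
- by rewrite addrAC (le_lt_trans (ler_normD _ _)).
- by rewrite addrAC (le_lt_trans (ler_normD _ _)).
Qed.

Lemma box_near z0 r z : box z0 r z -> \forall z' \near z, box z0 r z'.
Proof.
move=> [z1 z2].
have e0 : 0 < Num.min (r - `|z.1 - z0.1|) (r - `|z.2 - z0.2|).
  by rewrite lt_min !subr_gt0 z1.
have := box_nbhs z e0; apply: filterS => z' [].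
rewrite !lt_min !ltrBrDl => /andP[h1 _] /andP[_ h2]; split.
- have -> : z'.1 - z0.1 = (z.1 - z0.1) + (z'.1 - z.1) by lra.
  exact: le_lt_trans (ler_normD _ _) _.
- have -> : z'.2 - z0.2 = (z.2 - z0.2) + (z'.2 - z.2) by lra.
  exact: le_lt_trans (ler_normD _ _) _.
Qed.

Lemma lipschitz_continuous_box z0 r M (f : R * R -> R) z : box z0 r z ->
  (forall z', box z0 r z' -> `|f z' - f z| <= M * (`|z'.1 - z.1| + `|z'.2 - z.2|)) ->
  {for z, continuous f}.
Proof.
move=> zb fL; apply/cvgrPdist_lt => e e0.
have M1 : 0 < `|M| + 1 by rewrite ltr_wpDl.
have d0 : 0 < e / (2 * (`|M| + 1)) by rewrite divr_gt0 // mulr_gt0.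
near=> z'.
have z'b : box z0 r z' by near: z'; exact: box_near.
rewrite distrC; apply: le_lt_trans (fL _ z'b) _.
have [h1 h2] : box z (e / (2 * (`|M| + 1))) z' by near: z'; exact: box_nbhs.
apply: le_lt_trans (_ : (`|M| + 1) * (`|z'.1 - z.1| + `|z'.2 - z.2|) < _).
  by rewrite ler_wpM2r ?addr_ge0 // (le_trans (ler_norm _)) // lerDl.
rewrite mulrC -ltr_pdivlMr //; apply: lt_le_trans (ltrD h1 h2) _.
by rewrite le_eqVlt; apply/orP; left; apply/eqP; field; rewrite gt_eqF // addrC.
Unshelve. all: by end_near. Qed.

Lemma tame_plane_harmonic z0 r M f : 0 < r -> tame_harmonic z0 r M f -> plane_harmonic_at f z0.
Proof.
move=> r0 [g [h gh]]; rewrite /plane_harmonic_at.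
near=> z.
have zb : box z0 r z by near: z; exact: box_nbhs.
have Df z' i : box z0 r z' -> 'D_(axis i) f z' = g i z'.
  by move=> /gh[/(_ i) fg _ _ _ _]; exact: derive_val.
have Dg z' i j : box z0 r z' -> is_derive z' (axis j) ('D_(axis i) f) (h i j z').
  move=> z'b; have [_ dg _ _ _] := gh _ z'b.
  apply: (near_eq_is_derive _ (dg i j)).
  near=> u.
  have ub : box z0 r u by near: u; exact: box_near.
  by rewrite Df.
have [fg dg bd lap lip] := gh z zb.
split.
- by move=> i; have [] := fg i.
- by move=> i j; have [] := Dg _ i j zb.
- move=> i j.
  have e z' : box z0 r z' -> 'D_(axis j) ('D_(axis i) f) z' = h i j z'.
    by move=> z'b; have [_ ->] := Dg _ i j z'b.
  apply: (@lipschitz_continuous_box z0 r M) => // z' z'b.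
  by rewrite !e //; exact: lip.
- by have [_ ->] := Dg _ false false zb; have [_ ->] := Dg _ true true zb.
Unshelve. all: by end_near. Qed.

(** Harnack-type compactness: the derivatives converge along the ultrafilter
    because they are bounded, and the uniform quadratic Taylor estimates
    identify their limits as derivatives of the limit. *)
Lemma tame_harmonic_ultra_lim (U : set_system nat) (UU : UltraFilter U)
    (F : nat -> R * R -> R) f z0 r M :
    (\forall m \near U, tame_harmonic z0 r M (F m)) ->
    (forall z, box z0 r z -> F m z @[m --> U] --> f z) ->
  tame_harmonic z0 r M f.
Proof.
move=> FM Ff.
have /choice[gh ghP] : forall m, exists gh : (bool -> R * R -> R) * (bool -> bool -> R * R -> R),
    tame_harmonic z0 r M (F m) -> tame_data z0 r M (F m) gh.1 gh.2.
  move=> m; have [[g [h ?]]|?] := pselect (tame_harmonic z0 r M (F m)).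
    by exists (g, h).
  by exists ((fun _ _ => 0), (fun _ _ _ => 0)).
have GH : \forall m \near U, tame_data z0 r M (F m) (gh m).1 (gh m).2.
  by apply: filterS FM.
have /choice[g gP] : forall iz : bool * (R * R), exists l : R,
    box z0 r iz.2 -> (gh m).1 iz.1 iz.2 @[m --> U] --> l.
  move=> [i z]; have [zb|?] := pselect (box z0 r z); last by exists 0.
  have [|l ?] := @bounded_ultra_cvg _ U UU (fun m => (gh m).1 i z) M; last by exists l.
  by apply: filterS GH => m /(_ z zb)[_ _ /(_ i i)[]].
have /choice[h hP] : forall iz : (bool * bool) * (R * R), exists l : R,
    box z0 r iz.2 -> (gh m).2 iz.1.1 iz.1.2 iz.2 @[m --> U] --> l.
  move=> [[i j] z]; have [zb|?] := pselect (box z0 r z); last by exists 0.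
  have [|l ?] := @bounded_ultra_cvg _ U UU (fun m => (gh m).2 i j z) M; last by exists l.
  by apply: filterS GH => m /(_ z zb)[_ _ /(_ i j)[]].
have {}gP i z : box z0 r z -> (gh m).1 i z @[m --> U] --> g (i, z) by apply: (gP (i, z)).
have {}hP i j z : box z0 r z -> (gh m).2 i j z @[m --> U] --> h ((i, j), z) by apply: (hP ((i, j), z)).
have glip : \forall m \near U, forall i z z', box z0 r z -> box z0 r z' ->
    `|(gh m).1 i z' - (gh m).1 i z| <= M * (`|z'.1 - z.1| + `|z'.2 - z.2|).
  apply: filterS GH => m mgh i z z' zb z'b.
  apply: (lipschitz_box (z0 := z0) (r := r)) => // j.
  by exists ((gh m).2 i j) => u ub; have [_ /(_ i j) ? /(_ i j)[]] := mgh _ ub.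
exists (fun i z => g (i, z)), (fun i j z => h ((i, j), z)) => z zb; split.
- move=> i; have [e e0 eb] := box_axis_line i zb.
  apply: (@is_derive_quadratic _ f z i _ M e e0) => u ue.
  apply: (@ultra_lim_norm_le _ U UU (fun m => F m (axis_line i z (coord i z + u)) - F m z - u * (gh m).1 i z)).
    apply: cvgB; last by apply: cvgMr; exact: gP.
    by apply: cvgB; apply: Ff => //; exact: eb.
  near=> m.
  have mgh : tame_data z0 r M (F m) (gh m).1 (gh m).2 by near: m.
  apply: (quadratic_of_lipschitz (z0 := z0) (r := r)) => //.
  + by move=> z' /mgh[].
  + by move=> z' /mgh[_ _ /(_ i i)[]].
  + by near: m; apply: filterS glip => m + z1 z2; apply.
  + exact: eb.
- move=> i j; have [e e0 eb] := box_axis_line j zb.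
  apply: (@is_derive_quadratic _ (fun z => g (i, z)) z j _ M e e0) => u ue.
  apply: (@ultra_lim_norm_le _ U UU (fun m => (gh m).1 i (axis_line j z (coord j z + u)) - (gh m).1 i z - u * (gh m).2 i j z)).
    apply: cvgB; last by apply: cvgMr; exact: hP.
    by apply: cvgB; apply: gP => //; exact: eb.
  near=> m.
  have mgh : tame_data z0 r M (F m) (gh m).1 (gh m).2 by near: m.
  apply: (quadratic_of_lipschitz (z0 := z0) (r := r)) => //.
  + by move=> z' /mgh[_ /(_ i j)].
  + by move=> z' /mgh[_ _ /(_ i j)[]].
  + by move=> z1 z2 z1b /[dup] z2b /mgh[_ _ _ _ _]; have [_ _ _ _] := mgh _ z1b; apply.
  + exact: eb.
- move=> i j; split.
    apply: (@ultra_lim_norm_le _ U UU _ _ _ (gP i z zb)).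
    by apply: filterS GH => m /(_ z zb)[_ _ /(_ i j)[]].
  apply: (@ultra_lim_norm_le _ U UU _ _ _ (hP i j z zb)).
  by apply: filterS GH => m /(_ z zb)[_ _ /(_ i j)[]].
- apply/eqP; rewrite -normr_le0.
  apply: (@ultra_lim_norm_le _ U UU _ _ _ (cvgD (hP false false z zb) (hP true true z zb))).
  by apply: filterS GH => m /(_ z zb)[_ _ _ /= -> _]; rewrite normr0.
- move=> z' i j z'b.
  apply: (@ultra_lim_norm_le _ U UU _ _ _ (cvgB (hP i j z' z'b) (hP i j z zb))).
  by apply: filterS GH => m /(_ z zb)[_ _ _ _]; apply.
Unshelve. all: by end_near. Qed.

End TameHarmonic.

(** * Harmonicity of logarithms and the sign of the Laplacian *)

Section LogKernel.
Context {R : realType}.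

(** The bounds depend only on |a| and on the distance to the zero of a z + b, so
    they are uniform over all Fekete points. *)
Lemma log_lin_tame (a b A d : R) z0 r : 0 < d -> `|a| <= A ->
    (forall z, box z0 r z -> d ^+ 2 <= lin_sq a b z) ->
  tame_harmonic z0 r (A / d + A ^+ 2 / d ^+ 2 + 2 * A ^+ 3 / d ^+ 3) (log_lin a b).
Proof.
move=> d0 aA dz.
have A0 : 0 <= A by exact: le_trans aA.
have z_gt0 z : box z0 r z -> 0 < lin_sq a b z.
  by move=> /dz; apply: lt_le_trans; exact: exprn_gt0.
have z_neq0 z : box z0 r z -> lin_sq a b z != 0 by move=> /z_gt0 /lt0r_neq0.
pose g (i : bool) z := a * if i then - (inv_pow a b 1 z).2 else (inv_pow a b 1 z).1.
pose h (i j : bool) z := a ^+ 2 *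
  (if i == j then (if i then (inv_pow a b 2 z).1 else - (inv_pow a b 2 z).1)
   else (inv_pow a b 2 z).2).
have A1 : 0 <= A / d by rewrite divr_ge0 // ltW.
have A2 : 0 <= A ^+ 2 / d ^+ 2 by rewrite divr_ge0 // exprn_ge0 // ltW.
have A3 : 0 <= 2 * A ^+ 3 / d ^+ 3 by rewrite divr_ge0 // ?mulr_ge0 ?exprn_ge0 // ltW.
exists g, h => z zb; split.
- move=> i; apply: is_derive_eq (is_derive_log_lin i (z_gt0 _ zb)) _.
  by rewrite /g; case: i => /=; rewrite !mul1r !mul0r ?subr0 ?addr0 ?mulrN ?mulNr.
- move=> i j; have [d1 d2] := is_derive_inv_pow j 1 (z_neq0 _ zb).
  case: i; rewrite /g /h.
    have := is_deriveZ a (is_deriveN d2) => dd.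
    apply: is_derive_eq dd _; rewrite /GRing.scale /=.
    by case: j {d1 d2} => /=; ring.
  have := is_deriveZ a d1 => dd.
  apply: is_derive_eq dd _; rewrite /GRing.scale /=.
  by case: j {d1 d2} => /=; ring.
- move=> i j.
  have [b1 b2] := inv_pow_bound 1 d0 (dz _ zb).
  have [b3 b4] := inv_pow_bound 2 d0 (dz _ zb).
  split.
    rewrite /g normrM; apply: (@le_trans _ _ (A / d)); last lra.
    apply: ler_pM => //; case: i; rewrite ?normrN ?(le_trans b1) ?(le_trans b2) //;
      by rewrite expr1.
  rewrite /h normrM normrX; apply: (@le_trans _ _ (A ^+ 2 / d ^+ 2)); last lra.
  apply: ler_pM => //.
    by rewrite lerXn2r // nnegrE.
  by case: (i); case: (j) => //=; rewrite ?normrN.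
- by rewrite /h /= mulrN addNr.
- move=> z' i j z'b.
  have Mle : 2 * A ^+ 3 / d ^+ 3 <= A / d + A ^+ 2 / d ^+ 2 + 2 * A ^+ 3 / d ^+ 3 by lra.
  apply: le_trans (_ : 2 * A ^+ 3 / d ^+ 3 * (`|z'.1 - z.1| + `|z'.2 - z.2|) <= _); last first.
    by rewrite ler_wpM2r // addr_ge0.
  have key (q : R * R -> R) (dq : bool -> R * R -> R) :
     (forall k u, box z0 r u -> is_derive u (axis k) q (2 * a * dq k u)) ->
     (forall k u, box z0 r u -> `|dq k u| <= d ^- 3) ->
     `|a ^+ 2 * (q z' - q z)| <= 2 * A ^+ 3 / d ^+ 3 * (`|z'.1 - z.1| + `|z'.2 - z.2|).
    move=> qd qb.
    have : `|q z' - q z| <= (2 * A / d ^+ 3) * (`|z'.1 - z.1| + `|z'.2 - z.2|).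
      apply: (lipschitz_box (z0 := z0) (r := r)) => // k.
      exists (fun u => 2 * a * dq k u); first by move=> u; exact: qd.
      move=> u ub; rewrite !normrM ger0_norm // ler_pM // ?mulr_ge0 //.
        by rewrite ler_wpM2l.
      exact: qb.
    move=> ql; rewrite normrM normrX.
    have -> : 2 * A ^+ 3 / d ^+ 3 * (`|z'.1 - z.1| + `|z'.2 - z.2|) =
      A ^+ 2 * (2 * A / d ^+ 3 * (`|z'.1 - z.1| + `|z'.2 - z.2|)) by ring.
    by rewrite ler_pM // ?exprn_ge0 // lerXn2r // nnegrE.
  have bd k u : box z0 r u -> `|if k then (inv_pow a b 3 u).2 else - (inv_pow a b 3 u).1| <= d ^- 3.
    move=> ub; have [? ?] := inv_pow_bound 3 d0 (dz _ ub).
    by case: k; rewrite ?normrN.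
  have bd' k u : box z0 r u -> `|if k then - (inv_pow a b 3 u).1 else - (inv_pow a b 3 u).2| <= d ^- 3.
    move=> ub; have [? ?] := inv_pow_bound 3 d0 (dz _ ub).
    by case: k; rewrite ?normrN.
  have k1 := key (fun z => (inv_pow a b 2 z).1) _
    (fun k u ub => (is_derive_inv_pow k 2 (z_neq0 _ ub)).1) bd.
  have k2 := key (fun z => (inv_pow a b 2 z).2) _
    (fun k u ub => (is_derive_inv_pow k 2 (z_neq0 _ ub)).2) bd'.
  rewrite /h -mulrBr; case: (i); case: (j) => //=.
  by rewrite -opprD mulrN normrN.
Qed.

End LogKernel.

Section Laplacian.
Context {R : realType}.
Implicit Types (f : R * R -> R) (z : R * R).

(** Only the pure second derivatives, at a single point: the notion in which a
    sum with the non-harmonic function |zeta|^2 has a negative Laplacian. *)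
Definition has_laplacian f z (l : R) := exists (g : bool -> R * R -> R) (h : bool -> R),
  [/\ \forall z' \near z, forall i, is_derive z' (axis i) f (g i z'),
      forall i, is_derive z (axis i) (g i) (h i) & h false + h true = l].

Lemma has_laplacianD f1 f2 z l1 l2 : has_laplacian f1 z l1 -> has_laplacian f2 z l2 ->
  has_laplacian (fun z => f1 z + f2 z) z (l1 + l2).
Proof.
move=> [g1 [h1 [d1 e1 s1]]] [g2 [h2 [d2 e2 s2]]].
exists (fun i z => g1 i z + g2 i z), (fun i => h1 i + h2 i); split.
- by apply: filterS2 d1 d2 => u u1 u2 i; exact: (is_deriveD (u1 i) (u2 i)).
- by move=> i; exact: (is_deriveD (e1 i) (e2 i)).
- by rewrite addrACA s1 s2.
Qed.

Lemma has_laplacianZ f z l (c : R) : has_laplacian f z l -> has_laplacian (fun z => c * f z) z (c * l).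
Proof.
move=> [g1 [h1 [d1 e1 s1]]].
exists (fun i z => c * g1 i z), (fun i => c * h1 i); split.
- by apply: filterS d1 => u u1 i; exact: (is_deriveZ c (u1 i)).
- by move=> i; exact: (is_deriveZ c (e1 i)).
- by rewrite -mulrDr s1.
Qed.

Lemma plane_harmonic_has_laplacian f z : plane_harmonic_at f z -> has_laplacian f z 0.
Proof.
move=> fh; exists (fun i => 'D_(axis i) f), (fun i => 'D_(axis i) ('D_(axis i) f) z).
have [d1 d2 _ lap] := nbhs_singleton fh.
split => //.
- by apply: filterS fh => u [du _ _ _] i; exact/derivableP.
Qed.

Lemma ler_norm_dist (x y c : R) : `|x - y| <= c -> `|x| <= `|y| + c.
Proof.
move=> xy; rewrite -[x](subrK y) addrC.
by apply: le_trans (ler_normD _ _) _; rewrite lerD2l.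
Qed.

Lemma bool2_bound (c : bool -> bool -> R) : exists2 M, 0 <= M & forall i j, c i j <= M.
Proof.
exists (`|c true true| + `|c true false| + `|c false true| + `|c false false|).
  by rewrite !addr_ge0.
move=> i j; apply: le_trans (ler_norm _) _.
have h a b : 0 <= `|c a b| by [].
by case: i; case: j; move: (h true true) (h true false) (h false true) (h false false); lra.
Qed.

(** Partial derivatives alone do not give continuity, but here the second
    derivatives are continuous, so the first ones are bounded nearby. *)
Lemma plane_harmonic_continuous f z : plane_harmonic_at f z -> {for z, continuous f}.
Proof.
move=> fh.
have [_ _ c _] := nbhs_singleton fh.
pose Q u := (forall i, derivable f u (axis i)) /\
  forall i j, derivable ('D_(axis i) f) u (axis j) /\ `|'D_(axis j) ('D_(axis i) f) u| <= 
    `|'D_(axis j) ('D_(axis i) f) z| + 1.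
have Qn : \forall u \near z, Q u.
  have cn i j : \forall u \near z, `|'D_(axis j) ('D_(axis i) f) u| <= 
      `|'D_(axis j) ('D_(axis i) f) z| + 1.
    have /cvgrPdist_le /(_ 1 ltr01) := c i j.
    apply: filterS => u; rewrite distrC => hu.
    exact: ler_norm_dist.
  have c11 := cn true true; have c10 := cn true false.
  have c01 := cn false true; have c00 := cn false false.
  apply: filterS2 (filterI c11 c10) (filterI fh (filterI c01 c00)).
  move=> u [h11 h10] [[du ddu _ _] [h01 h00]].
  split; first exact: du.
  move=> i j; split; first exact: ddu.
  case: i; case: j; [exact: h11|exact: h10|exact: h01|exact: h00].
have [r r0 rQ] := nbhs_box Qn.
have [M M0 MP] := @bool2_bound (fun i j => `|'D_(axis j) ('D_(axis i) f) z| + 1).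
have Dlip i u v : box z r u -> box z r v ->
    `|'D_(axis i) f v - 'D_(axis i) f u| <= M * (`|v.1 - u.1| + `|v.2 - u.2|).
  apply: (@lipschitz_box _ ('D_(axis i) f) z r M) => j.
  exists ('D_(axis j) ('D_(axis i) f)) => w /rQ[_ /(_ i j)[wd wb]].
    exact/derivableP.
  exact: le_trans wb (MP i j).
have zb : box z r z by rewrite /box !subrr normr0.
have [B B0 BP] := bool2_bound (fun i _ => `|'D_(axis i) f z|).
have Db i u : box z r u -> `|'D_(axis i) f u| <= B + M * (r + r).
  move=> ub; apply: le_trans (_ : `|'D_(axis i) f z| + M * (r + r) <= _); last first.
    by rewrite lerD2r; exact: (BP i true).
  apply: ler_norm_dist; apply: le_trans (Dlip i _ _ zb ub) _; apply: ler_wpM2l => //.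
  by case: ub => ? ?; apply: lerD; exact: ltW.
apply: (@lipschitz_continuous_box _ z r (B + M * (r + r)) f z zb) => u ub.
apply: (@lipschitz_box _ f z r (B + M * (r + r)) _ z u zb ub) => j.
exists ('D_(axis j) f) => w wb; last exact: Db.
by have [wd _] := rQ _ wb; exact/derivableP.
Qed.

Lemma is_derive1_slope (g : R -> R) (t d : R) : is_derive t 1 g d -> d < 0 ->
  exists2 e, 0 < e & forall s, 0 < s < e -> g (t + s) < g t.
Proof.
move=> [dg <-] d0.
have : \forall h \near 0^', h^-1 *: ((g \o shift t) (h *: 1) - g t) < 0.
  exact: (cvgr_lt _ dg).
rewrite /dnbhs /within /= => /nbhs_ballP[e /= e0 eP].
exists e => // s /andP[s0 se].
have := eP s; rewrite /ball /= sub0r normrN gtr0_norm // => /(_ se (lt0r_neq0 s0)).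
rewrite /GRing.scale /= mulr1 pmulr_rlt0 ?invr_gt0 // subr_lt0 addrC //.
Qed.

(** If h < 0 then f' becomes negative just after t, and the mean value theorem
    contradicts the minimality of f t. *)
Lemma second_derivative_at_min (f g : R -> R) (t h : R) :
  (\forall s \near t, is_derive (s : R) (1 : R) f (g s)) -> is_derive t 1 g h ->
  (\forall s \near t, f t <= f s) -> 0 <= h.
Proof.
move=> fg gh tmin; rewrite leNgt; apply/negP => h0.
have [e e0 eP] := is_derive1_slope gh h0.
have /nbhs_ballP[e' /= e'0 e'P] : \forall s \near t, is_derive (s : R) (1 : R) f (g s) /\ f t <= f s.
  exact: filterI.
have inb s : `|s - t| < e' -> is_derive s 1 f (g s) /\ f t <= f s.
  by move=> se; apply: e'P; rewrite /ball /= distrC.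
have gt0 : g t = 0.
  have : is_derive t 1 f 0.
    apply: (@derive1_at_min _ f (t - e') (t + e')).
    - by lra.
    - move=> s; rewrite in_itv /= => /andP[? ?].
      by have [|[? _] _] := inb s; first by rewrite ltr_norml; apply/andP; split; lra.
    - by rewrite in_itv /=; apply/andP; split; lra.
    - move=> s; rewrite in_itv /= => /andP[? ?].
      by have [|//] := inb s; rewrite ltr_norml; apply/andP; split; lra.
  move=> [_ <-].
  have [|[_ ->] _] := inb t; first by rewrite subrr normr0.
  by [].
pose s := Num.min e e' / 2.
have s0 : 0 < s by rewrite divr_gt0 // lt_min e0.
have se : s < e by rewrite /s ltr_pdivrMr // (le_lt_trans (_ : _ <= e)) ?ge_min ?lexx //; lra.
have se' : s < e' by rewrite /s ltr_pdivrMr // (le_lt_trans (_ : _ <= e')) ?ge_min ?lexx ?orbT //; lra.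
have dfs u : t <= u <= t + s -> is_derive u 1 f (g u).
  move=> /andP[? ?]; apply: (inb u _).1; rewrite ger0_norm; lra.
have [|||c] := @MVT _ f g t (t + s).
- by rewrite ltrDl.
- move=> x; rewrite in_itv /= => /andP[? ?]; apply: dfs; apply/andP; split; exact: ltW.
- apply: derivable_within_continuous => x; rewrite in_itv /= => xx.
  by have [] := dfs _ xx.
rewrite in_itv /= => /andP[c1 c2] e1.
have : f t <= f (t + s) by apply: (inb _ _).2; rewrite addrAC subrr add0r gtr0_norm.
rewrite -subr_ge0 e1 addrAC subrr add0r pmulr_lge0 // leNgt; apply/negP/negPn.
have : g (t + (c - t)) < g t by apply: eP; apply/andP; split; lra.
by rewrite addrC subrK gt0.
Qed.

Lemma near_axis_line (P : set (R * R)) z i : (\forall z' \near z, P z') ->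
  \forall s \near coord i z, P (axis_line i z s).
Proof.
move=> /nbhs_box[r r0 rP].
apply/nbhs_ballP; exists r => // s /=; rewrite /ball /= distrC => sr; apply: rP.
by rewrite /box /axis_line /coord; case: i sr => /= ?; rewrite subrr normr0.
Qed.

Lemma laplacian_at_min f z l : (\forall z' \near z, f z <= f z') ->
  has_laplacian f z l -> 0 <= l.
Proof.
move=> fmin [g [h [dg dh <-]]].
suff hi i : 0 <= h i by apply: addr_ge0.
apply: (@second_derivative_at_min (fun s => f (axis_line i z s)) (fun s => g i (axis_line i z s)) (coord i z)).
- have := near_axis_line i dg; apply: filterS => s /(_ i)/is_derive_axisE.
  have -> : coord i (axis_line i z s) = s by case: (i).
  by have -> : axis_line i (axis_line i z s) = axis_line i z by case: (i).
- exact/is_derive_axisE.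
- by have := near_axis_line i fmin; apply: filterS => s; rewrite axis_line_coord.
Qed.

(** The Laplacian of |phi|^2 for holomorphic phi is 4 |phi'|^2, here with phi the
    homography (n1 z + n0) / (d1 z + d0). *)
Lemma moebius_sq_has_laplacian (n1 n0 d1 d0 : R) z : lin_sq d1 d0 z != 0 ->
  has_laplacian (fun z => lin_sq n1 n0 z / lin_sq d1 d0 z) z
    (4 * (n1 * d0 - n0 * d1) ^+ 2 / lin_sq d1 d0 z ^+ 2).
Proof.
move=> z0.
pose dd (a b : R) (i : bool) z := 2 * a * (if i then lin_im a z else lin_re a b z).
pose g (i : bool) z := dd n1 n0 i z / lin_sq d1 d0 z
   - lin_sq n1 n0 z * dd d1 d0 i z * (lin_sq d1 d0 z)^-1 ^+ 2.
have cD : {for z, continuous (lin_sq d1 d0)}.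
  rewrite /lin_sq /lin_re /lin_im; apply: cvgD.
    by apply: (@continuous_comp _ _ _ (fun z : R * R => d1 * z.1 + d0) (fun x => x ^+ 2));
     [apply: cvgD; [apply: cvgMr; exact: cvg_fst|exact: cvg_cst]|exact: exprn_continuous].
  by apply: (@continuous_comp _ _ _ (fun z : R * R => d1 * z.2) (fun x => x ^+ 2));
   [apply: cvgMr; exact: cvg_snd|exact: exprn_continuous].
have dD (a b : R) u i j : is_derive u (axis j) (dd a b i) (if i == j then 2 * a ^+ 2 else 0).
  rewrite /dd; case: i.
    have h := is_deriveZ (2 * a) (is_derive_lin_im a u j).
    by apply: is_derive_eq h _; rewrite /GRing.scale /=; case: j; rewrite /= ?mulr0 // mulrA.
  have h := is_deriveZ (2 * a) (is_derive_lin_re a b u j).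
  by apply: is_derive_eq h _; rewrite /GRing.scale /=; case: j; rewrite /= ?mulr0 // mulrA.
exists g, (fun i =>
  2 * n1 ^+ 2 / lin_sq d1 d0 z - 2 * (dd n1 n0 i z * dd d1 d0 i z) * (lin_sq d1 d0 z)^-1 ^+ 2
  - lin_sq n1 n0 z * (2 * d1 ^+ 2) * (lin_sq d1 d0 z)^-1 ^+ 2
  + 2 * lin_sq n1 n0 z * dd d1 d0 i z ^+ 2 * (lin_sq d1 d0 z)^-1 ^+ 3); split.
- near=> u => i.
  have u0 : lin_sq d1 d0 u != 0 by near: u; exact: (cvgr_neq0 _ cD).
  have h := is_deriveM (is_derive_lin_sq n1 n0 u i) (is_derive_axisV u0 (is_derive_lin_sq d1 d0 u i)).
  apply: is_derive_eq h _; rewrite /GRing.scale /g /dd /=.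
  by move: u0; set D := lin_sq _ _ _; set N := lin_sq _ _ _; case: i => u0; field.
- move=> i.
  have dV := is_derive_axisV z0 (is_derive_lin_sq d1 d0 z i).
  have h := is_deriveB (is_deriveM (dD n1 n0 z i i) dV)
    (is_deriveM (is_deriveM (is_derive_lin_sq n1 n0 z i) (dD d1 d0 z i i)) (is_deriveM dV dV)).
  have ge : g i = dd n1 n0 i * (fun z => (lin_sq d1 d0 z)^-1) -
      lin_sq n1 n0 * dd d1 d0 i * ((fun z => (lin_sq d1 d0 z)^-1) * (fun z => (lin_sq d1 d0 z)^-1)).
    by apply/funext => u; rewrite /g expr2.
  rewrite ge; apply: is_derive_eq h _; rewrite /GRing.scale /= eqxx.
  rewrite -[(lin_sq n1 n0 * dd d1 d0 i) z]/(lin_sq n1 n0 z * dd d1 d0 i z).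
  rewrite -[((fun z => (lin_sq d1 d0 z)^-1) * (fun z => (lin_sq d1 d0 z)^-1)) z]/((lin_sq d1 d0 z)^-1 * (lin_sq d1 d0 z)^-1).
  rewrite -![2 * n1 * _]/(dd n1 n0 i z) -![2 * d1 * _]/(dd d1 d0 i z).
  move: z0 {dV ge}; set D := lin_sq _ _ _; set N := lin_sq _ _ _ => z0.
  by move: (dd n1 n0 i z) (dd d1 d0 i z) => x y; field.
- move: z0; rewrite /dd /lin_sq /lin_re /lin_im => z0 /=.
  by field.
Unshelve. all: by end_near. Qed.

End Laplacian.

(** * Coordinates on the sphere with a prescribed pole *)

Section Modulus.
Context {R : realType}.
Implicit Types z : R * R.

Lemma cmod_sqr z : cmod z ^+ 2 = z.1 ^+ 2 + z.2 ^+ 2.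
Proof. by rewrite sqr_sqrtr // addr_ge0 // sqr_ge0. Qed.

Lemma cmodD z z' : cmod (z + z') <= cmod z + cmod z'.
Proof.
rewrite -ler_sqr ?nnegrE ?addr_ge0 ?cmod_ge0 //.
rewrite sqrrD !cmod_sqr.
have h : z.1 * z'.1 + z.2 * z'.2 <= cmod z * cmod z'.
  apply: le_trans (ler_norm _) _.
  rewrite -ler_sqr ?nnegrE ?mulr_ge0 ?cmod_ge0 // real_normK ?num_real //.
  rewrite exprMn !cmod_sqr.
  have := sqr_ge0 (z.1 * z'.2 - z.2 * z'.1); lra.
rewrite -[(z + z').1]/(z.1 + z'.1) -[(z + z').2]/(z.2 + z'.2).
lra.
Qed.

Lemma cmodN z : cmod (- z) = cmod z.
Proof. by rewrite /cmod /= !sqrrN. Qed.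

Lemma cmodB_ge z z' : cmod z - cmod z' <= cmod (z - z').
Proof.
rewrite lerBlDr; apply: le_trans (cmodD _ _).
by rewrite subrK.
Qed.

Lemma cmod_real (x : R) : cmod (x, 0) = `|x|.
Proof. by rewrite /cmod /= expr0n addr0 sqrtr_sqr. Qed.

Lemma normr2_le_cmod z : `|z.2| <= cmod z.
Proof. by rewrite /cmod -sqrtr_sqr ler_wsqrtr // lerDr sqr_ge0. Qed.

Lemma cmod_le_norm1 z : cmod z <= `|z.1| + `|z.2|.
Proof.
rewrite -ler_sqr ?nnegrE ?addr_ge0 ?cmod_ge0 // cmod_sqr sqrrD !real_normK ?num_real //.
have h : 0 <= `|z.1| * `|z.2| by exact: mulr_ge0.
lra.
Qed.

Lemma cmod_eq0 z : (cmod z == 0) = (z == 0).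
Proof.
rewrite /cmod sqrtr_eq0; apply/idP/eqP => [h|->]; last by rewrite /= expr0n addr0.
have : z.1 ^+ 2 + z.2 ^+ 2 == 0 by rewrite eq_le h addr_ge0 // sqr_ge0.
rewrite paddr_eq0 ?sqr_ge0 // !sqrf_eq0 => /andP[/eqP h1 /eqP h2].
by case: z h1 h2 {h} => x y /= -> ->.
Qed.

Lemma cmod_gt0 z : (0 < cmod z) = (z != 0).
Proof. by rewrite lt_neqAle cmod_ge0 andbT eq_sym cmod_eq0. Qed.

Lemma cmod_cinv z : cmod (cinv z) = (cmod z)^-1.
Proof.
have [->|z0] := eqVneq z 0.
  by rewrite /cmod /cinv /= !expr0n /= addr0 invr0 !mulr0 expr0n /= addr0 sqrtr0 invr0.
apply/eqP; rewrite -(@eqrXn2 _ 2) ?cmod_ge0 ?invr_ge0 ?cmod_ge0 //.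
rewrite exprVn !cmod_sqr /cinv /=.
have : cmod z ^+ 2 != 0 by rewrite sqrf_eq0 cmod_eq0.
rewrite cmod_sqr => h; apply/eqP; field; rewrite h.
by [].
Qed.

Lemma cinvK z : cinv (cinv z) = z.
Proof.
have [->|z0] := eqVneq z 0.
  by rewrite /cinv /= !(expr0n, addr0, invr0, mulr0, oppr0, mul0r).
have := cmod_cinv z; move/(congr1 (fun x => x ^+ 2)); rewrite exprVn !cmod_sqr => h.
rewrite {1}/cinv h invrK.
have h0 : z.1 ^+ 2 + z.2 ^+ 2 != 0 by rewrite -cmod_sqr sqrf_eq0 cmod_eq0.
by move: h0; rewrite /cinv /=; case: (z) => x y /= h0; congr (_, _); field.
Qed.

Lemma cinv_eq0 z : (cinv z == 0) = (z == 0).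
Proof. by rewrite -cmod_eq0 cmod_cinv invr_eq0 cmod_eq0. Qed.

Lemma lin_sq_ge0 (a b : R) z : 0 <= lin_sq a b z.
Proof. by rewrite addr_ge0 // sqr_ge0. Qed.

Lemma lin_sq_cinv (a b : R) z : z != 0 ->
  lin_sq a b (cinv z) = lin_sq b a z / cmod z ^+ 2.
Proof.
rewrite -cmod_eq0 -sqrf_eq0 cmod_sqr /lin_sq /lin_re /lin_im /cinv /= => z0.
by field.
Qed.

End Modulus.

Section Charts.
Context {R : realType}.
Implicit Types (w x : Rhat R) (p : Chat R) (z : R * R).

(** The variable z itself near a finite point, and 1 / z near infinity. *)
Definition chart p : R * R -> Chat R := if p is Some _ then Some else chart_oo.
Definition chart_center p : R * R := if p is Some z then z else 0.

Lemma chart_centerK p : chart p (chart_center p) = p.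
Proof. by case: p => [z|] //=; rewrite /chart_oo eqxx. Qed.

Lemma compact_plane_bounded (K : set (R * R)) : compact K -> exists2 M, 0 < M & forall z, K z -> cmod z < M.
Proof.
move=> /compact_bounded [M [_ MP]].
exists (2 * (`|M| + 1) + 1) => [|z Kz]; first by rewrite ltr_wpDl // mulr_ge0 // addr_ge0.
have := MP (`|M| + 1); rewrite (le_lt_trans (ler_norm M)) ?ltrDl // => /(_ isT z Kz) /= h.
apply: le_lt_trans (cmod_le_norm1 _) _.
have h1 : `|z.1| <= `|M| + 1 by apply: le_trans h; rewrite prod_normE le_max lexx.
have h2 : `|z.2| <= `|M| + 1 by apply: le_trans h; rewrite prod_normE le_max lexx orbT.
lra.
Qed.

Lemma cmod_ball_compact (M : R) : compact [set z : R * R | cmod z <= M] /\ closed [set z : R * R | cmod z <= M].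
Proof.
have cl : closed [set z : R * R | cmod z <= M].
  apply: (@preimage_closed _ _ cmod [set x | x <= M]); last exact: closed_le.
  move=> z _; rewrite /cmod; apply: continuous_comp; last exact: sqrt_continuous.
  by apply: cvgD; apply: (continuous_comp _ (@exprn_continuous _ 2 _)); [exact: cvg_fst|exact: cvg_snd].
split => //.
apply: (subclosed_compact cl (compact_setX (@segment_compact _ (-M) M) (@segment_compact _ (-M) M))).
move=> z /= zM; rewrite !in_itv /= -!ler_norml.
by split; apply: le_trans zM; [exact: normr1_le_cmod|exact: normr2_le_cmod].
Qed.

(** Neighborhoods of infinity are complements of compact sets, hence contain
    the images under inversion of small squares. *)
Lemma nbhs_chart p (P : set (Chat R)) :
  nbhs p P <-> \forall z \near chart_center p, P (chart p z).
Proof.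
case: p => [z|] //=.
rewrite /nbhs /=; split.
- move=> [K [cK _] KP].
  have [M M0 MK] := compact_plane_bounded cK.
  have := box_nbhs (0 : R * R) (r := (2 * M)^-1); rewrite invr_gt0 mulr_gt0 // => /(_ isT).
  apply: filterS => z [h1 h2]; apply: KP.
  rewrite /chart_oo; case: eqVneq => z0; first by right.
  left; exists (cinv z) => // /MK; rewrite cmod_cinv invf_plt ?posrE ?cmod_gt0 //.
  apply/negP; rewrite -leNgt; apply: le_trans (cmod_le_norm1 _) _.
  move: h1 h2; rewrite /= !subr0 => h1 h2.
  have : (2 * M)^-1 + (2 * M)^-1 = M^-1 by field; rewrite gt_eqF.
  lra.
- move=> /nbhs_box[r r0 rP].
  have [cK clK] := cmod_ball_compact r^-1.
  exists [set z : R * R | cmod z <= r^-1] => // -[z|_].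
    case=> // -[u /= /[swap] -[->] zr].
    have zgt : r^-1 < cmod z by rewrite ltNge; apply/negP.
    have z0 : z != 0 by rewrite -cmod_gt0 (lt_trans _ zgt) // invr_gt0.
    have := rP (cinv z); rewrite /chart_oo cinv_eq0 (negbTE z0) cinvK; apply.
    have zi : cmod (cinv z) < r.
      by rewrite cmod_cinv invf_plt ?posrE ?cmod_gt0.
    by split; rewrite [X in `|_ - X|]/= subr0; apply: le_lt_trans zi; [exact: normr1_le_cmod|exact: normr2_le_cmod].
  have := rP 0; rewrite /chart_oo eqxx; apply.
  by rewrite /box !subrr normr0.
Qed.

(** The coordinate with pole at w is a homography; [num_form] and [den_form] give
    the coefficients of its numerator and denominator in z, and passing to the
    chart at infinity reverses them. *)
Definition num_form w : R * R := if w is Some a then (0, 1) else (1, 0).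
Definition den_form w : R * R := if w is Some a then (-1, a) else (0, 1).
Definition in_chart p (c : R * R) : R * R := if p is Some _ then c else (c.2, c.1).

(** The coordinate with pole at w, on the sphere. *)
Definition zetac w p : R * R :=
  match w, p with
  | None, Some z => z
  | Some a, Some z => cinv (a - z.1, - z.2)
  | _, None => 0
  end.

(** The restriction of the coordinate to the real circle. *)
Definition zeta w x : R :=
  match w, x with
  | None, Some s => s
  | Some a, Some s => (a - s)^-1
  | _, None => 0
  end.

Definition zetainv w (s : R) : Rhat R :=
  if w is Some a then (if s == 0 then None else Some (a - s^-1)) else Some s.

Lemma zetac_to_sphere w x : zetac w (to_sphere x) = (zeta w x, 0).
Proof.
case: w x => [a|] [s|] //=; rewrite /cinv /= oppr0 expr0n addr0 /= oppr0 mul0r; congr (_, _).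
by have [->|h] := eqVneq (a - s) 0; rewrite ?mul0r ?invr0 //; field.
Qed.

Lemma den_form_neq0 w p z : chart p z <> to_sphere w ->
  lin_sq (in_chart p (den_form w)).1 (in_chart p (den_form w)).2 z != 0.
Proof.
have sq_neq0 (u v : R) : (u != 0) || (v != 0) -> u ^+ 2 + v ^+ 2 != 0.
  by rewrite paddr_eq0 ?sqr_ge0 // !sqrf_eq0 negb_and.
case: p w => [p|] [a|] /=; rewrite /lin_sq /lin_re /lin_im /=.
- move=> h; apply: sq_neq0; apply/orP.
  have [z2|z2] := eqVneq z.2 0; last by right; rewrite mulN1r oppr_eq0.
  left; apply: contra_notN h => /eqP e.
  by rewrite (surjective_pairing z) z2; congr (Some (_, _)); lra.
- by move=> _; rewrite mul0r add0r mul0r expr1n expr0n addr0 oner_neq0.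
- move=> h; apply: sq_neq0; apply/orP.
  have [a0|a0] := eqVneq a 0; first by left; rewrite a0 mul0r add0r oppr_eq0 oner_eq0.
  have [z2|z2] := eqVneq z.2 0; last by right; rewrite mulf_neq0.
  left; apply: contra_notN h => /eqP e.
  have z1 : z.1 = a^-1.
    by apply: (mulfI a0); rewrite mulfV //; lra.
  rewrite /chart_oo; case: eqP => [z0|_].
    by move: z1; rewrite z0 /= => /esym/eqP; rewrite invr_eq0 (negbTE a0).
  by rewrite /to_sphere /= /cinv z1 z2 oppr0 expr0n addr0 mul0r; congr (Some (_, _)); field.
- move=> h; apply: sq_neq0; rewrite !mul1r addr0.
  have : z != 0 by apply: contra_notN h => /eqP ->; rewrite /chart_oo eqxx.
  rewrite -cmod_eq0 -sqrf_eq0 cmod_sqr; apply: contraR; rewrite negb_or !negbK.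
  by move=> /andP[/eqP -> /eqP ->]; rewrite expr0n addr0.
Qed.

(** In either chart, |zeta_w - t| is the modulus of a homography of the chart
    variable whose denominator does not depend on t. *)
Lemma cmod_zetac w p z (t : R) : chart p z <> to_sphere w ->
  cmod (zetac w (chart p z) - (t, 0)) ^+ 2 =
  lin_sq ((in_chart p (num_form w)).1 - t * (in_chart p (den_form w)).1)
         ((in_chart p (num_form w)).2 - t * (in_chart p (den_form w)).2) z
  / lin_sq (in_chart p (den_form w)).1 (in_chart p (den_form w)).2 z.
Proof.
have plane v : @Some (R * R) v <> to_sphere w -> cmod (zetac w (Some v) - (t, 0)) ^+ 2 =
   lin_sq ((num_form w).1 - t * (den_form w).1) ((num_form w).2 - t * (den_form w).2) v /
   lin_sq (den_form w).1 (den_form w).2 v.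
  move=> h; have := @den_form_neq0 w (Some v) v h; rewrite /= cmod_sqr /= oppr0 addr0.
  case: w h => [a|] _; rewrite /lin_sq /lin_re /lin_im /=; last first.
    by move=> _; rewrite !(mul0r, mulr0, subr0, add0r, expr1n, expr0n, addr0, invr1, mulr1, mul1r).
  by move=> h; field; apply: contraNneq h => h; apply/eqP; rewrite -[RHS]h; ring.
case: p => [p|] /= h; first exact: plane.
case: (eqVneq z 0) h => [->|z0] h.
  rewrite /chart_oo eqxx /=.
  have h' : None <> to_sphere w by move: h; rewrite /chart_oo eqxx.
  case: w {plane h} h' => [a|//] _ /=.
  by rewrite cmod_sqr /lin_sq /lin_re /lin_im /=; field.
move: h; rewrite /chart_oo (negbTE z0) => h.
rewrite plane //.
rewrite !lin_sq_cinv // -mulf_div mulfV ?mulr1 //.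
by rewrite invr_eq0 sqrf_eq0 cmod_eq0.
Qed.

End Charts.

Section RealCoordinate.
Context {R : realType}.
Implicit Types (w x : Rhat R) (p : Chat R) (s : R).

Lemma zetainvK w : cancel (zetainv w) (zeta w).
Proof.
case: w => [a|] s //=; case: eqVneq => [->//|s0] /=.
by rewrite opprB addrC subrK invrK.
Qed.

Lemma zetaK w x : x <> w -> zetainv w (zeta w x) = x.
Proof.
case: w x => [a|] [s|] //= => [h|_]; last by rewrite eqxx.
have h' : a - s != 0 by apply: contra_notN h => /eqP e; congr Some; lra.
by rewrite invr_eq0 (negbTE h') invrK opprB addrC subrK.
Qed.

Lemma zetainv_neq w s : zetainv w s <> w.
Proof.
case: w => [a|] //=; case: eqVneq => // s0 [] /eqP.
by rewrite subr_eq -subr_eq0 opprD addNKr oppr_eq0 invr_eq0 (negbTE s0).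
Qed.

Lemma zetainv_inj w : injective (zetainv w).
Proof. exact: can_inj (zetainvK w). Qed.

Lemma zeta_eq w x s : x <> w -> zeta w x = s -> x = zetainv w s.
Proof. by move=> xw <-; rewrite zetaK. Qed.

Lemma to_sphere_inj : injective (@to_sphere R).
Proof. by move=> [x|] [y|] //= [->]. Qed.

Lemma zetainv_continuous w : continuous (zetainv w).
Proof.
case: w => [a|] s; last exact: one_point_compactification_some_continuous.
have [->|s0] := eqVneq s 0; last first.
  have h : (fun t : R => Some (a - t^-1) : Rhat R) @ s --> (Some (a - s^-1) : Rhat R).
    apply: (continuous_comp (f := fun t : R => a - t^-1)).
      by apply: cvgB; [exact: cvg_cst|apply: cvgV].
    exact: one_point_compactification_some_continuous.
  have e : zetainv (Some a) s = Some (a - s^-1) by rewrite /= (negbTE s0).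
  rewrite /continuous_at e; apply: cvg_trans h.
  apply: near_eq_cvg; near=> t.
  have t0 : t != 0 by near: t; exact: (cvgr_neq0 _ (@cvg_id _ _)).
  by rewrite /= (negbTE t0).
have e : zetainv (Some a) 0 = None by rewrite /= eqxx.
move=> P; rewrite e.
move=> [K [cK _] KP].
have [M [_ MP]] := compact_bounded cK.
have M1 : M < `|M| + 1 by rewrite (le_lt_trans (ler_norm _)) // ltrDl.
have {MP} KM z : K z -> `|z| <= `|M| + 1 by exact: MP.
pose B := `|a| + (`|M| + 1) + 1.
have B0 : 0 < B by rewrite ltr_wpDl // !addr_ge0.
apply/nbhs_ballP; exists B^-1 => [|t /=]; first by rewrite /= invr_gt0.
rewrite /ball /= sub0r normrN => tB; apply: KP.
case: eqVneq => t0; first by right.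
left; exists (a - t^-1) => // /KM h.
have : B < `|t^-1| by rewrite normfV invf_pgt ?posrE ?normr_gt0.
have := ler_normB a (a - t^-1); rewrite opprB addrC subrK; rewrite /B; lra.
Unshelve. all: by end_near. Qed.

Lemma zeta_continuous w x : x <> w -> zeta w @ x --> zeta w x.
Proof.
case: w x => [a|] [s|] //= h.
- have h' : a - s != 0 by apply: contra_notN h => /eqP e; congr Some; lra.
  move=> P /= PP; rewrite /nbhs /=.
  suff : (fun t : R => (a - t)^-1) @ s --> (a - s)^-1 by move/(_ P PP).
  by apply: cvgV => //; apply: cvgB; [exact: cvg_cst|exact: cvg_id].
- move=> P /= /nbhs_ballP[e /= e0 eP].
  exists `[a - e^-1, a + e^-1]%classic.
    by split; [exact: segment_compact|exact: interval_closed].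
  move=> -[s|] /=; last by move=> _; apply: eP; exact: ballxx.
  case=> // -[u /= /[swap] -[->] /negP su]; apply: eP; rewrite /ball /= sub0r normrN.
  have hs : e^-1 < `|a - s|.
    rewrite ltNge; apply/negP => h'; move/negP: su; apply; rewrite in_itv /=.
    by move: h'; rewrite ler_norml => /andP[? ?]; apply/andP; split; lra.
  by rewrite normfV invf_plt ?posrE // (lt_trans _ hs) // invr_gt0.
Qed.

Section ClosedSet.
Variables (w : Rhat R) (S : set (Rhat R)) (Scl : closed S) (Sw : ~ S w).

Lemma bounded_zetainv : exists2 B, 0 < B & forall s, S (zetainv w s) -> `|s| <= B.
Proof.
have : nbhs w (~` S) by apply: open_nbhs_nbhs; split => //; exact: closed_openC.
case: w Sw => [a|] Sw' /=.
  rewrite /nbhs /= => /nbhs_ballP[e /= e0 eP].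
  exists e^-1; first by rewrite invr_gt0.
  move=> s; case: eqVneq => [->|s0 Ss]; first by rewrite normr0 invr_ge0 ltW.
  rewrite leNgt; apply/negP => h; apply: (eP (a - s^-1)) Ss.
  by rewrite /ball /= opprB addrC subrK normfV invf_plt ?posrE // normr_gt0.
move=> [K [cK _] KS].
have [M [_ MP]] := compact_bounded cK.
exists (`|M| + 1); first by rewrite ltr_wpDl.
move=> s Ss; apply: (MP (`|M| + 1)).
  by rewrite (le_lt_trans (ler_norm _)) // ltrDl.
by apply: contrapT => nK; apply: (KS (Some s)) => //; left; exists s.
Qed.

Lemma limit_point_zetainv : zetainv w @^-1` limit_point S = limit_point (zetainv w @^-1` S).
Proof.
apply/seteqP; split => s h.
- move=> V Vs.
  have Vz : nbhs (zetainv w s) (zeta w @^-1` V).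
    by apply: zeta_continuous; [exact: zetainv_neq|rewrite zetainvK].
  have [y [yn Sy Vy]] := h _ Vz.
  have yw : y <> w by move=> e; rewrite e in Sy.
  exists (zeta w y); split => //=; last by rewrite zetaK.
  by apply: contra_neq yn => /(zeta_eq yw).
- move=> V /zetainv_continuous/h[y [yn Sy Vy]].
  exists (zetainv w y); split => //.
  by apply: contra_neq yn => /zetainv_inj.
Qed.

End ClosedSet.
End RealCoordinate.

(** * Moduli of polynomials in a coordinate *)

Section MoreLaplacian.
Context {R : realType}.
Implicit Types (f : R * R -> R) (z : R * R).

Lemma lin_sq_continuous (a b : R) : continuous (lin_sq a b).
Proof.
move=> z; rewrite /lin_sq /lin_re /lin_im; apply: cvgD.
  by apply: (@continuous_comp _ _ _ (fun z : R * R => a * z.1 + b) (fun x => x ^+ 2));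
   [apply: cvgD; [apply: cvgMr; exact: cvg_fst|exact: cvg_cst]|exact: exprn_continuous].
by apply: (@continuous_comp _ _ _ (fun z : R * R => a * z.2) (fun x => x ^+ 2));
 [apply: cvgMr; exact: cvg_snd|exact: exprn_continuous].
Qed.

Lemma has_laplacian_near f1 f2 z l : (\forall z' \near z, f1 z' = f2 z') ->
  has_laplacian f1 z l -> has_laplacian f2 z l.
Proof.
move=> f12 [g [h [dg dh hl]]]; exists g, h; split => //.
move/nbhs_box: f12 => [r r0 f12].
move/nbhs_box: dg => [r' r'0 dg].
near=> u => i.
have ub : box z r u by near: u; exact: box_nbhs.
have ub' : box z r' u by near: u; exact: box_nbhs.
apply: near_eq_is_derive (dg _ ub' i).
have := box_near ub; apply: filterS => v; exact: f12.
Unshelve. all: by end_near. Qed.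

Lemma has_laplacian_cst z (c : R) : has_laplacian (fun=> c) z 0.
Proof.
exists (fun _ _ => 0), (fun _ => 0); split; last by rewrite addr0.
- by near=> u => i; exact: is_derive_cst.
- by move=> i; exact: is_derive_cst.
Unshelve. all: by end_near. Qed.

Lemma has_laplacian_sum (T : eqType) (s : seq T) (F : T -> R * R -> R) z :
  {in s, forall t, has_laplacian (F t) z 0} ->
  has_laplacian (fun z => \sum_(t <- s) F t z) z 0.
Proof.
elim: s => [|t s IH] sF.
  under eq_fun do rewrite big_nil; exact: has_laplacian_cst.
under eq_fun do rewrite big_cons; rewrite -[X in has_laplacian _ _ X]addr0.
apply: has_laplacianD; first by apply: sF; rewrite mem_head.
by apply: IH => u us; apply: sF; rewrite in_cons us orbT.
Qed.

Lemma log_lin_has_laplacian (a b : R) z : 0 < lin_sq a b z -> has_laplacian (log_lin a b) z 0.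
Proof.
move=> z0.
exists (fun i z => a * if i then - (inv_im a b z) else inv_re a b z),
  (fun i => a * (a * if i then (inv_pow a b 2 z).1 else - (inv_pow a b 2 z).1)); split.
- near=> u => i.
  have u0 : 0 < lin_sq a b u by near: u; exact: (cvgr_gt _ (@lin_sq_continuous a b z)).
  by apply: is_derive_eq (is_derive_log_lin i u0) _; case: i; rewrite ?mulrN ?mulNr.
- move=> i; have z0' := lt0r_neq0 z0; case: i.
    have h := is_deriveZ a (is_deriveN (is_derive_inv_im true z0')).
    by apply: is_derive_eq h _; rewrite /GRing.scale /=; ring.
  exact: (is_deriveZ a (is_derive_inv_re false z0')).
- by rewrite !mulrN addNr.
Unshelve. all: by end_near. Qed.

End MoreLaplacian.

Section Sphere.
Context {R : realType}.
Implicit Types (w : Rhat R) (p : Chat R) (z : R * R).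

Lemma den_form_eq0 w p z : chart p z = to_sphere w ->
  lin_sq (in_chart p (den_form w)).1 (in_chart p (den_form w)).2 z = 0.
Proof.
case: p w => [p|] [a|] //=; rewrite /lin_sq /lin_re /lin_im /=.
- by move=> [->] /=; rewrite mulr0 expr0n /= mulN1r addNr expr0n addr0.
- rewrite /chart_oo; case: eqVneq => // z0 /(congr1 (odflt 0)) zE.
  rewrite [odflt _ _]/= in zE; have := cinvK z; rewrite zE => <-; rewrite /cinv /= expr0n /= addr0 oppr0 mul0r mulr0 expr0n addr0.
  have a0 : a != 0.
    by apply: contra_neq z0 => a0; apply/eqP; rewrite -cinv_eq0 zE a0.
  by apply/eqP; rewrite sqrf_eq0; apply/eqP; field.
- by rewrite /chart_oo; case: eqVneq => // -> _ /=; rewrite addr0 !mul1r expr0n /= addr0.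
Qed.

Lemma near_chart_neq w p : p <> to_sphere w ->
  \forall z \near chart_center p, chart p z <> to_sphere w.
Proof.
move=> pw.
have := @den_form_neq0 _ w p (chart_center p); rewrite chart_centerK => /(_ pw) d0.
near=> z => /den_form_eq0 /eqP; apply/negP.
by near: z; exact: (cvgr_neq0 _ (@lin_sq_continuous _ _ _ _) d0).
Unshelve. all: by end_near. Qed.

Lemma near_neq w p : p <> to_sphere w -> \forall q \near p, q <> to_sphere w.
Proof. by move=> pw; apply/nbhs_chart; exact: near_chart_neq. Qed.

Lemma continuous_of_chart (T : topologicalType) (g : Chat R -> T) p :
  (g (chart p z) @[z --> chart_center p] --> g p) -> g @ p --> g p.
Proof. by move=> gc P /gc h; apply/nbhs_chart. Qed.

Lemma cmod_zetac_continuous w (t : R) p : p <> to_sphere w ->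
  cmod (zetac w q - (t, 0)) @[q --> p] --> cmod (zetac w p - (t, 0)).
Proof.
move=> pw; apply: (continuous_of_chart (g := fun q => cmod (zetac w q - (t, 0)))).
have e z : chart p z <> to_sphere w -> cmod (zetac w (chart p z) - (t, 0)) =
    Num.sqrt (lin_sq ((in_chart p (num_form w)).1 - t * (in_chart p (den_form w)).1)
         ((in_chart p (num_form w)).2 - t * (in_chart p (den_form w)).2) z
  / lin_sq (in_chart p (den_form w)).1 (in_chart p (den_form w)).2 z).
  by move=> /cmod_zetac <-; rewrite sqrtr_sqr ger0_norm // cmod_ge0.
rewrite -[in X in _ --> X](chart_centerK p) e; last by rewrite chart_centerK.
have d0 := @den_form_neq0 _ w p (chart_center p); rewrite chart_centerK in d0.
have h : (fun z => Num.sqrt (lin_sq ((in_chart p (num_form w)).1 - t * (in_chart p (den_form w)).1)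
         ((in_chart p (num_form w)).2 - t * (in_chart p (den_form w)).2) z
  / lin_sq (in_chart p (den_form w)).1 (in_chart p (den_form w)).2 z)) @ chart_center p -->
   Num.sqrt (lin_sq ((in_chart p (num_form w)).1 - t * (in_chart p (den_form w)).1)
         ((in_chart p (num_form w)).2 - t * (in_chart p (den_form w)).2) (chart_center p)
  / lin_sq (in_chart p (den_form w)).1 (in_chart p (den_form w)).2 (chart_center p)).
  apply: (@continuous_comp _ _ _ (fun z => lin_sq _ _ z / lin_sq _ _ z) Num.sqrt); last exact: sqrt_continuous.
  apply: cvgM; first exact: lin_sq_continuous.
  by apply: cvgV; [exact: d0|exact: lin_sq_continuous].
apply: cvg_trans h; apply: near_eq_cvg; near=> z.
by rewrite e //; near: z; exact: near_chart_neq.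
Unshelve. all: by end_near. Qed.

Lemma harmonic_has_laplacian (v : Chat R -> R) p : harmonic_at v p ->
  has_laplacian (fun z => v (chart p z)) (chart_center p) 0 /\ v @ p --> v p.
Proof.
move=> vh; have h : plane_harmonic_at (fun z => v (chart p z)) (chart_center p).
  by case: p vh.
split; first exact: plane_harmonic_has_laplacian.
apply: continuous_of_chart.
by rewrite -[in X in _ --> X](chart_centerK p); exact: (plane_harmonic_continuous h).
Qed.

Lemma plane_harmonic_harmonic (v : Chat R -> R) p :
  plane_harmonic_at (fun z => v (chart p z)) (chart_center p) -> harmonic_at v p.
Proof. by case: p. Qed.

(** The modulus of the polynomial c prod (X - t) in the coordinate with pole at w. *)
Definition abs_poly w (c : R) (ts : seq R) p : R :=
  c * \prod_(t <- ts) cmod (zetac w p - (t, 0)).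

Lemma cvg_scaled_prod (T : Type) (F : set_system T) (FF : Filter F) (c : R)
    (ts : seq R) (G : R -> T -> R) (l : R -> R) :
  (forall t, G t x @[x --> F] --> l t) ->
  c * \prod_(t <- ts) G t x @[x --> F] --> c * \prod_(t <- ts) l t.
Proof.
move=> Gl; apply: cvgMr; elim: ts => [|t ts IH].
  by under eq_fun do rewrite big_nil; rewrite big_nil; exact: cvg_cst.
under eq_fun do rewrite big_cons; rewrite big_cons.
exact: cvgM.
Qed.

Lemma abs_poly_continuous w c ts p : p <> to_sphere w ->
  abs_poly w c ts q @[q --> p] --> abs_poly w c ts p.
Proof.
move=> pw; apply: (@cvg_scaled_prod _ _ (nbhs_filter p)) => t.
exact: cmod_zetac_continuous.
Qed.

Lemma ln_prod (T : eqType) (s : seq T) (F : T -> R) : {in s, forall t, 0 < F t} ->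
  ln (\prod_(t <- s) F t) = \sum_(t <- s) ln (F t).
Proof.
elim: s => [|t s IH] sF; first by rewrite !big_nil ln1.
have sF' : {in s, forall t, 0 < F t} by move=> u us; apply: sF; rewrite in_cons us orbT.
rewrite !big_cons lnM ?IH //; rewrite posrE; first by apply: sF; rewrite mem_head.
by rewrite big_seq prodr_gt0.
Qed.

Lemma ln_cmod_zetac w p z (t : R) : chart p z <> to_sphere w ->
  0 < cmod (zetac w (chart p z) - (t, 0)) ->
  let a := (in_chart p (num_form w)).1 - t * (in_chart p (den_form w)).1 in
  let b := (in_chart p (num_form w)).2 - t * (in_chart p (den_form w)).2 in
  0 < lin_sq a b z /\
  ln (cmod (zetac w (chart p z) - (t, 0))) =
  log_lin a b z - log_lin (in_chart p (den_form w)).1 (in_chart p (den_form w)).2 z.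
Proof.
move=> zw c0 a b.
have h := cmod_zetac t zw.
have d0 : 0 < lin_sq (in_chart p (den_form w)).1 (in_chart p (den_form w)).2 z.
  by rewrite lt_neqAle eq_sym den_form_neq0 // lin_sq_ge0.
have n0 : 0 < lin_sq a b z.
  have : 0 < lin_sq a b z / lin_sq (in_chart p (den_form w)).1 (in_chart p (den_form w)).2 z.
    by rewrite -h exprn_gt0.
  by rewrite pmulr_lgt0 // invr_gt0.
split => //.
have : ln (cmod (zetac w (chart p z) - (t, 0)) ^+ 2) = ln (lin_sq a b z / lin_sq (in_chart p (den_form w)).1 (in_chart p (den_form w)).2 z) by rewrite h.
rewrite lnXn // ln_div ?posrE // mulr2n /log_lin; lra.
Qed.

Lemma ln_abs_poly w c ts p : 0 < abs_poly w c ts p -> 0 < c ->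
  ln (abs_poly w c ts p) = ln c + \sum_(t <- ts) ln (cmod (zetac w p - (t, 0))) /\
  {in ts, forall t, 0 < cmod (zetac w p - (t, 0))}.
Proof.
rewrite /abs_poly => P0 c0.
have h : {in ts, forall t, 0 < cmod (zetac w p - (t, 0))}.
  move=> t tts; rewrite lt_neqAle cmod_ge0 andbT eq_sym.
  move: P0; rewrite pmulr_rgt0 // => /lt0r_neq0; rewrite prodf_seq_neq0.
  by move/allP => /(_ t tts).
split => //; rewrite lnM ?posrE // ?ln_prod //.
by rewrite big_seq prodr_gt0.
Qed.

(** Off the zeros, the logarithm is a sum of log|a z + b| minus a multiple of
    log of the common denominator. *)
Lemma ln_abs_poly_has_laplacian w c ts p : 0 < c -> p <> to_sphere w -> 0 < abs_poly w c ts p ->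
  has_laplacian (fun z => ln (abs_poly w c ts (chart p z))) (chart_center p) 0.
Proof.
move=> c0 pw P0.
have Pn : \forall z \near chart_center p, 0 < abs_poly w c ts (chart p z).
  by apply/(nbhs_chart p (fun q => 0 < abs_poly w c ts q)); exact: (cvgr_gt _ (@abs_poly_continuous w c ts _ pw) 0 P0).
have [r r0 rP] := nbhs_box (filterI Pn (near_chart_neq pw)).
pose a t := (in_chart p (num_form w)).1 - t * (in_chart p (den_form w)).1.
pose b t := (in_chart p (num_form w)).2 - t * (in_chart p (den_form w)).2.
pose F t z := log_lin (a t) (b t) z + (-1) * log_lin (in_chart p (den_form w)).1 (in_chart p (den_form w)).2 z.
have key z : box (chart_center p) r z -> {in ts, forall t, 0 < lin_sq (a t) (b t) z} /\
   ln (abs_poly w c ts (chart p z)) = ln c + \sum_(t <- ts) F t z.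
  move=> /rP[z0 zw].
  have [-> h] := ln_abs_poly z0 c0.
  split; first by move=> t /h; case/(ln_cmod_zetac zw).
  congr (_ + _); rewrite !big_seq; apply: eq_bigr => t /h.
  by case/(ln_cmod_zetac zw) => _ ->; rewrite /F mulN1r.
apply: (@has_laplacian_near _ (fun z => ln c + \sum_(t <- ts) F t z)).
  by apply: filterS (box_nbhs _ r0) => z /key[_ ->].
have [k1 _] : {in ts, forall t, 0 < lin_sq (a t) (b t) (chart_center p)} /\
   ln (abs_poly w c ts (chart p (chart_center p))) = ln c + \sum_(t <- ts) F t (chart_center p).
  by apply: key; rewrite /box !subrr normr0.
rewrite -[X in has_laplacian _ _ X]addr0; apply: has_laplacianD; first exact: has_laplacian_cst.
apply: has_laplacian_sum => t tts.
have <- : 0 + (-1) * 0 = 0 :> R by rewrite mulr0 addr0.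
apply: has_laplacianD; first by apply: log_lin_has_laplacian; exact: k1.
apply: has_laplacianZ; apply: log_lin_has_laplacian.
by rewrite lt_neqAle lin_sq_ge0 eq_sym den_form_neq0 // chart_centerK.
Qed.

(** Near its pole the coordinate is large, and it is the reciprocal of the local
    coordinate used to normalize Green functions. *)
Lemma near_pole w (rho : R) : \forall p \near (to_sphere w)^',
  rho <= cmod (zetac w p) /\ log_coord (to_sphere w) p = - ln (cmod (zetac w p)).
Proof.
pose rho' := `|rho| + 1.
have rho0 : 0 < rho' by rewrite ltr_wpDl.
have le_rho : rho <= rho' by rewrite (le_trans (ler_norm _)) // lerDl.
case: w => [a|]; rewrite /dnbhs /within /=.
- have h := box_nbhs ((a, 0) : R * R) (r := (2 * rho')^-1).
  have {h} := h _; rewrite invr_gt0 mulr_gt0 // => /(_ isT) h.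
  suff : nbhs (Some (a, 0) : Chat R) (fun p => p != Some (a, 0) ->
     rho <= cmod (zetac (Some a) p) /\ log_coord (Some (a, 0)) p = - ln (cmod (zetac (Some a) p))).
    exact.
  apply/nbhs_chart => /=; apply: filterS h => z [h1 h2] za.
  have e : cmod (z - (a, 0)) = cmod (a - z.1, - z.2).
    rewrite /cmod; congr Num.sqrt.
    by rewrite -[(z - (a, 0)).1]/(z.1 - a) -[(z - (a, 0)).2]/(z.2 - 0) /=; ring.
  rewrite cmod_cinv -e.
  have za' : 0 < cmod (z - (a, 0)).
    by rewrite cmod_gt0 subr_eq0; apply: contra_neq za => ->.
  split; last by rewrite lnV ?opprK.
  apply: le_trans le_rho _; rewrite -[rho']invrK lef_pV2 ?posrE ?invr_gt0 //.
  apply: le_trans (cmod_le_norm1 _) _.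
  have : (2 * rho')^-1 + (2 * rho')^-1 = rho'^-1 by field; rewrite gt_eqF.
  move: h1 h2 => /=; lra.
- suff : nbhs (None : Chat R) (fun p => p != None ->
     rho <= cmod (zetac None p) /\ log_coord None p = - ln (cmod (zetac None p))).
    exact.
  apply/nbhs_chart => /=.
  have h := box_nbhs (0 : R * R) (r := (2 * rho')^-1).
  have {h} := h _; rewrite invr_gt0 mulr_gt0 // => /(_ isT).
  apply: filterS => z [h1 h2]; rewrite /chart_oo; case: (eqVneq z 0) => // z0 _; split => //=.
  rewrite cmod_cinv; apply: le_trans le_rho _; rewrite -[rho']invrK lef_pV2 ?posrE ?invr_gt0 ?cmod_gt0 //.
  apply: le_trans (cmod_le_norm1 _) _.
  have : (2 * rho')^-1 + (2 * rho')^-1 = rho'^-1 by field; rewrite gt_eqF.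
  move: h1 h2 => /=; rewrite !subr0; lra.
Qed.

End Sphere.

(** * The maximum principle *)

Section MaximumPrinciple.
Context {R : realType}.

Definition coord_sq (w : Rhat R) (p : Chat R) : R := cmod (zetac w p - (0, 0)) ^+ 2.

Lemma coord_sq_continuous w p : p <> to_sphere w -> coord_sq w q @[q --> p] --> coord_sq w p.
Proof.
move=> pw; have h := @cmod_zetac_continuous _ w 0 p pw.
rewrite /coord_sq expr2; under eq_fun do rewrite expr2.
exact: (@cvgM _ _ (nbhs p) (nbhs_filter p) _ _ _ _ h h).
Qed.

Lemma coord_sq_has_laplacian w p : p <> to_sphere w ->
  exists2 l, 0 < l & has_laplacian (fun z => coord_sq w (chart p z)) (chart_center p) l.
Proof.
move=> pw.
have d0 := @den_form_neq0 _ w p (chart_center p); rewrite chart_centerK in d0.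
have h := moebius_sq_has_laplacian
  ((in_chart p (num_form w)).1 - 0 * (in_chart p (den_form w)).1)
  ((in_chart p (num_form w)).2 - 0 * (in_chart p (den_form w)).2) (d0 pw).
eexists; last first.
  apply: has_laplacian_near h; apply: filterS (near_chart_neq pw) => z zw.
  by rewrite /coord_sq cmod_zetac.
have det : (((in_chart p (num_form w)).1 - 0 * (in_chart p (den_form w)).1) * (in_chart p (den_form w)).2 -
   ((in_chart p (num_form w)).2 - 0 * (in_chart p (den_form w)).2) * (in_chart p (den_form w)).1) ^+ 2 = 1.
  by case: (p) => [?|]; case: (w) => [?|] /=; ring.
rewrite det mulr1 divr_gt0 // exprn_gt0 //.
by rewrite lt_neqAle eq_sym d0 //= lin_sq_ge0.
Qed.

(** The potential of a polynomial bounded by 1 on E lies below every candidate v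
    for the Green function.  For f = (1 + eta) v - (potential) + eta, the factor
    1 + eta makes f positive near the pole, whatever the bounded error terms,
    and the summand eta makes it positive near E and near the zeros of the
    polynomial.  Hence f can be negative only on a compact set away from all of
    these; if it were, subtracting a small multiple of the strictly subharmonic
    |zeta_w|^2 would still leave an interior minimum, where the Laplacian is
    negative. *)
Lemma potential_le_candidate (w : Rhat R) (E : set (Rhat R)) (c : R) (ts : seq R) (v : Chat R -> R) :
    ~ E w -> 0 < c -> (0 < size ts)%N ->
    (forall x, E x -> abs_poly w c ts (to_sphere x) <= 1) ->
    green_candidate (to_sphere @` E) (to_sphere w) v ->
  forall p, ~ (to_sphere @` E) p -> p <> to_sphere w -> 0 < abs_poly w c ts p ->
    ln (abs_poly w c ts p) / (size ts)%:R <= v p.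
Proof.
move=> Ew c0 ts0 PE [vharm vge0 [M vM]] p0 Ep0 p0w Pp0.
set P := abs_poly w c ts in PE Pp0 *.
set N : R := (size ts)%:R.
have N0 : 0 < N by rewrite ltr0n.
suff main eta : 0 < eta -> 0 <= (1 + eta) * v p0 - ln (P p0) / N + eta.
  apply/ler_addgt0Pr => e e0.
  have v0 := vge0 _ Ep0 p0w.
  have e1 : 0 < e / (v p0 + 1) by rewrite divr_gt0 // ltr_wpDl.
  have := main _ e1; have -> : (1 + e / (v p0 + 1)) * v p0 = v p0 + e - e / (v p0 + 1).
    by field; rewrite gt_eqF // ltr_wpDl.
  lra.
move=> eta0.
pose f p := (1 + eta) * v p - ln (P p) / N + eta.
rewrite -/(f p0) leNgt; apply/negP => f0.
pose G p := p <> to_sphere w -> ~ (to_sphere @` E) p -> 0 < P p -> 0 <= f p.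
have intG p : p <> to_sphere w -> P p <= 1 -> \forall q \near p, G q.
  move=> pw Pp1.
  have : \forall q \near p, P q < expR (eta * N).
    apply: (cvgr_lt _ (@abs_poly_continuous _ w c ts p pw)).
    by apply: le_lt_trans Pp1 _; rewrite -expR0 ltr_expR mulr_gt0.
  apply: filterS => q qP qw Eq Pq.
  have : ln (P q) / N <= eta.
    rewrite ler_pdivrMr // -[eta * N]expRK ler_ln ?posrE ?expR_gt0 //; exact: ltW.
  have := mulr_ge0 (ltW eta0) (vge0 _ Eq qw); have := vge0 _ Eq qw.
  by rewrite /f mulrDl mul1r; lra.
have intGw : \forall q \near to_sphere w, G q.
  pose B := \sum_(t <- ts) `|t|.
  have tB t : t \in ts -> `|t| <= B.
    by move=> tts; rewrite /B (big_rem _ tts) /= lerDl sumr_ge0.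
  (* eta ln|zeta| must absorb the errors in v and in the potential *)
  pose C := (1 + eta) * M + `|ln c| / N + ln 2.
  have Np := near_pole w (Num.max (Num.max B 1) (expR (C / eta))).
  have : \forall p \near (to_sphere w)^', G p.
    apply: filterS2 vM Np => q qM [qrho qlog] qw Eq Pq.
    move: qrho; rewrite !ge_max => /andP[/andP[qB q1] qC].
    set r := cmod (zetac w q) in qlog qB q1 qC.
    have r0 : 0 < r by apply: lt_le_trans q1.
    have [lnP tpos] := ln_abs_poly Pq c0.
    have hP : ln (P q) <= ln c + N * ln (2 * r).
      rewrite /P lnP lerD2l /N -sum1_size natr_sum mulr_suml !big_seq.
      apply: ler_sum => t tts; rewrite mul1r ler_ln ?posrE ?mulr_gt0 ?tpos //.
      apply: le_trans (_ : cmod (zetac w q) + cmod (- (t, 0)) <= _); first exact: cmodD.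
      rewrite cmodN cmod_real mulr_natl mulr2n lerD2l.
      exact: le_trans (tB _ tts) qB.
    have hv : ln r - M <= v q.
      by move: qM; rewrite qlog ler_norml => /andP[]; lra.
    have hr : C <= eta * ln r.
      rewrite mulrC -ler_pdivrMr // -[C / eta]expRK ler_ln ?posrE ?expR_gt0 //.
    have h2 : ln (P q) / N <= `|ln c| / N + ln 2 + ln r.
      rewrite ler_pdivrMr // !mulrDl divfK ?gt_eqF // -addrA -mulrDl -lnM ?posrE //.
      by apply: le_trans hP _; rewrite mulrC lerD2r ler_norm.
    have h3 : (1 + eta) * (ln r - M) <= (1 + eta) * v q.
      by rewrite ler_pM2l // addr_gt0.
    rewrite /f; move: hr h3; rewrite /C; lra.
  move=> h.
  have {}h : nbhs (to_sphere w) (fun q => q != to_sphere w -> G q) by exact: h.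
  by apply: filterS h => q h qw; apply: h => //; exact/eqP.
(* Kc is closed by construction; it avoids w, E and the zeros of P, since there
   G holds in a whole neighborhood *)
pose Kc : set (Chat R) := ~` [set p : Chat R | \forall q \near p, G q].
have Kc_neq p : Kc p -> p <> to_sphere w by move=> Kp e; apply: Kp; rewrite /= e.
have Kc_P p : Kc p -> 1 < P p.
  by move=> Kp; have pw := Kc_neq _ Kp; rewrite ltNge; apply/negP => h; apply: Kp; exact: intG.
have Kc_E p : Kc p -> ~ (to_sphere @` E) p.
  by move=> /Kc_P h [x Ex xp]; move: h; rewrite -xp ltNge PE.
have Kp0 : Kc p0.
  by move=> /= /nbhs_singleton h; have := h p0w Ep0 Pp0; rewrite leNgt f0.
have Kcompact : compact Kc.
  apply: (subclosed_compact _ one_point_compactification_compact) => //.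
  by apply: open_closedC; exact: open_interior.
have psi_cont : {within Kc, continuous (coord_sq w)}.
  apply: continuous_in_subspaceT => p /set_mem /Kc_neq.
  exact: coord_sq_continuous.
have [pm _ psiB] := compact_EVT_max (ex_intro _ p0 Kp0) Kcompact psi_cont.
set B := coord_sq w pm in psiB.
have psi_ge0 p : 0 <= coord_sq w p by exact: sqr_ge0.
have B1 : 0 < B + 1 by rewrite ltr_wpDl // psi_ge0.
(* tau is so small that phi stays above f p0 where f is nonnegative *)
pose tau := - f p0 / (B + 1).
have tau0 : 0 < tau by rewrite divr_gt0 // oppr_gt0.
pose phi p := f p - tau * coord_sq w p.
have phi_cont : {within Kc, continuous phi}.
  apply: continuous_in_subspaceT => p /set_mem Kp.
  have pw := Kc_neq _ Kp.
  have [_ vc] := harmonic_has_laplacian (vharm _ (Kc_E _ Kp) pw).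
  have Pc := @abs_poly_continuous _ w c ts p pw.
  have P0 : 0 < P p by apply: lt_trans (Kc_P _ Kp).
  have lnc : ln (P q) @[q --> p] --> ln (P p).
    by apply: (@continuous_comp _ _ _ P (@ln R)); [exact: Pc|exact: continuous_ln].
  have FF := nbhs_filter p.
  apply: (@cvgB _ _ _ (nbhs p) FF).
    apply: (@cvgD _ _ _ (nbhs p) FF); last exact: cvg_cst.
    apply: (@cvgB _ _ _ (nbhs p) FF); first exact: (@cvgMr _ _ (nbhs p) FF).
    exact: (@cvgMl _ _ (nbhs p) FF).
  by apply: (@cvgMr _ _ (nbhs p) FF); exact: coord_sq_continuous.
have [p1 p1K p1min] := compact_EVT_min (ex_intro _ p0 Kp0) Kcompact phi_cont.
move/set_mem : p1K => p1K.
have p1w := Kc_neq _ p1K.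
have p1P := Kc_P _ p1K.
have P1 : 0 < P p1 by apply: lt_trans p1P.
have phi_p1 : phi p1 <= f p0.
  apply: le_trans (p1min p0 (mem_set Kp0)) _.
  by rewrite /phi gerBl mulr_ge0 // ltW.
have locmin : \forall q \near p1, phi p1 <= phi q.
  have n1 := near_neq p1w.
  have n2 : \forall q \near p1, 1 < P q by exact: (cvgr_gt _ (@abs_poly_continuous _ w c ts p1 p1w)).
  have n3 : \forall q \near p1, coord_sq w q < B + 1.
    apply: (cvgr_lt _ (@coord_sq_continuous w p1 p1w)).
    by rewrite ltr_pwDr // psiB //; exact: mem_set.
  apply: filterS3 n1 n2 n3 => q qw qP qB.
  have [Kq|/contrapT] := pselect (Kc q); first by apply: p1min; exact: mem_set.
  move=> /= /nbhs_singleton Gq.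
  have fq : 0 <= f q.
    apply: Gq => //; last exact: lt_trans qP.
    by move=> [x Ex xq]; move: qP; rewrite -xq ltNge PE.
  apply: le_trans phi_p1 _; rewrite /phi.
  have h : tau * coord_sq w q <= tau * (B + 1) by rewrite ler_pM2l // ltW.
  move: h; rewrite {2}/tau divfK ?gt_eqF //; lra.
have [l l0 psil] := coord_sq_has_laplacian p1w.
have [vl _] := harmonic_has_laplacian (vharm _ (Kc_E _ p1K) p1w).
have Pl := ln_abs_poly_has_laplacian c0 p1w P1.
have phil : has_laplacian (fun z => phi (chart p1 z)) (chart_center p1) (- tau * l).
  have h := has_laplacianD (has_laplacianD (has_laplacianD (has_laplacianZ (1 + eta) vl)
    (has_laplacianZ (- N^-1) Pl)) (has_laplacian_cst (chart_center p1) eta)) (has_laplacianZ (- tau) psil).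
  rewrite !mulr0 !add0r in h.
  apply: has_laplacian_near h; near=> z.
  by rewrite /phi /f !mulNr [N^-1 * _]mulrC.
have : 0 <= - tau * l.
  apply: laplacian_at_min phil; move/nbhs_chart: locmin.
  by rewrite chart_centerK.
by rewrite mulNr oppr_ge0 leNgt mulr_gt0.
Unshelve. all: by end_near. Qed.

End MaximumPrinciple.

(** * Fekete polynomials of the set of limit points *)

(** A point with real coordinate lies on the real circle. *)
Lemma zetac_real {R : realType} (w : Rhat R) (p : Chat R) : p <> to_sphere w ->
  (zetac w p).2 = 0 -> p = to_sphere (zetainv w (zetac w p).1).
Proof.
case: p w => [[x y]|] [a|] //=.
- rewrite /cinv /= => h y0.
  have [a0|a0] := eqVneq (a - x) 0.
    exfalso; apply: h; congr (Some (_, _)); first lra.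
    move: y0; rewrite a0 expr0n add0r opprK => /eqP; rewrite mulf_eq0 invr_eq0 sqrf_eq0 oppr_eq0 orbb.
    by move/eqP.
  have y0' : y = 0.
    move: y0; rewrite opprK => /eqP; rewrite mulf_eq0 invr_eq0.
    have : (a - x) ^+ 2 + (- y) ^+ 2 != 0.
      by rewrite paddr_eq0 ?sqr_ge0 // negb_and sqrf_eq0 a0.
    by move/negbTE ->; rewrite orbF => /eqP.
  have -> : (a - x) / ((a - x) ^+ 2 + (- y) ^+ 2) = (a - x)^-1.
    by rewrite y0' oppr0 expr0n addr0; field.
  by rewrite invr_eq0 (negbTE a0) /= invrK y0'; congr (Some (_, _)); ring.
- by move=> _ ->.
- by move=> _ _; rewrite eqxx.
Qed.

Section FeketeData.
Context {R : realType}.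
Variables (w : Rhat R) (S : set (Rhat R)).
Hypotheses (Scl : closed S) (Sw : ~ S w).

(** The points of S close to its limit points; all but finitely many points of S
    are of this kind. *)
Definition near_ess (m : nat) : set R :=
  [set s | S (zetainv w s) /\ exists2 t, limit_point S (zetainv w t) & `|s - t| < m.+1%:R^-1].

(** The degree (m+1)! is divisible by every given integer from some m on, which
    lets the zeros be cut into a prescribed number of blocks of equal size. *)
Definition fekete_data (m : nat) (c : R) (ts : seq R) : Prop :=
  [/\ 0 < c, size ts = (m.+1)`!, {in ts, forall x, near_ess m x},
    forall x, near_ess m x -> c * \prod_(t <- ts) `|x - t| <= 1 &
    forall (z : R * R) (d D : R), 0 < d ->
      (forall x, near_ess m x -> d <= cmod (z - (x, 0)) <= D) ->
      d / (2 * ((m.+1)`!).+1%:R * D) <= c * \prod_(t <- ts) cmod (z - (t, 0))].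

Lemma limit_point_sub : limit_point S `<=` S.
Proof. by move=> x /subset_limit_point; rewrite -(closure_id S).1. Qed.

Lemma ess_near_ess m t : limit_point S (zetainv w t) -> near_ess m t.
Proof.
move=> Et; split; first exact: limit_point_sub.
by exists t => //; rewrite subrr normr0 invr_gt0.
Qed.

Lemma exists_fekete_data m : limit_point S !=set0 -> exists c ts, fekete_data m c ts.
Proof.
move=> [x0 Ex0].
have x0w : x0 <> w by move=> e; apply: Sw; rewrite -e; exact: limit_point_sub.
have [B B0 BP] := bounded_zetainv Scl Sw.
have inf : infinite_set (near_ess m).
  have e0 : limit_point (zetainv w @^-1` S) (zeta w x0).
    by rewrite -limit_point_zetainv //= zetaK.
  move/limit_point_infinite_setP: e0 => /(_ (ball (zeta w x0) m.+1%:R^-1)).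
  have nb : nbhs (zeta w x0) (ball (zeta w x0) m.+1%:R^-1).
    by apply: nbhsx_ballx; rewrite invr_gt0.
  move=> /(_ nb); apply: contra_not; apply: sub_finite_set => s [sb Ss].
  by split => //; exists (zeta w x0); [rewrite zetaK|rewrite distrC].
have [c [ts [? ? ? ? ?]]] := @fekete_polynomial _ _ B (m.+1)`! inf (fun x xn => BP x xn.1).
by exists c, ts.
Qed.

(** An infinite bounded set of far points would accumulate at a limit point of S. *)
Lemma finite_far m : finite_set ((zetainv w @^-1` S) `\` near_ess m).
Proof.
apply: contrapT => inf.
have [B B0 BP] := bounded_zetainv Scl Sw.
have bd : bounded_set ((zetainv w @^-1` S) `\` near_ess m).
  exists B; split; first exact: num_real.
  by move=> M BM s [Ss _]; apply: le_trans (BP _ Ss) (ltW BM).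
have [l lP] := infinite_bounded_limit_point_nonempty inf bd.
have El : limit_point S (zetainv w l).
  suff : (zetainv w @^-1` limit_point S) l by [].
  rewrite limit_point_zetainv // => V /lP[y [yl [Sy _] Vy]].
  by exists y.
have nb : nbhs l (ball l m.+1%:R^-1) by apply: nbhsx_ballx; rewrite invr_gt0.
have [y [_ [Sy ny] yb]] := lP _ nb.
by apply: ny; split => //; exists l => //; rewrite distrC.
Qed.

Lemma abs_poly_real c ts x :
  abs_poly w c ts (to_sphere x) = c * \prod_(t <- ts) `|zeta w x - t|.
Proof.
congr (_ * _); apply: eq_bigr => t _; rewrite zetac_to_sphere -cmod_real; congr cmod.
by congr (_, _); rewrite /= subr0.
Qed.

Lemma cmod_lin_lower (a b : R) (z z0 : R * R) :
  cmod (a * z0.1 + b, a * z0.2) - `|a| * (`|z.1 - z0.1| + `|z.2 - z0.2|) <= cmod (a * z.1 + b, a * z.2).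
Proof.
rewrite lerBlDr; apply: le_trans (_ : cmod (a * z.1 + b, a * z.2) + cmod (a * (z0.1 - z.1), a * (z0.2 - z.2)) <= _).
  apply: le_trans (cmodD _ _); rewrite le_eqVlt; apply/orP; left; apply/eqP.
  by congr cmod; congr (_, _) => /=; ring.
rewrite lerD2l; apply: le_trans (cmod_le_norm1 _) _ => /=.
by rewrite !normrM -mulrDr distrC [`|z0.2 - _|]distrC.
Qed.

Lemma separated_from_ess p : p <> to_sphere w -> ~ (to_sphere @` limit_point S) p ->
  exists2 d, 0 < d & forall t, limit_point S (zetainv w t) -> d <= cmod (zetac w p - (t, 0)).
Proof.
move=> pw Ep.
have [z2|z2] := eqVneq (zetac w p).2 0; last first.
  exists `|(zetac w p).2|; first by rewrite normr_gt0.
  move=> t _; apply: le_trans (normr2_le_cmod _).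
  by rewrite -[(zetac w p - (t, 0)).2]/((zetac w p).2 - 0) subr0.
set s := (zetac w p).1.
have pE : p = to_sphere (zetainv w s) by exact: zetac_real.
have es : ~ limit_point (zetainv w @^-1` S) s.
  by rewrite -limit_point_zetainv // => h; apply: Ep; exists (zetainv w s).
have ecl : closed (limit_point (zetainv w @^-1` S)).
  by apply: limit_point_closed; apply: hausdorff_accessible; exact: Rhausdorff.
have /nbhs_ballP[d /= d0 dP] : nbhs s (~` limit_point (zetainv w @^-1` S)).
  by apply: open_nbhs_nbhs; split => //; exact: closed_openC.
exists d => // t Et; apply: le_trans (normr1_le_cmod _).
rewrite -[(zetac w p - (t, 0)).1]/(s - t) leNgt; apply/negP => h.
by apply: (dP t) => //; rewrite -limit_point_zetainv.
Qed.

(** Uniform position of a point p off the limit set: on a square of the chart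
    around p, the numerators and the denominator of all the homographies
    zeta_w - s, with s near the limit set, are bounded away from zero. *)
Lemma separated_in_chart p : p <> to_sphere w -> ~ (to_sphere @` limit_point S) p ->
  exists A r d m0, [/\ 0 < r, 0 < d,
    forall m s, (m0 <= m)%N -> near_ess m s ->
      `|(in_chart p (num_form w)).1 - s * (in_chart p (den_form w)).1| <= A &
    forall z, box (chart_center p) r z ->
      [/\ chart p z <> to_sphere w,
        d ^+ 2 <= lin_sq (in_chart p (den_form w)).1 (in_chart p (den_form w)).2 z &
        forall m s, (m0 <= m)%N -> near_ess m s ->
          d ^+ 2 <= lin_sq ((in_chart p (num_form w)).1 - s * (in_chart p (den_form w)).1)
                           ((in_chart p (num_form w)).2 - s * (in_chart p (den_form w)).2) z]].
Proof.
move=> pw Ep.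
have [B B0 BP] := bounded_zetainv Scl Sw.
have [d0 d00 d0P] := separated_from_ess pw Ep.
set n := in_chart p (num_form w); set e := in_chart p (den_form w).
set z0 := chart_center p.
have D0 : 0 < cmod (e.1 * z0.1 + e.2, e.1 * z0.2).
  rewrite lt_neqAle cmod_ge0 andbT eq_sym -sqrf_eq0 cmod_sqr /=.
  by apply: den_form_neq0; rewrite chart_centerK.
set D := cmod _ in D0.
have [m0 m0P] : exists m0 : nat, forall m, (m0 <= m)%N -> m.+1%:R^-1 <= d0 / 2.
  exists (Num.bound (2 / d0)) => m mm.
  rewrite -[d0 / 2]invrK lef_pV2 ?posrE ?invr_gt0 ?divr_gt0 // invf_div.
  apply: le_trans (ltW (archi_boundP _)) _; first by rewrite divr_ge0 // ltW.
  by rewrite ler_nat ltnW.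
(* A bounds the slopes of the numerators; r is small enough for the values at
   the center of the square to drop by at most one half *)
pose A := `|n.1| + B * `|e.1|.
have A0 : 0 <= A by rewrite addr_ge0 // mulr_ge0 // ltW.
pose r := Num.min (D / (4 * (`|e.1| + 1))) (d0 * D / (8 * (A + 1))).
pose d := Num.min (D / 2) (d0 * D / 4).
have r0 : 0 < r by rewrite lt_min !divr_gt0 ?mulr_gt0 ?ltr_wpDl.
have d_gt0 : 0 < d by rewrite lt_min !divr_gt0 ?mulr_gt0.
have AP m s : near_ess m s -> `|n.1 - s * e.1| <= A.
  move=> [Ss _]; apply: le_trans (ler_normB _ _) _.
  by rewrite normrM lerD2l ler_wpM2r // BP.
exists A, r, d, m0; split => // [m s _|z [z1 z2]]; first exact: AP.
have rr : `|z.1 - z0.1| + `|z.2 - z0.2| <= 2 * r by lra.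
have le_sq (x y : R) : 0 < x -> x <= y -> x ^+ 2 <= y ^+ 2.
  by move=> x0 xy; rewrite lerXn2r ?nnegrE // ?ltW // (lt_le_trans x0).
have den : d <= cmod (e.1 * z.1 + e.2, e.1 * z.2).
  apply: le_trans (cmod_lin_lower _ _ _ z0); rewrite -/D.
  have : `|e.1| * (`|z.1 - z0.1| + `|z.2 - z0.2|) <= D / 2.
    apply: le_trans (_ : (`|e.1| + 1) * (2 * (D / (4 * (`|e.1| + 1)))) <= _).
      apply: ler_pM => //; rewrite ?addr_ge0 ?lerDl //.
      by apply: le_trans rr _; rewrite ler_pM2l // ge_min lexx.
    by rewrite le_eqVlt; apply/orP; left; apply/eqP; field; rewrite gt_eqF // ltr_wpDl.
  have : d <= D / 2 by rewrite ge_min lexx.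
  lra.
split.
- move=> /den_form_eq0 h; move: (lt_le_trans d_gt0 den).
  by rewrite cmod_gt0 -cmod_eq0 -sqrf_eq0 cmod_sqr /= -[X in X != 0]/(lin_sq e.1 e.2 z) h eqxx.
- by apply: le_trans (le_sq _ _ d_gt0 den) _; rewrite cmod_sqr.
- move=> m s mm sn; set a := n.1 - _; set b := n.2 - _.
  have [_ [t Et st]] := sn.
  have h0 : d0 / 2 <= cmod (zetac w p - (s, 0)).
    apply: le_trans (_ : cmod (zetac w p - (t, 0)) - cmod (s - t, 0) <= _).
      by have := d0P _ Et; have := le_trans (ltW st) (m0P _ mm); rewrite cmod_real; lra.
    apply: le_trans (cmodB_ge _ _) _; rewrite le_eqVlt; apply/orP; left; apply/eqP; congr cmod.
    by rewrite -addrA; congr (_ + _); congr (_, _) => /=; ring.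
  have h1 : d0 / 2 * D <= cmod (a * z0.1 + b, a * z0.2).
    have pw' : chart p z0 <> to_sphere w by rewrite chart_centerK.
    have := cmod_zetac s pw'; rewrite -/a -/b -/n -/e chart_centerK => h.
    have -> : cmod (a * z0.1 + b, a * z0.2) = cmod (zetac w p - (s, 0)) * D.
      apply/eqP; rewrite -(@eqrXn2 _ 2) ?mulr_ge0 ?cmod_ge0 // exprMn h /D !cmod_sqr /=.
      by rewrite /lin_sq /lin_re /lin_im divfK // -/(lin_sq e.1 e.2 z0) den_form_neq0.
    by rewrite ler_pM2r.
  have : d <= cmod (a * z.1 + b, a * z.2).
    apply: le_trans (cmod_lin_lower _ _ _ z0).
    have : `|a| * (`|z.1 - z0.1| + `|z.2 - z0.2|) <= d0 * D / 4.
      apply: le_trans (_ : (A + 1) * (2 * (d0 * D / (8 * (A + 1)))) <= _).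
        apply: ler_pM => //.
          by apply: le_trans (AP _ _ sn) _; rewrite lerDl.
        by apply: le_trans rr _; rewrite ler_pM2l // ge_min lexx orbT.
      by rewrite le_eqVlt; apply/orP; left; apply/eqP; field; rewrite gt_eqF // ltr_wpDl.
    have : d <= d0 * D / 4 by rewrite ge_min lexx orbT.
    lra.
  by move=> h2; apply: le_trans (le_sq _ _ d_gt0 h2) _; rewrite cmod_sqr.
Qed.

End FeketeData.

Section Preliminaries.
Context {R : realType}.

Lemma tame_harmonic_eq z0 (r M : R) (f1 f2 : R * R -> R) : (forall z, box z0 r z -> f1 z = f2 z) ->
  tame_harmonic z0 r M f1 -> tame_harmonic z0 r M f2.
Proof.
move=> f12 [g [h gh]]; exists g, h => z zb.
have [dg dh bd lap lip] := gh z zb; split => // i.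
by apply: near_eq_is_derive (dg i); have := box_near zb; apply: filterS => u; exact: f12.
Qed.

(** Logarithmic factors are lost in the limit of n-th roots. *)
Lemma ln_succ_small (C e : R) : 0 < e -> exists n0 : nat, forall n : nat, (n0 <= n)%N -> (0 < n)%N ->
  (C + ln n.+1%:R) / n%:R <= e.
Proof.
move=> e0; pose K := `|C| + 2 / e + e / 2.
exists (Num.bound (2 * K / e)) => n nK n0.
have n0' : 0 < n%:R :> R by rewrite ltr0n.
have K0 : 0 <= K by rewrite !addr_ge0 ?divr_ge0 // ltW.
have h1 : 2 * K / e <= n%:R.
  apply: le_trans (ltW (archi_boundP _)) _; last by rewrite ler_nat.
  by rewrite divr_ge0 ?mulr_ge0 // ltW.
set s := Num.sqrt (n.+1%:R : R).
have s0 : 0 < s by rewrite sqrtr_gt0 ltr0n.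
have ss : s ^+ 2 = n%:R + 1 by rewrite sqr_sqrtr // natr1.
have h2 : ln n.+1%:R <= 2 * s.
  rewrite -natr1 -ss lnXn // mulr2n.
  have := ln_sublinear s0; lra.
have h3 : 2 * s <= e / 2 * s ^+ 2 + 2 / e.
  have : 0 <= (e / 2) * (s - 2 / e) ^+ 2 by rewrite mulr_ge0 ?sqr_ge0 // divr_ge0 // ltW.
  have -> : (e / 2) * (s - 2 / e) ^+ 2 = e / 2 * s ^+ 2 - 2 * s + 2 / e by field; rewrite gt_eqF.
  lra.
rewrite ler_pdivrMr //.
have h4 : K <= e / 2 * n%:R.
  move: h1; rewrite ler_pdivrMr // => h1.
  have -> : e / 2 * n%:R = (n%:R * e) / 2 by ring.
  lra.
have := ler_norm C; move: h3; rewrite ss /K in h4 *; lra.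
Qed.

Lemma ln_le_subr1 (y : R) : 0 < y -> ln y <= y - 1.
Proof.
move=> y0; have := @le_ln1Dx _ (y - 1); rewrite [1 + _]addrC subrK; apply.
by rewrite ltrBrDr addNr.
Qed.

Lemma ln_ratio_bound (r t x : R) : 0 < r -> 2 * t <= r -> 0 <= t -> r - t <= x -> x <= r + t ->
  `|ln x - ln r| <= 2 * t / r.
Proof.
move=> r0 tr t0 rx xr.
have x0 : 0 < x by lra.
have xr0 : 0 < x / r by rewrite divr_gt0.
rewrite -ln_div ?posrE // ler_norml; apply/andP; split.
- have h2 : ln (r / x) <= r / x - 1 by apply: ln_le_subr1; rewrite divr_gt0.
  have -> : ln (x / r) = - ln (r / x) by rewrite -lnV ?posrE ?divr_gt0 // invf_div.
  rewrite lerN2; apply: le_trans h2 _.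
  rewrite lerBlDr ler_pdivrMr // mulrDl mul1r.
  have : 2 * t / r * (r - t) <= 2 * t / r * x.
    by rewrite ler_wpM2l // divr_ge0 ?mulr_ge0 // ltW.
  have -> : 2 * t / r * (r - t) = 2 * t - t * (2 * t / r) by field; rewrite gt_eqF.
  have : t * (2 * t / r) <= t * 1.
    by rewrite ler_wpM2l // ler_pdivrMr // mul1r.
  lra.
- apply: le_trans (ln_le_subr1 xr0) _.
  rewrite lerBlDr ler_pdivrMr // mulrDl mul1r divfK ?gt_eqF //.
  lra.
Qed.

End Preliminaries.

Section FeketePotentials.
Context {R : realType}.
Variables (w : Rhat R) (S : set (Rhat R)).
Hypotheses (Scl : closed S) (Sw : ~ S w).
Variables (c : nat -> R) (ts : nat -> seq R).
Hypothesis data : forall m, fekete_data w S m (c m) (ts m).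

Let E := limit_point S.

Definition pot m p : R := ln (abs_poly w (c m) (ts m) p) / (size (ts m))%:R.
(** Normalized logarithm of the leading coefficient, the analogue of the Robin
    constant for the m-th Fekete polynomial. *)
Definition robin_approx m : R := ln (c m) / (size (ts m))%:R.
Definition off_ess (p : Chat R) := p <> to_sphere w /\ ~ (to_sphere @` E) p.

Let c_gt0 m : 0 < c m. Proof. by have [] := data m. Qed.
Let size_gt0 m : 0 < (size (ts m))%:R :> R.
Proof. by have [_ -> _ _ _] := data m; rewrite ltr0n fact_gt0. Qed.
Let ts_near m t : t \in ts m -> near_ess w S m t.
Proof. by have [_ _ + _ _] := data m; apply. Qed.

Lemma potE m p : 0 < abs_poly w (c m) (ts m) p ->
  pot m p = robin_approx m + (\sum_(t <- ts m) ln (cmod (zetac w p - (t, 0)))) / (size (ts m))%:R.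
Proof. by move=> P0; rewrite /pot /robin_approx (ln_abs_poly P0 (c_gt0 m)).1 mulrDl. Qed.

(** The Lagrange lower bound for Fekete polynomials is of the form
    constant / degree, which is invisible after normalization. *)
Lemma pot_lower p e : off_ess p -> 0 < e ->
  exists m0, forall m, (m0 <= m)%N -> - e <= pot m p /\ 0 < abs_poly w (c m) (ts m) p.
Proof.
move=> [pw Ep] e0.
have [B B0 BP] := bounded_zetainv Scl Sw.
have [A [r [d [m0 [r0 d0 _ sep]]]]] := separated_in_chart Scl Sw pw Ep.
have [_ den sep0] := sep (chart_center p) (conj (eq_ind_r (fun x => `|x| < r) (eq_ind_r (fun x => x < r) r0 (normr0 _)) (subrr _)) (eq_ind_r (fun x => `|x| < r) (eq_ind_r (fun x => x < r) r0 (normr0 _)) (subrr _))).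
set z0 := chart_center p in den sep0.
set Dn := lin_sq _ _ z0 in den.
have Dn0 : 0 < Dn by apply: lt_le_trans den; rewrite exprn_gt0.
pose d' := d / Num.sqrt Dn.
have d'0 : 0 < d' by rewrite divr_gt0 // sqrtr_gt0.
pose D := cmod (zetac w p) + B.
have D0 : 0 < D by rewrite ltr_wpDl // cmod_ge0.
have bnd m s : (m0 <= m)%N -> near_ess w S m s -> d' <= cmod (zetac w p - (s, 0)) <= D.
  move=> mm sn; apply/andP; split.
    rewrite -(@ler_pXn2r _ 2) ?nnegrE ?cmod_ge0 // ?(ltW d'0) //.
    have pw' : chart p z0 <> to_sphere w by rewrite chart_centerK.
    have := cmod_zetac s pw'; rewrite chart_centerK => ->.
    rewrite expr_div_n sqr_sqrtr ?(ltW Dn0) // ler_pM2r ?invr_gt0 //.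
    exact: sep0 mm sn.
  apply: le_trans (cmodD _ _) _; rewrite cmodN cmod_real lerD2l; exact: BP sn.1.
pose C := - ln (d' / (2 * D)).
have [n0 n0P] := ln_succ_small C e0.
exists (maxn m0 n0) => m; rewrite geq_max => /andP[mm mn].
have [_ sz _ _ /(_ (zetac w p) d' D d'0)] := data m.
move=> /(_ (fun x xn => bnd m x mm xn)); rewrite -/(abs_poly w (c m) (ts m) p).
set N := ((m.+1)`!)%N in sz *; set P := abs_poly _ _ _ _ => hP.
have N0 : (0 < N)%N by exact: fact_gt0.
have dD0 : 0 < d' / (2 * D) by rewrite divr_gt0 // mulr_gt0.
have q0 : 0 < d' / (2 * N.+1%:R * D) by rewrite divr_gt0 // !mulr_gt0.
have P0 : 0 < P by exact: lt_le_trans hP.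
split => //; rewrite /pot sz -/P lerNl.
apply: le_trans (n0P N _ N0); last first.
  by apply: leq_trans mn _; apply: leq_trans (leqnSn m) _; exact: fact_geq.
rewrite -mulNr ler_pM2r ?invr_gt0 ?ltr0n // lerNl.
have -> : - (C + ln N.+1%:R) = ln (d' / (2 * N.+1%:R * D)).
  have -> : d' / (2 * N.+1%:R * D) = (d' / (2 * D)) / N.+1%:R.
    have Np : (N.+1%:R : R) != 0 by rewrite pnatr_eq0.
    by move: (N.+1%:R : R) Np => k k0; field; rewrite k0 gt_eqF.
  by rewrite [RHS]ln_div ?posrE ?dD0 ?ltr0n // /C opprD opprK.
by rewrite ler_ln.
Qed.

(** Each factor |zeta - t| equals |zeta| up to a relative error B / |zeta|. *)
Lemma pot_near_pole B m p : 0 < B -> (forall s, S (zetainv w s) -> `|s| <= B) ->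
  2 * B <= cmod (zetac w p) ->
  `|pot m p - (robin_approx m + ln (cmod (zetac w p)))| <= 2 * B / cmod (zetac w p) /\
  0 < abs_poly w (c m) (ts m) p.
Proof.
move=> B0 BP; set r := cmod _ => Br.
have r0 : 0 < r by apply: lt_le_trans Br; rewrite mulr_gt0.
have tB t : t \in ts m -> `|t| <= B by move=> /ts_near[St _]; exact: BP.
have tpos t : t \in ts m -> r - `|t| <= cmod (zetac w p - (t, 0)).
  by move=> tts; apply: le_trans (cmodB_ge _ _); rewrite cmod_real.
have P0 : 0 < abs_poly w (c m) (ts m) p.
  rewrite mulr_gt0 // big_seq prodr_gt0 // => t tts.
  by apply: lt_le_trans (tpos _ tts); have := tB _ tts; lra.
split => //; rewrite potE //.
set N : R := (size (ts m))%:R.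
have N0 : 0 < N by exact: size_gt0.
have -> : robin_approx m + (\sum_(t <- ts m) ln (cmod (zetac w p - (t, 0)))) / N - (robin_approx m + ln r) =
   (\sum_(t <- ts m) (ln (cmod (zetac w p - (t, 0))) - ln r)) / N.
  rewrite sumrB -[X in (_ - X) / N](_ : N * ln r = _); last first.
    by rewrite /N -sum1_size natr_sum mulr_suml; apply: eq_bigr => t _; rewrite mul1r.
  by field; rewrite gt_eqF.
rewrite normrM [X in _ * X]ger0_norm ?invr_ge0 ?(ltW N0) //.
rewrite ler_pdivrMr // mulrC; apply: le_trans (ler_norm_sum _ _ _) _.
rewrite {1}/N -sum1_size natr_sum mulr_suml !big_seq.
apply: ler_sum => t tts; rewrite mul1r.
apply: le_trans (ln_ratio_bound r0 _ (normr_ge0 t) (tpos _ tts) _) _.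
- by have := tB _ tts; lra.
- by apply: le_trans (cmodD _ _) _; rewrite cmodN cmod_real.
- by rewrite ler_pM2r ?invr_gt0 // ler_pM2l // tB.
Qed.

Lemma pot_upper B m p : 0 < B -> (forall s, S (zetainv w s) -> `|s| <= B) ->
  0 < abs_poly w (c m) (ts m) p -> pot m p <= robin_approx m + ln (cmod (zetac w p) + B).
Proof.
move=> B0 BP P0; rewrite potE // lerD2l ler_pdivrMr // mulrC -sum1_size natr_sum mulr_suml !big_seq.
have [_ tpos] := ln_abs_poly P0 (c_gt0 m).
apply: ler_sum => t tts; rewrite mul1r ler_ln ?posrE ?tpos //; last first.
  by rewrite ltr_wpDl // cmod_ge0.
apply: le_trans (cmodD _ _) _; rewrite cmodN cmod_real lerD2l.
by have [St _] := ts_near tts; exact: BP.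
Qed.

(** The potential at a point beyond all the zeros is at most the
    Robin approximation plus a constant, and it is bounded below. *)
Lemma robin_approx_lower : exists C m0, forall m, (m0 <= m)%N -> - C <= robin_approx m.
Proof.
have [B B0 BP] := bounded_zetainv Scl Sw.
pose s := B + 1; pose p : Chat R := to_sphere (zetainv w s).
have off : off_ess p.
  split; first by move=> /to_sphere_inj; exact: zetainv_neq.
  move=> [x Ex /to_sphere_inj xs].
  have := BP s; rewrite -xs => /(_ (limit_point_sub Scl Ex)).
  by rewrite ger0_norm /s ?addr_ge0 ?(ltW B0) // leNgt ltrDl ltr01.
have [m0 m0P] := pot_lower off ltr01.
exists (1 + ln (cmod (zetac w p) + B)), m0 => m /m0P[h1 h2].
by have := pot_upper B0 BP h2; lra.
Qed.

(** The bounds are uniform in m: a potential is an average of kernels which are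
    tame with common constants. *)
Lemma tame_pot p : off_ess p -> exists r M m0, [/\ 0 < r,
  forall z, box (chart_center p) r z -> off_ess (chart p z) &
  forall m, (m0 <= m)%N -> tame_harmonic (chart_center p) r M (fun z => pot m (chart p z))].
Proof.
move=> [pw Ep].
have [A [r [d [m0 [r0 d0 As sep]]]]] := separated_in_chart Scl Sw pw Ep.
set n := in_chart p (num_form w) in As sep; set e := in_chart p (den_form w) in As sep.
pose M1 := A / d + A ^+ 2 / d ^+ 2 + 2 * A ^+ 3 / d ^+ 3.
pose M2 := `|e.1| / d + `|e.1| ^+ 2 / d ^+ 2 + 2 * `|e.1| ^+ 3 / d ^+ 3.
have d20 : 0 < d ^+ 2 by rewrite exprn_gt0.
have cpos z m s : box (chart_center p) r z -> (m0 <= m)%N -> near_ess w S m s ->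
    0 < cmod (zetac w (chart p z) - (s, 0)).
  move=> zb mm sn; have [zw den num] := sep z zb.
  rewrite lt_neqAle cmod_ge0 andbT eq_sym -sqrf_eq0 cmod_zetac // gt_eqF // divr_gt0 //.
    exact: lt_le_trans (num _ _ mm sn).
  exact: lt_le_trans den.
exists r, (M1 + M2), m0; split => // [z zb|m mm].
  have [zw den num] := sep z zb; split => // -[x Ex xz].
  have xw : x <> w by move=> xw; apply: zw; rewrite -xz xw.
  have := cpos z m0 (zeta w x) zb (leqnn _).
  rewrite -xz zetac_to_sphere subrr => h.
  have /h : near_ess w S m0 (zeta w x) by apply: ess_near_ess => //; rewrite zetaK.
  by rewrite cmod_gt0 eqxx.
pose F t z := log_lin (n.1 - t * e.1) (n.2 - t * e.2) z + (-1) * log_lin e.1 e.2 z.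
apply: (@tame_harmonic_eq _ _ _ _ (fun z => robin_approx m + ((size (ts m))%:R)^-1 * \sum_(t <- ts m) F t z)).
  move=> z zb; have [zw den num] := sep z zb.
  have P0 : 0 < abs_poly w (c m) (ts m) (chart p z).
    rewrite mulr_gt0 // big_seq prodr_gt0 // => t tts.
    by apply: cpos zb mm _; exact: ts_near.
  rewrite potE // mulrC; congr (_ + _ * _); rewrite !big_seq; apply: eq_bigr => t tts.
  have [_ ->] := ln_cmod_zetac zw (cpos z m t zb mm (ts_near tts)).
  by rewrite /F mulN1r.
have N0 := size_gt0 m.
apply: (@tame_harmonicW _ _ r _ (0 + `|((size (ts m))%:R)^-1| * ((size (ts m))%:R * (M1 + `|-1| * M2)))) => //.
  by rewrite add0r gtr0_norm ?invr_gt0 // mulKf ?gt_eqF // normrN1 mul1r.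
apply: tame_harmonicD; first exact: tame_harmonic_cst.
apply: tame_harmonicZ; apply: tame_harmonic_sum => t tts.
apply: tame_harmonicD.
  apply: log_lin_tame => //; first exact: As mm (ts_near tts).
  by move=> z zb; have [_ _ num] := sep z zb; apply: num mm _; exact: ts_near.
apply: tame_harmonicZ; apply: log_lin_tame => // z zb.
by have [] := sep z zb.
Qed.

End FeketePotentials.

(** * The Green function as a limit of potentials *)

Section SphereFilters.
Context {R : realType}.

Lemma chart_neq_center (p : Chat R) (r : R) : 0 < r ->
  exists2 z, box (chart_center p) r z & chart p z != p.
Proof.
move=> r0; exists (chart_center p + (r / 2, 0)).
  by split; rewrite /= addrAC subrr add0r ?normr0 // gtr0_norm ?divr_gt0 // ltr_pdivrMr // mulr_natr mulr2n ltrDr.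
case: p => [[x y]|] /=; last first.
  have r20 : (r / 2, 0) != 0 :> R * R.
    by apply/eqP => /(congr1 fst) /= /eqP; rewrite mulf_eq0 gt_eqF //= invr_eq0 pnatr_eq0.
  by rewrite /chart_oo add0r (negbTE r20).
apply/eqP => -[/eqP]; rewrite -subr_eq0 addrAC subrr add0r.
by rewrite mulf_eq0 gt_eqF //= invr_eq0 pnatr_eq0.
Qed.

Lemma sphere_dnbhs_proper (p : Chat R) : ProperFilter p^'.
Proof.
apply: Build_ProperFilter_ex => P PP.
have : nbhs p (fun q => q != p -> P q) by exact: PP.
move=> /nbhs_chart /nbhs_box[r r0 rP].
have [z zb zp] := chart_neq_center p r0.
by exists (chart p z); exact: rP.
Qed.

End SphereFilters.

Section UltraOrder.
Context {R : realType}.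

Lemma ultra_lim_ge (U : set_system nat) (UU : UltraFilter U) (x : nat -> R) (l a : R) :
  x m @[m --> U] --> l -> (\forall m \near U, a <= x m) -> a <= l.
Proof.
move=> xl xa; apply: (closed_cvg [set y : R | a <= y] _ _ _ xl) => //.
Qed.

Lemma ultra_lim_le (U : set_system nat) (UU : UltraFilter U) (x : nat -> R) (l a : R) :
  x m @[m --> U] --> l -> (\forall m \near U, x m <= a) -> l <= a.
Proof.
move=> xl xa; apply: (closed_cvg [set y : R | y <= a] _ _ _ xl) => //.
Qed.

End UltraOrder.

Section GreenLimit.
Context {R : realType}.
Variables (w : Rhat R) (S : set (Rhat R)).
Hypotheses (Scl : closed S) (Sw : ~ S w).
Variables (c : nat -> R) (ts : nat -> seq R).
Hypothesis data : forall m, fekete_data w S m (c m) (ts m).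
Variables (U : set_system nat) (UU : UltraFilter U).
Hypothesis Uoo : forall m0, \forall m \near U, (m0 <= m)%N.
Variable (Gam : R).
Hypothesis robin_le : \forall m \near U, robin_approx c ts m <= Gam.

Let E := limit_point S.
Let pot := pot w c ts.
Let robin_approx := robin_approx c ts.
Let off := off_ess w S.

Let Uge m0 (P : nat -> Prop) : (forall m, (m0 <= m)%N -> P m) -> \forall m \near U, P m.
Proof. by move=> mP; apply: filterS (Uoo m0). Qed.

Lemma robin_approx_ultra_cvg : exists l : R, robin_approx m @[m --> U] --> l.
Proof.
have [C [m0 m0C]] := robin_approx_lower Scl Sw data.
apply: (@bounded_ultra_cvg _ U UU _ (`|C| + `|Gam|)).
apply: filterS2 (Uge m0C) robin_le => m h1 h2.
rewrite ler_norml; apply/andP; split.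
  by have := ler_norm C; have := normr_ge0 Gam; rewrite /robin_approx; lra.
by have := ler_norm Gam; have := normr_ge0 C; rewrite /robin_approx; lra.
Qed.

Lemma pot_ultra_cvg p : off p -> exists l : R, pot m p @[m --> U] --> l.
Proof.
move=> offp.
have [B B0 BP] := bounded_zetainv Scl Sw.
have [m0 m0P] := pot_lower Scl Sw data offp ltr01.
apply: (@bounded_ultra_cvg _ U UU _ (1 + `|Gam| + `|ln (cmod (zetac w p) + B)|)).
apply: filterS2 (Uge m0P) robin_le => m [h1 h2] h3.
have := pot_upper data B0 BP h2.
have := ler_norm Gam; have := ler_norm (ln (cmod (zetac w p) + B)).
have := normr_ge0 Gam; have := normr_ge0 (ln (cmod (zetac w p) + B)).
move=> ? ? ? ? ?; rewrite ler_norml; apply/andP; split; rewrite /pot; lra.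
Qed.

Definition green_lim p : R := lim (pot m p @[m --> U]).
Definition robin_lim : R := lim (robin_approx m @[m --> U]).

Lemma green_lim_cvg p : off p -> pot m p @[m --> U] --> green_lim p.
Proof.
move=> /pot_ultra_cvg[l pl]; rewrite /green_lim.
by rewrite (cvg_lim _ pl) //; exact: Rhausdorff.
Qed.

Lemma robin_lim_cvg : robin_approx m @[m --> U] --> robin_lim.
Proof.
have [l pl] := robin_approx_ultra_cvg; rewrite /robin_lim.
by rewrite (cvg_lim _ pl) //; exact: Rhausdorff.
Qed.

Lemma green_lim_harmonic p : off p -> harmonic_at green_lim p.
Proof.
move=> offp; apply: plane_harmonic_harmonic.
have [r [M [m0 [r0 offb tame]]]] := tame_pot Scl Sw data offp.
apply: (tame_plane_harmonic r0 (M := M)).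
apply: (@tame_harmonic_ultra_lim _ U UU (fun m z => pot m (chart p z))).
  by apply: Uge tame.
by move=> z zb; apply: green_lim_cvg; exact: offb.
Qed.

Lemma green_lim_ge0 p : off p -> 0 <= green_lim p.
Proof.
move=> offp; apply/ler_addgt0Pr => e e0.
rewrite -lerBlDr sub0r.
apply: (ultra_lim_ge UU (green_lim_cvg offp)).
have [m0 m0P] := pot_lower Scl Sw data offp e0.
by apply: (Uge (m0 := m0)) => m /m0P[].
Qed.

Lemma near_pole_off : \forall p \near (to_sphere w)^', off p.
Proof.
have [B B0 BP] := bounded_zetainv Scl Sw.
have h := near_pole w (B + 1).
have h' : \forall p \near (to_sphere w)^', p <> to_sphere w.
  have : nbhs (to_sphere w) (fun p => p != to_sphere w -> p <> to_sphere w).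
    by apply: filterE => q /eqP.
  exact.
apply: filterS2 h h' => p [hB _] pw; split => // -[x Ex xp].
have Sx : S x by exact: (limit_point_sub Scl).
have xw : x <> w by move=> e; apply: Sw; rewrite -e.
move: hB; rewrite -xp zetac_to_sphere cmod_real.
have := BP (zeta w x); rewrite zetaK // => /(_ Sx); lra.
Qed.

Lemma green_lim_near_pole e : 0 < e -> \forall p \near (to_sphere w)^',
  `|green_lim p + log_coord (to_sphere w) p - robin_lim| <= e.
Proof.
move=> e0.
have [B B0 BP] := bounded_zetainv Scl Sw.
have h := near_pole w (Num.max (2 * B) (2 * B / e)).
apply: filterS2 h near_pole_off => p [+ ->] offp.
rewrite ge_max => /andP[h1 h2].
have r0 : 0 < cmod (zetac w p) by apply: lt_le_trans h1; rewrite mulr_gt0.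
have -> : green_lim p - ln (cmod (zetac w p)) - robin_lim = green_lim p - (robin_lim + ln (cmod (zetac w p))) by ring.
apply: (@ultra_lim_norm_le _ U UU (fun m => pot m p - (robin_approx m + ln (cmod (zetac w p))))).
  apply: cvgB; first exact: green_lim_cvg.
  by apply: cvgD; [exact: robin_lim_cvg|exact: cvg_cst].
apply: (Uge (m0 := 0)) => m _.
have [h3 _] := pot_near_pole data m B0 BP h1.
apply: le_trans h3 _.
by rewrite ler_pdivrMr // [e * _]mulrC -ler_pdivrMr.
Qed.

(** Minimality passes to the limit from the potentials, to which the maximum
    principle applies. *)
Lemma green_lim_is_green : E !=set0 -> is_green (to_sphere @` E) (to_sphere w) green_lim.
Proof.
move=> Ene; split.
  split.
  - by move=> p Ep pw; exact: green_lim_harmonic.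
  - by move=> p Ep pw; exact: green_lim_ge0.
  - exists (1 + `|robin_lim|); apply: filterS (green_lim_near_pole ltr01) => p h.
    have := ler_norm_dist h; lra.
move=> v vc p Ep pw.
have offp : off p by split.
apply: (ultra_lim_le UU (green_lim_cvg offp)).
have [m0 m0P] := pot_lower Scl Sw data offp ltr01.
apply: (Uge (m0 := m0)) => m /m0P[_ P0].
have [c0 sz tn Fle _] := data m.
apply: (potential_le_candidate (E := E)) => //.
- by move=> /(limit_point_sub Scl).
- by rewrite sz fact_gt0.
- move=> x Ex; rewrite abs_poly_real; apply: Fle.
  apply: ess_near_ess => //; rewrite zetaK // => xw.
  by apply: Sw; rewrite -xw; exact: limit_point_sub.
Qed.

Lemma green_limE p : E !=set0 -> off p -> green E p (to_sphere w) = green_lim p.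
Proof.
move=> Ene [pw Ep]; have gl := green_lim_is_green Ene.
have := xgetPex (fun=> 0) (ex_intro [set u | is_green (to_sphere @` E) (to_sphere w) u] green_lim gl).
rewrite /green /=; set G := xget _ _ => -[Gc Gmin].
apply/eqP; rewrite eq_le; apply/andP; split.
  by apply: Gmin => //; exact: gl.1.
by apply: gl.2.
Qed.

Lemma robin_const_lim : E !=set0 -> robin_const E (to_sphere w) = robin_lim.
Proof.
move=> Ene; rewrite /robin_const.
have PF := sphere_dnbhs_proper (to_sphere w).
apply: (@cvg_lim _ (@Rhausdorff R) _ _ PF).
apply/(@cvgrPdist_le _ _ _ _ PF) => e e0.
apply: filterS2 near_pole_off (green_lim_near_pole e0) => p offp h.
by rewrite green_limE // distrC.
Qed.

End GreenLimit.

Section GreenApproximation.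
Context {R : realType}.
Variables (w : Rhat R) (S : set (Rhat R)).
Hypotheses (Scl : closed S) (Sw : ~ S w).
Variables (c : nat -> R) (ts : nat -> seq R).
Hypothesis data : forall m, fekete_data w S m (c m) (ts m).
Hypothesis Ene : limit_point S !=set0.

(** If the Robin approximations are bounded, every limit along an ultrafilter is
    the Green function; so some index comes within e of it. *)
Lemma fekete_approximates_green (Gam : R) (p : Chat R) (e : R) : 0 < e ->
    (forall m, robin_approx c ts m <= Gam) -> off_ess w S p ->
  (exists m, robin_const (limit_point S) (to_sphere w) - e <= robin_approx c ts m) /\
  (exists m, green (limit_point S) p (to_sphere w) - e <= pot w c ts m p /\
     0 < abs_poly w (c m) (ts m) p).
Proof.
move=> e0 Gle offp.
have [U [UU ooU]] := ultraFilterLemma eventually_filter.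
have Uoo m0 : \forall m \near U, (m0 <= m)%N by apply: ooU; exact: nbhs_infty_ge.
have Gle' : \forall m \near U, robin_approx c ts m <= Gam by apply: filterE.
split.
  rewrite (robin_const_lim Scl Sw data UU Uoo Gle' Ene).
  have := robin_lim_cvg Scl Sw data UU Uoo Gle' => /cvgrPdist_le /(_ e e0) h.
  have [m] := @filter_ex _ U _ _ h.
  by rewrite ler_norml => /andP[h1 h2]; exists m; lra.
rewrite (green_limE Scl Sw data UU Uoo Gle' Ene offp).
have := green_lim_cvg Scl Sw data UU Uoo Gle' offp => /cvgrPdist_le /(_ e e0) h.
have [m0 m0P] := pot_lower Scl Sw data offp ltr01.
have h' : \forall m \near U, 0 < abs_poly w (c m) (ts m) p.
  by apply: filterS (Uoo m0) => m /m0P[].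
have [m [h1 h2]] := @filter_ex _ U _ _ (filterI h h').
by exists m; split => //; move: h1; rewrite ler_norml => /andP[? ?]; lra.
Qed.

End GreenApproximation.

(** * Measures of finite energy and bounded Robin constants *)

Section LogKernels.
Context {R : realType}.
Local Open Scope ereal_scope.

(** The positive part of -log|r|, with value +oo at 0; it differs from the
    logarithmic kernel by a function which is bounded on bounded sets. *)
Definition logk (r : R) : \bar R := if r == 0%R then +oo else (Num.max (- ln `|r|) 0)%:E.
Definition nlogk (r : R) : \bar R := (Num.max (ln `|r|) 0)%:E.

Lemma logk_ge0 r : 0 <= logk r.
Proof. by rewrite /logk; case: ifP => // _; rewrite lee_fin le_max lexx orbT. Qed.

Lemma nlogk_ge0 r : 0 <= nlogk r.
Proof. by rewrite /nlogk lee_fin le_max lexx orbT. Qed.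

Lemma logk_anti r r' : (`|r| <= `|r'|)%R -> logk r' <= logk r.
Proof.
rewrite /logk; have [//|r0] := eqVneq r 0%R; first by rewrite leey.
have [->|r'0] := eqVneq r' 0%R; first by rewrite normr0 normr_le0 (negbTE r0).
move=> rr; rewrite lee_fin ge_max !le_max lexx orbT andbT lerN2.
by rewrite ler_ln ?posrE ?normr_gt0 // rr.
Qed.

Lemma lne_pos (r : R) : maxe (- lne `|r|%:E) 0 = logk r.
Proof.
rewrite /logk; have [->|r0] := eqVneq r 0%R.
  by rewrite normr0 le0_lneNy ?lexx // maxye.
by rewrite lne_EFin ?normr_gt0 // -EFinN EFin_max.
Qed.

Lemma lne_neg (r : R) : maxe (- - lne `|r|%:E) 0 = nlogk r.
Proof.
rewrite oppeK /nlogk; have [->|r0] := eqVneq r 0%R.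
  by rewrite normr0 le0_lneNy ?lexx // maxNye ln0 ?maxxx.
by rewrite lne_EFin ?normr_gt0 // EFin_max.
Qed.

Lemma measurable_logk : measurable_fun [set: R] logk.
Proof.
apply: (measurable_fun_ifT (f := fun r : R => r == 0%R)) => //.
  by apply: measurable_fun_eqr.
apply/measurable_EFinP; apply: measurable_maxr => //.
by apply: measurable_funN; apply: (measurableT_comp (@measurable_ln R)) => //; exact: measurable_normr.
Qed.

Lemma measurable_nlogk : measurable_fun [set: R] nlogk.
Proof.
apply/measurable_EFinP; apply: measurable_maxr => //.
by apply: (measurableT_comp (@measurable_ln R)) => //; exact: measurable_normr.
Qed.

Lemma measurable_kernel (k : R -> \bar R) : measurable_fun [set: R] k ->
  measurable_fun [set: measurableTypeR R * measurableTypeR R] (fun st => k (st.1 - st.2)%R).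
Proof.
move=> mk; apply: (measurableT_comp mk).
by apply: measurable_funB; [exact: measurable_fst|exact: measurable_snd].
Qed.

Lemma measurable_invr : measurable_fun [set: R] (fun x : R => x^-1%R).
Proof.
have -> : (fun x : R => x^-1%R) = (fun x : R => x * (x ^+ 2) `^ (-1))%R.
  apply/funext => x; rewrite powRN powRr1 ?sqr_ge0 //.
  by have [->|x0] := eqVneq x 0%R; [rewrite invr0 mul0r|field].
apply: measurable_funM => //.
by apply: (measurableT_comp (@measurable_powR R _)) => //; exact: measurable_funX.
Qed.

End LogKernels.

Section FiniteEnergy.
Context {R : realType}.
Variable nu : {finite_measure set (measurableTypeR R) -> \bar R}.
Variable K : set R.
Hypotheses (cK : compact K) (nuK : nu (~` K) = 0%E) (nuT : nu [set: R] <> 0%E).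
Local Open Scope ereal_scope.

Definition log_pot (s : R) : \bar R := \int[nu]_t logk (s - t).

Lemma measurable_log_pot : measurable_fun [set: measurableTypeR R] log_pot.
Proof.
have := @measurable_fun_fubini_tonelli_F _ _ _ _ R nu
  (fun st : measurableTypeR R * measurableTypeR R => logk (st.1 - st.2)%R).
by apply; [exact: measurable_kernel measurable_logk|move=> ?; exact: logk_ge0].
Qed.

(** If the potential exceeded every bound almost everywhere, the energy would be
    infinite. *)
Lemma finite_energy_bounded_log_pot : log_energy nu <> +oo ->
  exists M : nat, nu (K `&` [set s | log_pot s <= M%:R%:E]) != 0.
Proof.
move=> en; apply: contrapT => /forallNP h.
have {}h M : nu (K `&` [set s | log_pot s <= M%:R%:E]) = 0.
  by have /negP := h M; rewrite negbK => /eqP.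
apply: en.
have mK : measurable (K : set (measurableTypeR R)).
  by apply: closed_measurable; exact: compact_closed (@Rhausdorff R) cK.
pose Nn s := \int[nu]_t nlogk (s - t).
have mN : measurable_fun [set: measurableTypeR R] Nn.
  have := @measurable_fun_fubini_tonelli_F _ _ _ _ R nu
    (fun st : measurableTypeR R * measurableTypeR R => nlogk (st.1 - st.2)%R).
  by apply; [exact: measurable_kernel measurable_nlogk|move=> ?; exact: nlogk_ge0].
have innerE s : \int[nu]_t (- lne `|s - t|%R%:E) = log_pot s - Nn s.
  rewrite integralE; congr (_ - _); apply: eq_integral => t _.
    by rewrite funepos.unlock; exact: lne_pos.
  by rewrite funeneg.unlock; exact: lne_neg.
rewrite /log_energy; under eq_integral do rewrite innerE.
have [B [_ BK]] := compact_bounded cK.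
have {}BK s : K s -> (`|s| <= `|B| + 1)%R.
  by apply: BK; rewrite (le_lt_trans (ler_norm _)) // ltrDl.
have mA M : measurable ([set s | log_pot s <= M%:R%:E] : set (measurableTypeR R)).
  rewrite -[X in measurable X]setTI.
  exact: (emeasurable_fun_infty_c measurableT measurable_log_pot).
have Nfin s : K s -> Nn s < +oo.
  move=> Ks; rewrite /Nn (@ge0_negligible_integral _ _ _ nu setT (~` K)) //; first last.
  - by move=> *; exact: nlogk_ge0.
  - by apply: (measurableT_comp measurable_nlogk); apply: measurable_funB.
  - exact: measurableC.
  rewrite setTD setCK.
  apply: (@le_lt_trans _ _ (\int[nu]_(t in K) (Num.max (ln (2 * (`|B| + 1))) 0)%:E)).
    apply: ge0_le_integral => //.
    - by move=> *; exact: nlogk_ge0.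
    - by apply: measurable_funTS; apply: (measurableT_comp measurable_nlogk); apply: measurable_funB.
    - move=> t Kt; rewrite /nlogk lee_fin ge_max !le_max lexx orbT andbT.
      have [->|st] := eqVneq (s - t)%R 0%R.
        by rewrite normr0 ln0 ?lexx ?orbT.
      rewrite ler_ln ?posrE ?normr_gt0 ?mulr_gt0 ?ltr_wpDl //.
      rewrite (le_trans (ler_normB _ _)) // mulr_natl mulr2n lerD ?BK //.
  rewrite integral_cst // ltey_eq fin_numM // fin_num_measure //.
have ae : ae_eq nu setT (fun s => log_pot s - Nn s) (cst +oo).
  have neg : nu.-negligible (~` K `|` \bigcup_M (K `&` [set s | log_pot s <= M%:R%:E])).
    apply: negligibleU.
      by apply/negligibleP; [exact: measurableC|].
    apply: negligible_bigcup => M; apply/negligibleP; last exact: h.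
    exact: measurableI.
  apply: negligibleS neg => s /= ns.
  have [Ks|nK] := pselect (K s); last by left.
  right; apply: contrapT => nM; apply: ns => _.
  have -> : log_pot s = +oo.
    apply/eqyP => A A0; rewrite leNgt; apply/negP => sA; apply: nM.
    exists (Num.bound A) => //; split => //=.
    apply: le_trans (ltW sA) _; rewrite lee_fin ltW //.
    by apply: archi_boundP; exact: ltW.
  by case: (Nn s) (Nfin _ Ks).
have -> : \int[nu]_x (log_pot x - Nn x) = \int[nu]_x (cst +oo) x.
  apply: ae_eq_integral => //.
  by apply: emeasurable_funB => //; exact: measurable_log_pot.
rewrite integral_cst // gt0_mulye // lt0e; apply/andP; split => //.
exact/eqP.
Qed.

End FiniteEnergy.

Section BoundedPotential.
Context {R : realType}.
Variable nu : {finite_measure set (measurableTypeR R) -> \bar R}.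
Local Open Scope ereal_scope.

Lemma logkN (r : R) : logk (- r)%R = logk r.
Proof. by rewrite /logk oppr_eq0 normrN. Qed.

(** A bi-Lipschitz change of variable alters potentials by a bounded amount. *)
Lemma logk_scale (r r' k : R) : (0 < k)%R -> (`|r'| <= k * `|r|)%R ->
  logk r <= logk r' + (`|ln k|%R)%:E.
Proof.
move=> k0 rr; rewrite /logk.
have [r'0|r'0] := eqVneq r' 0%R; first by rewrite addye // leey.
have r0 : r != 0%R.
  apply: contraNneq r'0 => r0; move: rr; rewrite r0 normr0 mulr0 normr_le0.
  by move=> ->.
rewrite (negbTE r0) -EFinD lee_fin ge_max; apply/andP; split; last first.
  by rewrite addr_ge0 // le_max lexx orbT.
apply: le_trans (_ : (- ln `|r'| + ln k <= _)%R).
  have : (ln `|r'| <= ln (k * `|r|))%R by rewrite ler_ln ?posrE ?mulr_gt0 ?normr_gt0.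
  rewrite lnM ?posrE ?normr_gt0 //; lra.
by rewrite lerD // ?ler_norm // le_max lexx.
Qed.

Lemma measurable_logk_shift (phi : R -> R) (t : R) : measurable_fun [set: measurableTypeR R] phi ->
  measurable_fun [set: measurableTypeR R] (fun x => logk (phi x - t)%R).
Proof.
move=> mphi; apply: (measurableT_comp measurable_logk).
by apply: measurable_funB => //; exact: measurable_cst.
Qed.

(** One-dimensional maximum principle.  On the part of D to the right of tau,
    replacing tau by the point of phi(D) nearest to it increases the kernel;
    when this infimum b is not attained, D is exhausted by the sets where
    phi >= b + 1 / (n+1). *)
Lemma half_line_potential (D : set (measurableTypeR R)) (phi : R -> R) (C : R) (tau : R) :
    measurable D -> measurable_fun [set: measurableTypeR R] phi -> (0 <= C)%R ->
    (forall y, D y -> \int[nu]_(x in D) logk (phi x - phi y)%R <= C%:E) ->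
  \int[nu]_(x in D `&` [set x | (tau <= phi x)%R]) logk (phi x - tau)%R <= C%:E.
Proof.
move=> mD mphi C0 DC.
have mge b : measurable ([set x | (b <= phi x)%R] : set (measurableTypeR R)).
  have -> : [set x | (b <= phi x)%R] = phi @^-1` `[b, +oo[%classic.
    by apply/seteqP; split => x /=; rewrite in_itv /= andbT.
  by rewrite -[X in measurable X]setTI; apply: mphi.
set Dt := D `&` _.
have mDt : measurable Dt by apply: measurableI.
have mk t A : measurable_fun A (fun x : measurableTypeR R => logk (phi x - t)%R).
  exact: measurable_funTS (measurable_logk_shift t mphi).
have cmp y G : measurable G -> G `<=` Dt -> Dt y -> (forall x, G x -> (phi y <= phi x)%R) ->
    \int[nu]_(x in G) logk (phi x - tau)%R <= C%:E.
  move=> mG GD [Dy ty] yG.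
  apply: le_trans (DC _ Dy).
  apply: le_trans (_ : \int[nu]_(x in G) logk (phi x - phi y)%R <= _).
    apply: ge0_le_integral => //.
    - by move=> *; exact: logk_ge0.
    - move=> x Gx; apply: logk_anti; have := yG _ Gx => xy.
      by rewrite !ger0_norm ?subr_ge0 ?lerD2l ?lerN2 // (le_trans ty).
  apply: ge0_subset_integral => //.
    by move=> *; exact: logk_ge0.
  by move=> x /GD[].
have [->|/set0P[x0 Dx0]] := eqVneq Dt set0; first by rewrite integral_set0 lee_fin.
pose b := inf (phi @` Dt).
have hinf : has_inf (phi @` Dt).
  by split; [exists (phi x0), x0|exists tau => _ [x [_ xt] <-]].
have [[y Dy yb]|nob] := pselect (exists2 y, Dt y & phi y = b).
  apply: (cmp y) => // x Dx; rewrite yb; apply: ge_inf; first exact: hinf.2.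
  by exists x.
pose G n := Dt `&` [set x | (b + n.+1%:R^-1 <= phi x)%R].
have GE : \bigcup_n G n = Dt.
  apply/seteqP; split => [x [n _ []]|x Dx] //.
  have bx : (b < phi x)%R.
    rewrite lt_neqAle; apply/andP; split.
      by apply/eqP => e; apply: nob; exists x.
    by apply: ge_inf; [exact: hinf.2|exists x].
  have e0 : (0 < phi x - b)%R by rewrite subr_gt0.
  have [n0 n0P] : exists n0 : nat, ((phi x - b)^-1 <= n0.+1%:R)%R.
    exists (Num.bound (phi x - b)^-1).
    apply: le_trans (ltW (archi_boundP _)) _; first by rewrite invr_ge0 ltW.
    by rewrite ler_nat.
  exists n0 => //; split => //=.
  by rewrite -lerBrDl -[(phi x - b)%R]invrK lef_pV2 ?posrE ?invr_gt0 ?ltr0n.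
have mG n : measurable (G n) by apply: measurableI.
have cvgG : \int[nu]_(x in G i) logk (phi x - tau)%R @[i --> \oo] -->
    \int[nu]_(x in \bigcup_i G i) logk (phi x - tau)%R.
  apply: ge0_nondecreasing_set_cvg_integral => //.
  - apply/nondecreasing_seqP => n; rewrite subsetEset => x [Dx xn]; split => //=.
    by apply: le_trans xn; rewrite lerD2l lef_pV2 ?posrE ?ltr0n // ler_nat.
  - by move=> *; exact: logk_ge0.
rewrite -GE -(cvg_lim _ cvgG) //.
apply: lime_le; first by apply/cvg_ex; eexists; exact: cvgG.
apply: nearW => n.
have [_ [y Dy <-] yn] : exists2 u, (phi @` Dt) u & (u < b + n.+1%:R^-1)%R.
  by apply: inf_adherent => //; rewrite invr_gt0.
apply: (cmp y) => //; first by move=> x [].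
by move=> x [_ /=]; apply: le_trans; exact: ltW.
Qed.

(** A potential bounded by C on its own support is bounded by 2 C everywhere:
    apply the one-sided bound on both sides of tau. *)
Lemma bounded_potential (D : set (measurableTypeR R)) (phi : R -> R) (C : R) (tau : R) :
    measurable D -> measurable_fun [set: measurableTypeR R] phi -> (0 <= C)%R ->
    (forall y, D y -> \int[nu]_(x in D) logk (phi x - phi y)%R <= C%:E) ->
  \int[nu]_(x in D) logk (phi x - tau)%R <= (2 * C)%:E.
Proof.
move=> mD mphi C0 DC.
have mge b : measurable ([set x | (b <= phi x)%R] : set (measurableTypeR R)).
  have -> : [set x | (b <= phi x)%R] = phi @^-1` `[b, +oo[%classic.
    by apply/seteqP; split => x /=; rewrite in_itv /= andbT.
  by rewrite -[X in measurable X]setTI; apply: mphi.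
have mk t A : measurable_fun A (fun x : measurableTypeR R => logk (phi x - t)%R).
  exact: measurable_funTS (measurable_logk_shift t mphi).
set A := [set x | (tau <= phi x)%R].
have mA : measurable (A : set (measurableTypeR R)) by exact: mge.
have mDA : measurable (D `&` ~` A) by exact: (measurableI _ _ mD (measurableC mA)).
have -> : D = (D `&` A) `|` (D `&` ~` A) by rewrite -setIUr setUv setIT.
rewrite ge0_integral_setU //; first last.
- by apply/disj_setPS => x [[_ ?] [_ ?]].
- by move=> *; exact: logk_ge0.
- exact: (measurableI _ _ mD mA).
have -> : (2 * C)%:E = C%:E + C%:E by rewrite -EFinD mulr_natl mulr2n.
apply: leeD; first exact: half_line_potential.
have h := @half_line_potential D (fun x => - phi x)%R C (- tau)%R mD _ C0 _.
apply: le_trans (h _ _); first last.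
- move=> y Dy; under eq_integral do rewrite -opprD logkN.
  exact: DC.
- exact: measurable_funN.
have E2 : \int[nu]_(x in D `&` [set x | (- tau <= - phi x)%R]) logk (- phi x - - tau)%R =
   \int[nu]_(x in D `&` [set x | (- tau <= - phi x)%R]) logk (phi x - tau)%R.
  by apply: eq_integral => x _; rewrite -opprD logkN.
rewrite E2; apply: ge0_subset_integral => //.
- apply: (measurableI _ _ mD).
  have -> : [set x | (- tau <= - phi x)%R] = phi @^-1` `]-oo, tau]%classic.
    by apply/seteqP; split => x /=; rewrite in_itv /= lerN2.
  by rewrite -[X in measurable X]setTI; apply: mphi.
- by move=> *; exact: logk_ge0.
- move=> x [Dx /negP]; rewrite -ltNge => h'; split => //=.
  by rewrite lerN2 ltW.
Qed.

End BoundedPotential.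

Section NonpolarBound.
Context {R : realType}.
Variables (w : Rhat R) (S : set (Rhat R)).
Hypotheses (Scl : closed S) (Sw : ~ S w).
Variables (c : nat -> R) (ts : nat -> seq R).
Hypothesis data : forall m, fekete_data w S m (c m) (ts m).
Local Open Scope ereal_scope.

Lemma measurable_zeta : measurable_fun [set: measurableTypeR R] (fun x : R => zeta w (Some x)).
Proof.
case: (w) => [a|] /=; last exact: measurable_id.
by apply: (measurableT_comp measurable_invr); apply: measurable_funB.
Qed.

(** On a set D of positive measure where the potential is bounded, integrate the
    inequality log c_m + sum log|zeta - t| <= 0.  The integral of each
    -log|zeta - t| is bounded independently of t, so log c_m is at most a
    constant times the degree. *)
Lemma nonpolar_robin_bounded : ~ polar (limit_point S) ->
  exists Gam, forall m, (robin_approx c ts m <= Gam)%R.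
Proof.
move=> /existsNP[nu /existsNP[K]] /not_implyP[cK] /not_implyP[KE] /not_implyP[nuK] /not_implyP[nuT en].
have [M nuD] := finite_energy_bounded_log_pot cK nuK nuT en.
pose D : set (measurableTypeR R) := K `&` [set s | log_pot nu s <= M%:R%:E].
have mD : measurable D.
  apply: measurableI; first by apply: closed_measurable; exact: compact_closed (@Rhausdorff R) cK.
  rewrite -[X in measurable X]setTI.
  exact: (emeasurable_fun_infty_c measurableT (measurable_log_pot nu)).
have [B [_ BK]] := compact_bounded cK.
have {}BK s : K s -> (`|s| <= `|B| + 1)%R.
  by apply: BK; rewrite (le_lt_trans (ler_norm _)) // ltrDl.
pose phi x := zeta w (Some x).
(* the coordinate is bi-Lipschitz on the compact set K *)
have [k k0 phik] : exists2 k, (0 < k)%R & forall x y, K x -> K y -> (`|x - y| <= k * `|phi x - phi y|)%R.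
  rewrite /phi; have Kw x : K x -> Some x <> w.
    by move=> /KE /= Ex xw; apply: Sw; rewrite -xw; exact: limit_point_sub.
  case: (w) Kw => [a|] Kw /=; last by exists 1%R => // x y _ _; rewrite mul1r.
  pose L := (`|a| + (`|B| + 1))%R.
  have L0 : (0 < L)%R by rewrite ltr_wpDl // ltr_wpDl.
  have aL x : K x -> (a - x != 0)%R /\ (`|a - x| <= L)%R.
    move=> Kx; split; last by rewrite (le_trans (ler_normB _ _)) // lerD2l BK.
    by apply/eqP => ax; apply: (Kw _ Kx); congr Some; lra.
  exists (L * L)%R; first exact: mulr_gt0.
  move=> x y Kx Ky; have [ax xL] := aL _ Kx; have [ay yL] := aL _ Ky.
  have -> : ((a - x)^-1 - (a - y)^-1 = (x - y) / ((a - x) * (a - y)))%R by field; rewrite ax ay.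
  rewrite normrM normfV normrM mulrCA ler_peMr // ler_pdivlMr ?mul1r ?mulr_gt0 ?normr_gt0 //.
  by rewrite ler_pM.
pose C := (M%:R + `|ln k| * fine (nu setT))%R.
have nu0 : (0 <= fine (nu setT))%R by rewrite fine_ge0.
have C0 : (0 <= C)%R by rewrite addr_ge0 // mulr_ge0.
have mphi : measurable_fun [set: measurableTypeR R] phi by exact: measurable_zeta.
have mk t A : measurable_fun A (fun x : measurableTypeR R => logk (phi x - t)%R).
  exact: measurable_funTS (measurable_logk_shift t mphi).
have DC y : D y -> \int[nu]_(x in D) logk (phi x - phi y)%R <= C%:E.
  move=> [Ky /= yM].
  have ms : measurable_fun [set: measurableTypeR R] (fun x : R => logk (y - x)%R).
    by apply: (measurableT_comp measurable_logk); apply: measurable_funB.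
  apply: le_trans (_ : \int[nu]_(x in D) (logk (y - x)%R + (`|ln k|%R)%:E) <= _).
    apply: ge0_le_integral => //.
    - by move=> *; exact: logk_ge0.
    - by apply: emeasurable_funD => //; exact: measurable_funTS ms.
    - move=> x [Kx _]; apply: logk_scale => //.
      by rewrite distrC phik.
  apply: le_trans (_ : \int[nu]_x (logk (y - x)%R + (`|ln k|%R)%:E) <= _).
    apply: ge0_subset_integral => //; first by apply: emeasurable_funD.
    by move=> *; rewrite adde_ge0 ?logk_ge0 ?lee_fin.
  rewrite ge0_integralD //; last by move=> *; exact: logk_ge0.
  rewrite integral_cst // /C EFinD EFinM fineK ?fin_num_measure //.
  by apply: leeD.
have pot t : \int[nu]_(x in D) logk (phi x - t)%R <= (2 * C)%:E by exact: bounded_potential.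
have nuD0 : (0 < fine (nu D))%R.
  by rewrite fine_gt0 // lt0e nuD measure_ge0 /= -ge0_fin_numE ?fin_num_measure.
exists (2 * C / fine (nu D))%R => m.
have [c0 sz _ Fle _] := data m.
set N : R := (size (ts m))%:R.
have N0 : (0 < N)%R by rewrite /N sz ltr0n fact_gt0.
rewrite /robin_approx ler_pdivrMr // -/N mulrAC ler_pdivlMr //.
have pw x : D x -> (Num.max (ln (c m)) 0)%:E <= \sum_(t <- ts m) logk (phi x - t)%R.
  move=> [Kx _].
  have sum0 : 0 <= \sum_(t <- ts m) logk (phi x - t)%R by apply: sume_ge0 => *; exact: logk_ge0.
  have [[t tts tx]|nz] := pselect (exists2 t, t \in ts m & (phi x - t = 0)%R).
    rewrite (big_rem t) //= {1}/logk tx eqxx addye ?leey //; apply/negbT.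
    by apply/gt_eqF/(@lt_le_trans _ _ 0) => //; apply: sume_ge0 => *; exact: logk_ge0.
  rewrite EFin_max ge_max sum0 andbT.
  have : (c m * \prod_(t <- ts m) `|phi x - t| <= 1)%R.
    apply: Fle; apply: ess_near_ess => //.
    rewrite zetaK; first exact: KE.
    by move=> xw; apply: Sw; rewrite -xw; apply: limit_point_sub => //; exact: KE.
  have pos t : t \in ts m -> (0 < `|phi x - t|)%R.
    by move=> tts; rewrite normr_gt0; apply/eqP => tx; apply: nz; exists t.
  have prod0 : (0 < \prod_(t <- ts m) `|phi x - t|)%R by rewrite big_seq prodr_gt0.
  rewrite -ler_ln ?posrE ?mulr_gt0 // ln1 lnM ?posrE // ln_prod // => h.
  apply: le_trans (_ : (\sum_(t <- ts m) - ln `|phi x - t|)%:E <= _).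
    by rewrite lee_fin sumrN; lra.
  rewrite -sumEFin !big_seq; apply: lee_sum => t tts.
  rewrite /logk -normr_eq0 gt_eqF ?pos // lee_fin le_max lexx //.
have : \int[nu]_(x in D) (Num.max (ln (c m)) 0)%:E <= \int[nu]_(x in D) \sum_(t <- ts m) logk (phi x - t)%R.
  apply: ge0_le_integral => //.
  - by move=> *; rewrite lee_fin le_max lexx orbT.
  - by apply: emeasurable_sum => t; exact: mk.
rewrite integral_cst // ge0_integral_sum //; last by move=> *; exact: logk_ge0.
move=> h.
have : (Num.max (ln (c m)) 0)%:E * nu D <= (2 * C * N)%:E.
  apply: le_trans h _.
  apply: le_trans (_ : \sum_(t <- ts m) (2 * C)%:E <= _).
    by apply: lee_sum => t _; exact: pot.
  by rewrite sumEFin lee_fin big_const_seq count_predT iter_addr_0 /N mulr_natr.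
rewrite -(fineK (fin_num_measure nu _ mD)) -EFinM lee_fin; apply: le_trans.
by rewrite ler_pM2r // le_max lexx.
Qed.

End NonpolarBound.

(** * Limit distributions of Fekete points *)

Section Quantiles.
Context {R : realType}.
Implicit Types (s : seq R) (q h : R -> R).

(** The quantile function of the uniform distribution on the entries of s. *)
Definition quantile s (x : R) : R :=
  nth 0 (sort <=%R s) (minn (Num.truncn (x * (size s)%:R)) (size s).-1).

Lemma quantile_mem s x : (0 < size s)%N -> quantile s x \in s.
Proof.
move=> s0; rewrite -(mem_sort <=%R); apply: mem_nth; rewrite size_sort.
by rewrite gtn_min ltn_predL s0 orbT.
Qed.

Lemma sort_nth_le s d i j : (i <= j)%N -> (j < size s)%N ->
  nth d (sort <=%R s) i <= nth d (sort <=%R s) j.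
Proof.
move=> ij js; apply: (sorted_leq_nth le_trans le_refl) => //.
- exact: sort_le_sorted.
- by rewrite inE size_sort (leq_ltn_trans ij).
- by rewrite inE size_sort.
Qed.

Lemma quantile_nondecreasing s : (0 < size s)%N -> {homo quantile s : x y / x <= y}.
Proof.
move=> s0 x y xy; apply: sort_nth_le; last by rewrite gtn_min ltn_predL s0 orbT.
have : (Num.truncn (x * (size s)%:R) <= Num.truncn (y * (size s)%:R))%N.
  by apply: le_truncn; rewrite ler_wpM2r.
lia.
Qed.

Lemma quantile_block s n b j : size s = (n * b)%N -> (0 < b)%N -> (j < n)%N ->
  quantile s (j%:R / n%:R) = nth 0 (sort <=%R s) (j * b).
Proof.
move=> sz b0 jn; rewrite /quantile sz.
have n0 : n%:R != 0 :> R by rewrite pnatr_eq0; case: n jn {sz}.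
have -> : j%:R / n%:R * (n * b)%:R = (j * b)%:R :> R by rewrite !natrM; field.
rewrite natrK; congr nth; apply/minn_idPl.
have : (j * b < n * b)%N by rewrite ltn_mul2r b0.
by case: (n * b)%N.
Qed.

(** Sampling the sorted list once per block of b entries changes the average of a
    Lipschitz function by at most its Lipschitz constant times the total
    increase of the list divided by the number of blocks. *)
Lemma block_average h (L B : R) s n b : size s = (n * b)%N -> (0 < b)%N -> (0 < n)%N ->
    {in s, forall x, `|x| <= B} -> 0 <= L ->
    (forall u v, `|u| <= B -> `|v| <= B -> h u - h v <= L * `|u - v|) ->
  (\sum_(0 <= j < n) h (quantile s (j%:R / n%:R))) / n%:R <=
    (\sum_(t <- s) h t) / (size s)%:R + L * (2 * B) / n%:R.
Proof.
move=> sz b0 n0 sB L0 hL.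
have s0 : (0 < size s)%N by rewrite sz muln_gt0 n0.
have B0 : 0 <= B.
  by apply: le_trans (normr_ge0 _) (sB (nth 0 s 0) _); exact: mem_nth.
pose t i := nth B (sort <=%R s) i.
have tB i : `|t i| <= B.
  rewrite /t; case: (ltnP i (size s)) => h'.
    by apply: sB; rewrite -(mem_sort <=%R) mem_nth ?size_sort.
  by rewrite nth_default ?size_sort // ger0_norm.
have tle i j : (i <= j)%N -> t i <= t j.
  move=> ij; case: (ltnP j (size s)) => h'; first exact: sort_nth_le.
  rewrite [t j]/t (nth_default _ (s := sort _ _)) ?size_sort //.
  by have := tB i; rewrite ler_norml => /andP[].
have E1 : \sum_(0 <= j < n) h (quantile s (j%:R / n%:R)) = \sum_(0 <= j < n) h (t (j * b)%N).
  apply: eq_big_nat => j /andP[_ jn]; rewrite (quantile_block sz) //; congr h.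
  by apply: set_nth_default; rewrite size_sort sz ltn_mul2r b0.
have E2 : \sum_(x <- s) h x = \sum_(0 <= j < n) \sum_(j * b <= i < j.+1 * b) h (t i).
  rewrite -big_nat_mul -sz -(size_sort <=%R) -(big_nth B xpredT h).
  by apply: perm_big; rewrite perm_sym perm_sort.
have E3 j : (h (t (j * b)%N) - L * (t (j.+1 * b)%N - t (j * b)%N)) *+ b <=
    \sum_(j * b <= i < j.+1 * b) h (t i).
  have <- : \sum_(j * b <= i < j.+1 * b) (h (t (j * b)%N) - L * (t (j.+1 * b)%N - t (j * b)%N)) =
     (h (t (j * b)%N) - L * (t (j.+1 * b)%N - t (j * b)%N)) *+ b.
    by rewrite big_const_nat iter_addr_0 mulSn addnK.
  apply: ler_sum_nat => i /andP[ji ij].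
  have := hL _ _ (tB (j * b)%N) (tB i); rewrite distrC ger0_norm ?subr_ge0 ?tle // => h1.
  have : L * (t i - t (j * b)%N) <= L * (t (j.+1 * b)%N - t (j * b)%N).
    by rewrite ler_wpM2l // lerB // tle // ltnW.
  lra.
have E4 : (\sum_(0 <= j < n) h (t (j * b)%N) - L * (t (n * b)%N - t 0)) *+ b <= \sum_(x <- s) h x.
  have -> : t (n * b)%N - t 0 = \sum_(0 <= j < n) (t (j.+1 * b)%N - t (j * b)%N).
    by rewrite (telescope_sumr (fun j => t (j * b)%N)).
  rewrite mulr_sumr -sumrB -sumrMnl E2; apply: ler_sum => j _; exact: E3.
have tt : L * (t (n * b)%N - t 0) <= L * (2 * B).
  rewrite ler_wpM2l //; have := tB (n * b)%N; have := tB 0.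
  by rewrite !ler_norml => /andP[? ?] /andP[? ?]; lra.
rewrite E1 sz natrM.
have n0' : 0 < n%:R :> R by rewrite ltr0n.
have b0' : 0 < b%:R :> R by rewrite ltr0n.
rewrite invfM mulrCA [n%:R^-1 * _]mulrC -mulrDl ler_pM2r ?invr_gt0 // -lerBlDr ler_pdivlMr //.
by move: E4; rewrite -[(_ - _) *+ b]mulr_natr; apply: le_trans; rewrite ler_wpM2r ?(ltW b0') //; lra.
Qed.

Local Notation leb := (@lebesgue_measure R).

(** The same comparison for a monotone function on [0, 1[ and its values at the
    multiples of 1 / n. *)
Lemma monotone_integral q h (L B : R) n : (0 < n)%N -> 0 <= L ->
    {homo q : x y / x <= y} -> (forall x, `|q x| <= B) ->
    (forall u v, `|u| <= B -> `|v| <= B -> h u - h v <= L * `|u - v|) ->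
    (forall u, 0 <= h u) ->
    measurable_fun [set: measurableTypeR R] (fun x => (h (q x))%:E) ->
  (\int[leb]_(x in `[0%R, 1%R[) (h (q x))%:E <=
    ((\sum_(0 <= j < n) h (q (j%:R / n%:R))) / n%:R + L * (2 * B) / n%:R)%:E)%E.
Proof.
move=> n0 L0 qle qB hL h0 mh.
have n0' : 0 < n%:R :> R by rewrite ltr0n.
pose a (j : nat) : R := j%:R / n%:R.
have aS j : a j <= a j.+1 by rewrite /a ler_pM2r ?invr_gt0 // ler_nat.
have step j : (\int[leb]_(x in `[a j, a j.+1[) (h (q x))%:E <=
   ((h (q (a j)) + L * (q (a j.+1) - q (a j))) / n%:R)%:E)%E.
  apply: (@le_trans _ _ (\int[leb]_(x in `[a j, a j.+1[) (h (q (a j)) + L * (q (a j.+1) - q (a j)))%:E)%E).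
    apply: ge0_le_integral => //.
    - by move=> x _; rewrite lee_fin.
    - exact: measurable_funTS.
    - move=> x /=; rewrite in_itv /= => /andP[x1 x2]; rewrite lee_fin.
      have q1 := qle _ _ x1; have q2 := qle _ _ (ltW x2).
      have := hL _ _ (qB x) (qB (a j)); rewrite ger0_norm ?subr_ge0 // => h1.
      have : L * (q x - q (a j)) <= L * (q (a j.+1) - q (a j)) by rewrite ler_wpM2l // lerB.
      lra.
  rewrite integral_cst //= lebesgue_measure_itv /= lte_fin.
  have aE : a j.+1 - a j = n%:R^-1 by rewrite /a -natr1 mulrDl mul1r addrAC subrr add0r.
  by rewrite -subr_gt0 aE invr_gt0 n0' -EFinD aE.
have ind k : (\int[leb]_(x in `[0%R, a k[) (h (q x))%:E <=
   (\sum_(0 <= j < k) (h (q (a j)) + L * (q (a j.+1) - q (a j))) / n%:R)%:E)%E.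
  elim: k => [|k ih].
    by rewrite /a mul0r set_itvco0 integral_set0 big_nil.
  have a0 : 0 <= a k by rewrite /a divr_ge0 // ltW.
  rewrite (@itv_bndbnd_setU _ _ _ (BLeft (a k))) ?bnd_simp //.
  rewrite ge0_integral_setU //=; first last.
  - apply/disj_setPS => x [] /=; rewrite !in_itv /= => /andP[_ x1] /andP[x2 _].
    by move: (lt_le_trans x1 x2); rewrite ltxx.
  - by move=> x _; rewrite lee_fin.
  - exact: measurable_funTS.
  by rewrite big_nat_recr //= EFinD leeD.
have := ind n.
rewrite [a n]/a divff ?gt_eqF //; move=> h1; apply: le_trans h1 _.
rewrite lee_fin -mulr_suml -mulrDl ler_pM2r ?invr_gt0 // big_split /= lerD2l.
rewrite -mulr_sumr (telescope_sumr (fun j => q (a j))) // ler_wpM2l //.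
have := qB (a n); have := qB (a 0); rewrite !ler_norml => /andP[? ?] /andP[? ?]; lra.
Qed.

End Quantiles.

Section TruncatedKernel.
Context {R : realType}.

(** The kernel truncated at height M: a Lipschitz function of u. *)
Definition logk_trunc (M : nat) (u : R) : R :=
  - ln (Num.max (expR (- M%:R)) (Num.min `|u| 1)).

Lemma logk_truncE M u : (logk_trunc M u)%:E = mine (logk u) (M%:R)%:E.
Proof.
rewrite /logk_trunc /logk; have e1 : expR (- M%:R) <= 1 :> R by rewrite -expR0 ler_expR oppr_le0.
have [->|u0] := eqVneq u 0.
  rewrite normr0 (min_l ler01) (max_l (expR_ge0 _)) expRK opprK.
  by rewrite minye.
rewrite -EFin_min; congr EFin.
have nu0 : 0 < `|u| by rewrite normr_gt0.
have [u1|u1] := lerP `|u| 1.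
  have l0 : ln `|u| <= 0 by rewrite ln_le0.
  rewrite (max_l (_ : 0 <= - ln `|u|)) ?oppr_ge0 //.
  case: (lerP (expR (- M%:R)) `|u|) => h.
    by rewrite min_l // lerNl -ler_expR lnK ?posrE.
  rewrite expRK opprK min_r // lerNr -ler_expR lnK ?posrE // ltW //.
rewrite (max_r e1) ln1 oppr0 max_r ?min_l //.
by rewrite oppr_le0 ln_ge0 // ltW.
Qed.

Lemma logk_trunc_ge0 M u : 0 <= logk_trunc M u.
Proof. by rewrite -lee_fin logk_truncE le_min logk_ge0 /= lee_fin. Qed.

Lemma logk_trunc_lipschitz M u v : logk_trunc M u - logk_trunc M v <= expR M%:R * `|u - v|.
Proof.
rewrite /logk_trunc; set e := expR (- M%:R).
have e0 : 0 < e by exact: expR_gt0.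
set a := Num.max e (Num.min `|u| 1); set b := Num.max e (Num.min `|v| 1).
have ea : e <= a by rewrite le_max lexx.
have eb : e <= b by rewrite le_max lexx.
have a0 : 0 < a by exact: lt_le_trans ea.
have b0 : 0 < b by exact: lt_le_trans eb.
have -> : - ln a - - ln b = ln (b / a) by rewrite lnM ?posrE ?invr_gt0 // lnV ?posrE //; ring.
apply: le_trans (ln_le_subr1 _) _; first exact: divr_gt0.
have -> : b / a - 1 = (b - a) / a by rewrite mulrBl divff // gt_eqF.
have ab : b - a <= `|u - v|.
  have : `|v| <= `|u| + `|u - v|.
    by rewrite -lerBlDl distrC; exact: lerB_dist.
  have d0 := normr_ge0 (u - v) => vu.
  have ma : Num.min `|u| 1 <= a by rewrite /a le_max lexx orbT.
  have : b <= a + `|u - v|; last lra.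
  rewrite /b ge_max; apply/andP; split; first lra.
  by move: ma; case: (lerP `|u| 1) => ?; case: (lerP `|v| 1) => ?; lra.
rewrite ler_pdivrMr //; apply: le_trans ab _.
have -> : expR M%:R = e^-1 by rewrite /e expRN invrK.
rewrite mulrAC ler_peMl // mulrC ler_pdivlMr // mul1r //.
Qed.

(** Moving the point off the real line by e^-M truncates the kernel at height M up
    to a constant; the polynomial lower bound applies there because the
    distance to the zeros is at least e^-M. *)
Lemma logk_trunc_le M (u D : R) : 2 <= D -> `|u| + 1 <= D ->
  logk_trunc M u <= - ln (cmod (u, expR (- M%:R))) + ln D.
Proof.
move=> D2 uD; rewrite /logk_trunc; set e := expR (- M%:R).
have e0 : 0 < e by exact: expR_gt0.
have e1 : e <= 1 by rewrite -expR0 ler_expR oppr_le0.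
have D0 : 0 < D by lra.
set a := Num.max e _.
have a0 : 0 < a by rewrite lt_max e0.
have c0 : 0 < cmod (u, e) by apply: lt_le_trans (normr2_le_cmod _); rewrite /= normr_gt0 gt_eqF.
suff : ln (cmod (u, e)) <= ln (D * a) by rewrite lnM ?posrE //; lra.
rewrite ler_ln ?posrE ?mulr_gt0 //.
apply: le_trans (cmod_le_norm1 _) _; rewrite /= (gtr0_norm e0).
rewrite /a; case: (lerP `|u| 1) => h; case: (lerP e _) => h'; nra.
Qed.

Lemma measurable_logk_trunc M (t : R) (phi : R -> R) : measurable_fun [set: measurableTypeR R] phi ->
  measurable_fun [set: measurableTypeR R] (fun x => (logk_trunc M (t - phi x))%:E).
Proof.
move=> mphi; under eq_fun do rewrite logk_truncE.
apply: measurable_mine => //.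
apply: (measurableT_comp measurable_logk).
by apply: measurable_funB.
Qed.

End TruncatedKernel.

Section QuantileLimit.
Context {R : realType}.
Variables (w : Rhat R) (S : set (Rhat R)).
Hypotheses (Scl : closed S) (Sw : ~ S w).
Variables (c : nat -> R) (ts : nat -> seq R).
Hypothesis data : forall m, fekete_data w S m (c m) (ts m).
Variable Gam : R.
Hypothesis GamP : forall m, robin_approx c ts m <= Gam.
Variables (B : R).
Hypotheses (B0 : 0 < B) (SB : forall s, S (zetainv w s) -> `|s| <= B).

Let node_bound m : {in ts m, forall t, `|t| <= B}.
Proof. by have [_ _ tn _ _] := data m; move=> t /tn[St _]; exact: SB. Qed.

Let size_nodes m : (0 < size (ts m))%N.
Proof. by have [_ -> _ _ _] := data m; rewrite fact_gt0. Qed.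

(** The lower bound for the Fekete polynomial at the point s + i e^-M, read as an
    upper bound for the average of the truncated kernel over the zeros. *)
Lemma node_average_trunc (M : nat) (s e : R) : `|s| <= B + 1 -> 0 < e ->
  exists m0, forall m, (m0 <= m)%N ->
    (\sum_(t <- ts m) logk_trunc M (s - t)) / (size (ts m))%:R <= Gam + e + ln (2 * B + 2).
Proof.
move=> sB e0; set D := 2 * B + 2.
have B1 : 0 < B by exact: B0.
have D2 : (2 : R) <= D by rewrite /D; lra.
have D0 : 0 < D by lra.
pose y : R := expR (- M%:R).
have y0 : 0 < y by exact: expR_gt0.
have y1 : y <= 1 by rewrite -expR0 ler_expR oppr_le0.
have uD t : `|t| <= B -> `|s - t| + 1 <= D.
  by move=> tB; have := ler_normB s t; rewrite /D; lra.
have [n0 n0P] := ln_succ_small (M%:R + ln (2 * D)) e0.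
exists n0 => m mn; have [c0 sz tn _ low] := data m.
set N : R := (size (ts m))%:R.
have N0 : 0 < N by rewrite ltr0n.
have n0m : (n0 <= size (ts m))%N.
  by rewrite sz; apply: leq_trans (fact_geq _); apply: leq_trans mn _.
have cm t : 0 < cmod ((s, y) - (t, 0)).
  by apply: lt_le_trans (normr2_le_cmod _); rewrite /= normr_gt0 subr0 gt_eqF.
have low' : y / (2 * ((m.+1)`!).+1%:R * D) <= c m * \prod_(t <- ts m) cmod ((s, y) - (t, 0)).
  apply: low => // x [Sx _]; apply/andP; split.
    by apply: le_trans (normr2_le_cmod _); rewrite /= subr0 gtr0_norm.
  apply: le_trans (cmod_le_norm1 _) _; rewrite /= subr0 (gtr0_norm y0).
  by have := uD _ (SB Sx); lra.
have pr0 : 0 < \prod_(t <- ts m) cmod ((s, y) - (t, 0)) by apply: prodr_gt0.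
have lnP : ln (\prod_(t <- ts m) cmod ((s, y) - (t, 0))) = \sum_(t <- ts m) ln (cmod ((s, y) - (t, 0))).
  by apply: ln_prod => t _; exact: cm.
move: low'; rewrite -ler_ln ?posrE ?divr_gt0 ?mulr_gt0 ?ltr0n //.
rewrite [ln (c m * _)]lnM ?posrE // lnP ln_div ?posrE ?mulr_gt0 ?ltr0n // expRK mulrAC.
rewrite lnM ?posrE ?mulr_gt0 ?ltr0n // => low'.
have h1 : \sum_(t <- ts m) logk_trunc M (s - t) <= - (\sum_(t <- ts m) ln (cmod ((s, y) - (t, 0)))) + N * ln D.
  have -> : N * ln D = \sum_(t <- ts m) ln D.
    by rewrite big_const_seq count_predT iter_addr_0 /N mulr_natl.
  rewrite -sumrN -big_split /= !big_seq; apply: ler_sum => t tts.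
  have := logk_trunc_le M D2 (uD _ (node_bound tts)).
  by rewrite (_ : (s, y) - (t, 0) = (s - t, y)) //; congr pair; rewrite /= subr0.
have := GamP m; rewrite /robin_approx ler_pdivrMr // => h2.
have := n0P _ n0m (size_nodes m); rewrite {1}sz ler_pdivrMr // => h3.
rewrite ler_pdivrMr //.
have -> : (Gam + e + ln D) * N = Gam * N + e * N + N * ln D by ring.
rewrite -/N in h2 h3; lra.
Qed.

Variables (U : set_system nat) (UU : UltraFilter U) (ooU : \oo `<=` U).
Let UF : ProperFilter U := ultra_proper.

Let Uge m0 (P : nat -> Prop) : (forall m, (m0 <= m)%N -> P m) -> \forall m \near U, P m.
Proof. by move=> h; apply: ooU; exists m0. Qed.

Lemma exists_quantile_limit : exists q : R -> R, forall x, quantile (ts m) x @[m --> U] --> q x.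
Proof.
have /choice[q qP] : forall x, exists l : R, quantile (ts m) x @[m --> U] --> l.
  move=> x; apply: (@bounded_ultra_cvg _ U UU (fun m => quantile (ts m) x) B).
  by apply: (Uge (m0 := 0)) => m _; apply: node_bound; exact: quantile_mem.
by exists q.
Qed.

Variable q : R -> R.
Hypothesis qP : forall x, quantile (ts m) x @[m --> U] --> q x.

Lemma quantile_limit_nondecreasing : {homo q : x y / x <= y}.
Proof.
move=> x y xy; rewrite -subr_ge0.
have h : quantile (ts m) y - quantile (ts m) x @[m --> U] --> q y - q x by apply: cvgB; exact: qP.
apply: (ultra_lim_ge UU h).
apply: (Uge (m0 := 0)) => m _; rewrite /= subr_ge0.
exact: quantile_nondecreasing.
Qed.

Lemma quantile_limit_bound x : `|q x| <= B.
Proof.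
apply: (@ultra_lim_norm_le _ U UU (fun m => quantile (ts m) x)); first exact: qP.
apply: (Uge (m0 := 0)) => m _.
by apply: node_bound; exact: quantile_mem.
Qed.

Lemma quantile_limit_ess x : limit_point S (zetainv w (q x)).
Proof.
have zcl : closed (zetainv w @^-1` limit_point S).
  rewrite (limit_point_zetainv Sw).
  by apply: limit_point_closed; apply: hausdorff_accessible; exact: Rhausdorff.
apply: zcl => V /nbhs_ballP[e /= e0 eV].
have [n0 n0P] : exists n0 : nat, forall m, (n0 <= m)%N -> m.+1%:R^-1 <= e / 2 :> R.
  have e20 : 0 < e / 2 by lra.
  exists (Num.bound (e / 2)^-1) => m hm.
  rewrite invf_ple ?posrE ?ltr0n //; apply: le_trans (ltW (archi_boundP _)) _.
    by rewrite invr_ge0 ltW.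
  by rewrite ler_nat leqW.
have [t [Et tq]] : exists t, limit_point S (zetainv w t) /\ `|q x - t| < e.
  have e20 : 0 < e / 2 by lra.
  have h1 : \forall m \near U, `|q x - quantile (ts m) x| < e / 2.
    by have /cvgrPdist_lt := @qP x; apply.
  have h2 := Uge n0P.
  have [m [mq me]] := filter_ex (filterI h1 h2).
  have [_ _ tn _ _] := data m.
  have [_ [t Et td]] := tn _ (quantile_mem x (size_nodes m)).
  exists t; split => //.
  have -> : q x - t = (q x - quantile (ts m) x) + (quantile (ts m) x - t) by ring.
  apply: le_lt_trans (ler_normD _ _) _.
  by rewrite [ltRHS]splitr; apply: ltrD mq (lt_le_trans td me).
by exists t; split => //; apply: eV.
Qed.

Local Notation leb := (@lebesgue_measure R).

Lemma measurable_quantile_limit : measurable_fun [set: measurableTypeR R] q.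
Proof. by apply: nondecreasing_measurable => //; exact: quantile_limit_nondecreasing. Qed.

(** Both the integral and the averages over the zeros are compared with sums over
    the multiples of 1 / n, where the quantile functions converge. *)
Lemma quantile_limit_trunc_potential (M : nat) (s : R) : `|s| <= B + 1 ->
  (\int[leb]_(x in `[0%R, 1%R[) (logk_trunc M (s - q x))%:E <= (Gam + ln (2 * B + 2))%:E)%E.
Proof.
move=> sB; apply/lee_addgt0Pr => e e0.
pose L : R := expR M%:R.
have L0 : 0 <= L by exact: expR_ge0.
pose h t := logk_trunc M (s - t).
have hL u v : h u - h v <= L * `|u - v|.
  apply: le_trans (logk_trunc_lipschitz _ _ _) _.
  by rewrite (_ : s - u - (s - v) = - (u - v)) ?normrN //; ring.
pose K := L * (2 * B).
have K0 : 0 <= K by rewrite !mulr_ge0 // ltW.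
(* so many blocks that each of the two comparisons costs at most e / 4 *)
pose n := (Num.bound (4 * K / e)).+1.
have n0 : 0 < n%:R :> R by rewrite ltr0n.
have Kn : K / n%:R <= e / 4.
  rewrite ler_pdivrMr // -ler_pdivrMl ?divr_gt0 // invf_div mulrAC.
  apply: le_trans (ltW (archi_boundP _)) _; first by rewrite divr_ge0 ?mulr_ge0 // ltW.
  by rewrite ler_nat leqnSn.
apply: le_trans (@monotone_integral _ q h L B n _ L0 _ _ _ _ _) _ => //.
- exact: quantile_limit_nondecreasing.
- exact: quantile_limit_bound.
- by move=> u; exact: logk_trunc_ge0.
- exact: (measurable_logk_trunc M s measurable_quantile_limit).
rewrite -EFinD lee_fin -/K.
have hcont (t : R) : h @ t --> h t.
  apply/cvgrPdist_le => d d0.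
  near=> u.
  have ut : `|t - u| <= d / L.
    near: u; apply: cvgr_dist_le; last by rewrite divr_gt0 ?expR_gt0.
    exact: cvg_id.
  have Lut : L * `|t - u| <= d by rewrite mulrC -ler_pdivlMr ?expR_gt0.
  rewrite ler_norml; apply/andP; split.
    by have := hL u t; rewrite distrC; lra.
  by have := hL t u; lra.
have cvS k : \sum_(0 <= j < k) h (quantile (ts m) (j%:R / n%:R)) @[m --> U] -->
    \sum_(0 <= j < k) h (q (j%:R / n%:R)).
  elim: k => [|k ih].
    rewrite big_geq //; under eq_fun do rewrite big_geq //; exact: cvg_cst.
  rewrite big_nat_recr //; under eq_fun do rewrite big_nat_recr //.
  apply: cvgD; first exact: ih.
  exact: (continuous_cvg _ (hcont _) (@qP _)).
have cv : (\sum_(0 <= j < n) h (quantile (ts m) (j%:R / n%:R))) / n%:R @[m --> U] -->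
  (\sum_(0 <= j < n) h (q (j%:R / n%:R))) / n%:R.
  apply: cvgM; last exact: cvg_cst.
  exact: cvS.
have e20 : 0 < e / 2 by lra.
have [m0 m0P] := node_average_trunc M sB e20.
suff : (\sum_(0 <= j < n) h (q (j%:R / n%:R))) / n%:R <= Gam + ln (2 * B + 2) + e / 2 + K / n%:R by lra.
apply: (ultra_lim_le UU cv).
apply: (Uge (m0 := maxn m0 n)) => m; rewrite geq_max => /andP[mm0 mn].
have [_ sz _ _ _] := data m.
have [b bE] : exists b, size (ts m) = (n * b)%N.
  have : (n %| size (ts m))%N by rewrite sz; apply: dvdn_fact; rewrite /= leqW.
  by move=> /dvdnP[b ->]; exists b; rewrite mulnC.
have b0 : (0 < b)%N by have := size_nodes m; rewrite bE muln_gt0 => /andP[].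
apply: le_trans (@block_average _ h L B _ n b bE b0 _ (@node_bound m) L0 _) _ => //.
by have := m0P _ mm0; rewrite -/K; lra.
Unshelve. all: by end_near. Qed.

Lemma quantile_limit_potential (s : R) :
  (\int[leb]_(x in `[0%R, 1%R[) logk (s - q x) <= (Num.max (Gam + ln (2 * B + 2)) 0)%:E)%E.
Proof.
have mI : measurable (`[0%R, 1%R[%classic : set (measurableTypeR R)) by [].
(* far from the support the kernel vanishes *)
have [sB|sB] := lerP `|s| (B + 1); last first.
  rewrite (eq_integral (fun=> 0%E)); first by rewrite integral0 lee_fin le_max lexx orbT.
  move=> x _; rewrite /logk.
  have h1 : 1 <= `|s - q x|.
    by have := quantile_limit_bound x; have := lerB_dist s (q x); lra.
  rewrite -normr_eq0 gt_eqF; last lra.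
  by rewrite max_r // oppr_le0 ln_ge0.
apply: (@le_trans _ _ (Gam + ln (2 * B + 2))%:E); last by rewrite lee_fin le_max lexx.
pose g (M : nat) x : \bar R := (logk_trunc M (s - q x))%:E.
have cv x : g M x @[M --> \oo] --> logk (s - q x).
  rewrite /g; under eq_fun do rewrite logk_truncE.
  case E : (logk (s - q x)) => [r| |].
  - apply: cvg_near_cst; exists (Num.bound `|r|) => // M /= hM.
    rewrite min_l // lee_fin (le_trans (ler_norm _)) // (le_trans (ltW (archi_boundP _))) //.
    by rewrite ler_nat.
  - under eq_fun do rewrite minye.
    by apply/cvgenyP; exact: cvg_id.
  - by have := logk_ge0 (s - q x); rewrite E.
have mcv : (\int[leb]_(x in `[0%R, 1%R[) g M x @[M --> \oo] -->
    \int[leb]_(x in `[0%R, 1%R[) limn (g ^~ x))%E.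
  apply: cvg_monotone_convergence => //.
  - by move=> M; apply: measurable_funTS; exact: (measurable_logk_trunc M s measurable_quantile_limit).
  - by move=> M x _; rewrite lee_fin logk_trunc_ge0.
  - move=> x _ M M' MM'; rewrite /g !logk_truncE le_min ge_min lexx /= ge_min lee_fin ler_nat MM' orbT //.
have -> : (\int[leb]_(x in `[0%R, 1%R[) logk (s - q x) = \int[leb]_(x in `[0%R, 1%R[) limn (g ^~ x))%E.
  by apply: eq_integral => x _; apply/esym/cvg_lim => //; exact: cv.
apply: (cvge_to_le mcv); apply: nearW => M.
exact: quantile_limit_trunc_potential.
Qed.

End QuantileLimit.

Section ImageMeasure.
Context {R : realType}.
Local Open Scope ereal_scope.
Local Notation leb := (@lebesgue_measure R).

Variables (D : set (measurableTypeR R)) (X : measurableTypeR R -> measurableTypeR R).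
Hypotheses (mD : measurable D) (Doo : leb D < +oo) (mX : measurable_fun [set: measurableTypeR R] X).

Let m1 := mfrestr mD Doo.
Definition image_measure : set (measurableTypeR R) -> \bar R := pushforward m1 X.

Let m2 := measure_function_pushforward__canonical__measure_function_Measure
  [the {measure set _ -> \bar R} of m1] mX.

Let image_measure0 : image_measure set0 = 0.
Proof. exact: (measure0 m2). Qed.

Let image_measure_ge0 A : 0 <= image_measure A.
Proof. exact: (measure_ge0 m2). Qed.

Let image_measure_sigma_additive : semi_sigma_additive image_measure.
Proof. exact: (@measure_semi_sigma_additive _ _ _ m2). Qed.

HB.instance Definition _ := isMeasure.Build _ _ _ image_measure
  image_measure0 image_measure_ge0 image_measure_sigma_additive.

Let image_measure_fin : fin_num_fun image_measure.
Proof.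
move=> A mA; apply: (@fin_num_measure _ _ _ [the {finite_measure set _ -> \bar R} of m1]).
by rewrite -[Z in measurable Z]setTI; exact (mX measurableT mA).
Qed.

HB.instance Definition _ := Measure_isFinite.Build _ _ _ image_measure image_measure_fin.

Lemma exists_image_measure :
  exists nu : {finite_measure set (measurableTypeR R) -> \bar R},
    (forall A, nu A = leb (D `&` X @^-1` A)) /\
    (forall f : R -> \bar R, (forall x, 0 <= f x) -> measurable_fun [set: measurableTypeR R] f ->
       \int[nu]_x f x = \int[leb]_(x in D) f (X x)).
Proof.
exists [the {finite_measure set _ -> \bar R} of image_measure]; split.
  by move=> A; rewrite /= /image_measure /pushforward /m1 /mfrestr /mrestr setIC.
move=> f f0 mf.
transitivity (\int[pushforward m1 X]_x f x); first by [].
rewrite (ge0_integral_pushforward mX) //.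
rewrite preimage_setT.
have mfX A : measurable_fun A (f \o X).
  by apply: measurable_funTS; exact: measurableT_comp mf mX.
have mCD : measurable (~` D) by exact: measurableC.
rewrite (@ge0_negligible_integral _ _ _ [the {measure set _ -> \bar R} of m1] _ (~` D)) //; last 2 first.
- by move=> x _; exact: f0.
- by transitivity (leb (~` D `&` D)); [by []|rewrite setICl measure0].
rewrite setTD setCK; apply: eq_measure_integral => A mA AD.
by transitivity (leb (A `&` D)); [by []|rewrite setIidl].
Qed.

End ImageMeasure.

(** * Bounded Robin constants rule out polarity *)

Section PolarCriterion.
Context {R : realType}.
Local Open Scope ereal_scope.
Local Notation leb := (@lebesgue_measure R).

(** The energy is the integral of the potential minus a nonnegative term. *)
Lemma bounded_log_pot_energy (nu : {finite_measure set (measurableTypeR R) -> \bar R}) (C : R) :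
  (0 <= C)%R -> (forall s, log_pot nu s <= C%:E) -> log_energy nu <> +oo.
Proof.
move=> C0 hC.
pose Nn s := \int[nu]_t nlogk (s - t).
have mN : measurable_fun [set: measurableTypeR R] Nn.
  have := @measurable_fun_fubini_tonelli_F _ _ _ _ R nu
    (fun st : measurableTypeR R * measurableTypeR R => nlogk (st.1 - st.2)%R).
  by apply; [exact: measurable_kernel measurable_nlogk|move=> ?; exact: nlogk_ge0].
have innerE s : \int[nu]_t (- lne `|s - t|%R%:E) = log_pot nu s - Nn s.
  rewrite integralE; congr (_ - _); apply: eq_integral => t _.
    by rewrite funepos.unlock; exact: lne_pos.
  by rewrite funeneg.unlock; exact: lne_neg.
have N0 s : 0 <= Nn s by apply: integral_ge0 => t _; exact: nlogk_ge0.
rewrite /log_energy; under eq_integral do rewrite innerE.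
apply/eqP; rewrite -ltey; apply: (@le_lt_trans _ _ (\int[nu]_s C%:E)); last first.
  by rewrite integral_cst // ltey_eq fin_numM // fin_num_measure.
have mI : measurable_fun [set: measurableTypeR R] (fun s => log_pot nu s - Nn s).
  by apply: emeasurable_funB => //; exact: measurable_log_pot.
rewrite integralE; apply: (@le_trans _ _ (\int[nu]_s (fun s => log_pot nu s - Nn s)^\+ s)).
  by rewrite -[leRHS]adde0 leeD2l // oppe_le0; apply: integral_ge0 => s _; exact: funeneg_ge0.
apply: ge0_le_integral => //.
- by apply: measurable_funepos.
- move=> s _; rewrite funepos.unlock ge_max lee_fin C0 andbT.
  by apply: le_trans (hC s); rewrite -[leRHS]adde0 leeD2l // oppe_le0.
Qed.

Lemma subset_measure_potential (nu : {finite_measure set (measurableTypeR R) -> \bar R}) (K : set R) (C : R) :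
    compact K -> nu (~` K) = 0 -> (0 <= C)%R ->
    (forall s, K s -> log_pot nu s <= C%:E) ->
  log_energy nu <> +oo.
Proof.
move=> cK nuK C0 KC.
have mK : measurable (K : set (measurableTypeR R)).
  by apply: closed_measurable; exact: compact_closed (@Rhausdorff R) cK.
have mk s A : measurable_fun A (fun x : measurableTypeR R => logk (s - x)%R).
  by apply: measurable_funTS; apply: (measurableT_comp measurable_logk); apply: measurable_funB.
have potK s : log_pot nu s = \int[nu]_(x in K) logk (x - s)%R.
  rewrite /log_pot (@ge0_negligible_integral _ _ _ nu setT (~` K)) //; first last.
  - by move=> *; exact: logk_ge0.
  - exact: measurableC.
  by rewrite setTD setCK; apply: eq_integral => x _; rewrite -logkN opprB.
apply: (@bounded_log_pot_energy nu (2 * C)); first by rewrite mulr_ge0.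
move=> s; rewrite potK; apply: (@bounded_potential _ nu K id C s) => //.
by move=> y Ky; rewrite /= -potK; exact: KC.
Qed.

End PolarCriterion.

Section PolarUnbounded.
Context {R : realType}.
Variables (w : Rhat R) (S : set (Rhat R)).
Hypotheses (Scl : closed S) (Sw : ~ S w).
Variables (c : nat -> R) (ts : nat -> seq R).
Hypothesis data : forall m, fekete_data w S m (c m) (ts m).
Local Open Scope ereal_scope.
Local Notation leb := (@lebesgue_measure R).

(** The quantile function cannot vanish almost everywhere, for then the potential
    at 0 would be infinite. *)
Lemma quantile_support_positive (q : R -> R) (C : R) :
    measurable_fun [set: measurableTypeR R] q ->
    \int[leb]_(x in `[0%R, 1%R[) logk (0 - q x)%R <= C%:E ->
  exists n : nat, leb (`[0%R, 1%R[ `&` [set x | (n.+1%:R^-1 <= `|q x|)%R]) <> 0.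
Proof.
move=> mq qC; apply: contrapT => /forallNP h.
pose I : set (measurableTypeR R) := `[0%R, 1%R[%classic.
have mI : measurable I by exact: measurable_itv.
have mnq : measurable_fun [set: measurableTypeR R] (fun x => `|q x|%R).
  exact: (measurableT_comp (@normr_measurable R setT) mq).
have mge (b : R) : measurable ([set x | (b <= `|q x|)%R] : set (measurableTypeR R)).
  have -> : [set x | (b <= `|q x|)%R] = (fun x => `|q x|%R) @^-1` `[b, +oo[%classic.
    by apply/seteqP; split => x /=; rewrite in_itv /= andbT.
  rewrite -[X in measurable X]setTI.
  exact: (mnq measurableT _ (measurable_itv _)).
have mD n : measurable (I `&` [set x | (n.+1%:R^-1 <= `|q x|)%R]) by exact: (measurableI _ _ mI (mge _)).
have neg : leb.-negligible (\bigcup_n (I `&` [set x | (n.+1%:R^-1 <= `|q x|)%R])).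
  by apply: negligible_bigcup => n; apply/negligibleP => //; exact: contrapT (h n).
pose V := \bigcup_n (I `&` [set x | (n.+1%:R^-1 <= `|q x|)%R]).
have mV : measurable (V : set (measurableTypeR R)) by exact: bigcup_measurable.
have V0 : leb V = 0 by exact: measure_negligible.
have IV x : (I `\` V) x -> q x = 0%R.
  move=> [Ix nV]; apply: contrapT => /eqP q0; apply: nV.
  have nq : (0 < `|q x|)%R by rewrite normr_gt0.
  exists (Num.bound `|q x|^-1) => //; split => //=.
  rewrite invf_ple ?posrE ?ltr0n //; apply: le_trans (ltW (archi_boundP _)) _.
    by rewrite invr_ge0.
  by rewrite ler_nat.
have mk : measurable_fun [set: measurableTypeR R] (fun x => logk (0 - q x)%R).
  apply: (measurableT_comp measurable_logk).
  by apply: measurable_funB => //; exact: measurable_cst.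
move: qC; rewrite (@ge0_negligible_integral _ _ _ leb I V) //; first last.
- by move=> *; exact: logk_ge0.
- exact: measurable_funTS.
rewrite (eq_integral (cst +oo)); last first.
  by move=> x; rewrite inE => /IV ->; rewrite subrr /logk eqxx.
rewrite integral_cst; last exact: measurableD.
have E : leb (I `\` V) = 1%:E.
  have VI : V `<=` I by move=> x [n _ []].
  rewrite measureD //=; last by rewrite lebesgue_measure_itv /= lte_fin ltr01 -EFinD ltry.
  rewrite setIidr // V0 sube0 lebesgue_measure_itv /= lte_fin ltr01.
  by rewrite oppr0 addr0.
rewrite (_ : +oo * _ = +oo) ?leye_eq //.
by transitivity (+oo * 1%:E : \bar R); [congr (_ * _); exact: E|rewrite mule1].
Qed.

(** The limit q of the quantile functions of the zeros pushes Lebesgue measure to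
    the limit set, in the coordinate zeta_w, with bounded potential.  On the
    set where |q| >= e the coordinate is bi-Lipschitz, so that the image measure
    on the line itself has finite energy; e is chosen so that this set is not
    negligible. *)
Lemma bounded_robin_nonpolar (Gam : R) : (forall m, (robin_approx c ts m <= Gam)%R) ->
  ~ polar (limit_point S).
Proof.
move=> GamP pol.
have [B B0 SB] := bounded_zetainv Scl Sw.
have [U [UU ooU]] := ultraFilterLemma eventually_filter.
have [q qP] := exists_quantile_limit data SB UU ooU.
have mq := measurable_quantile_limit data UU ooU qP.
have mnq : measurable_fun [set: measurableTypeR R] (fun x => `|q x|%R).
  exact: (measurableT_comp (@normr_measurable R setT) mq).
pose C := Num.max (Gam + ln (2 * B + 2))%R 0%R.
have pot := quantile_limit_potential data GamP B0 SB UU ooU qP.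
have [n Dn] := quantile_support_positive mq (pot 0%R).
set e : R := (n.+1%:R^-1)%R in Dn.
have e0 : (0 < e)%R by rewrite invr_gt0.
set D : set (measurableTypeR R) := _ `&` _ in Dn.
have mD : measurable D.
  have mI : measurable (`[0%R, 1%R[%classic : set (measurableTypeR R)) by [].
  apply: (measurableI _ _ mI).
  have -> : [set x | (e <= `|q x|)%R] = (fun x => `|q x|%R) @^-1` `[e, +oo[%classic.
    by apply/seteqP; split => x /=; rewrite in_itv /= andbT.
  rewrite -[X in measurable X]setTI.
  exact: (mnq measurableT _ (measurable_itv _)).
have D1 : leb D <= 1%:E.
  apply: (@le_trans _ _ (leb (`[0%R, 1%R[ : set (measurableTypeR R)))).
    by apply: le_measure; rewrite ?inE //; move=> x [].
  by rewrite lebesgue_measure_itv /= lte_fin ltr01 oppr0 addr0.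
have Doo : leb D < +oo by apply: le_lt_trans D1 _; rewrite ltry.
pose psi (s : R) : R := match w with Some a => (a - s^-1)%R | None => s end.
pose A : set R := [set s | limit_point S (zetainv w s) /\ (e <= `|s|)%R].
have AB s : A s -> (`|s| <= B)%R by move=> [Es _]; apply: SB; exact: limit_point_sub.
have A0 s : A s -> s != 0%R by move=> [_ es]; rewrite -normr_gt0; exact: lt_le_trans es.
have psiE s : A s -> zetainv w s = Some (psi s).
  by move=> /A0 s0; rewrite /zetainv /psi; case: (w) => [a|] //; rewrite (negbTE s0).
have cA : compact A.
  apply: (subclosed_compact _ (@segment_compact R (- B) B)); last first.
    by move=> s /AB; rewrite ler_norml /= in_itv.
  apply: closedI.
    rewrite [X in closed X](limit_point_zetainv Sw).
    by apply: limit_point_closed; apply: hausdorff_accessible; exact: Rhausdorff.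
  have E : [set s : R | (e <= `|s|)%R] = (fun x : R => `|x|%R) @^-1` `[e, +oo[%classic.
    by apply/seteqP; split => x /=; rewrite in_itv /= andbT.
  suff : closed [set s : R | (e <= `|s|)%R] by [].
  rewrite E; apply: closed_comp; last exact: interval_closed.
  by move=> s _; exact: norm_continuous.
have psic : {within A, continuous psi}.
  apply: continuous_in_subspaceT => s; rewrite inE => /A0 s0.
  rewrite /psi; case: (w) => [a|]; last exact: cvg_id.
  by apply: cvgB; [exact: cvg_cst|apply: cvgV => //; exact: cvg_id].
have cK := continuous_compact psic cA.
set K := psi @` A in cK.
have KE : K `<=` [set s | limit_point S (Some s)].
  by move=> _ [s As <-] /=; rewrite -psiE //; case: As.
have mpsi : measurable_fun [set: measurableTypeR R] psi.
  rewrite /psi; case: (w) => [a|]; last exact: measurable_id.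
  by apply: measurable_funB => //; exact: measurable_invr.
have mX : measurable_fun [set: measurableTypeR R] (psi \o q) by exact: measurableT_comp mpsi mq.
have [nu [nuE nuI]] := exists_image_measure mD Doo mX.
have DA x : D x -> A (q x).
  by move=> [_ ex]; split => //; exact: (quantile_limit_ess Sw data UU ooU qP).
have nuK : nu (~` K) = 0.
  rewrite nuE (_ : D `&` _ = set0) ?measure0 //.
  by apply/seteqP; split => // x [Dx]; apply; exists (q x) => //; exact: DA.
have nuT : nu [set: R] <> 0 by rewrite nuE preimage_setT setIT.
have [k k0 psik] : exists2 k, (0 < k)%R & forall s t, A s -> A t -> (`|s - t| <= k * `|psi s - psi t|)%R.
  rewrite /psi; case: (w) => [a|]; last by exists 1%R => // s t _ _; rewrite mul1r.
  exists (B * B)%R; first exact: mulr_gt0.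
  move=> s t As At; have s0 := A0 _ As; have t0 := A0 _ At.
  have -> : (a - s^-1 - (a - t^-1) = (s - t) / (s * t))%R by field; rewrite s0 t0.
  rewrite normrM normfV normrM mulrCA ler_peMr // ler_pdivlMr ?mul1r ?mulr_gt0 ?normr_gt0 //.
  by rewrite ler_pM // AB.
pose C1 := (C + `|ln k|)%R.
have C0 : (0 <= C)%R by rewrite /C le_max lexx orbT.
apply: (@subset_measure_potential _ nu K C1 cK nuK) => //; first by rewrite addr_ge0.
  move=> _ [s As <-]; rewrite /log_pot.
  rewrite (nuI (fun t => logk (psi s - t)%R)); first last.
  - by apply: (measurableT_comp measurable_logk); apply: measurable_funB.
  - by move=> x; exact: logk_ge0.
  have mk t A' : measurable_fun A' (fun x : measurableTypeR R => logk (t - q x)%R).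
    apply: measurable_funTS; apply: (measurableT_comp measurable_logk).
    by apply: measurable_funB => //; exact: measurable_cst.
  apply: (@le_trans _ _ (\int[leb]_(x in D) (logk (s - q x)%R + (`|ln k|%R)%:E))).
    apply: ge0_le_integral => //.
    - by move=> *; exact: logk_ge0.
    - apply: measurable_funTS; apply: (measurableT_comp measurable_logk).
      by apply: measurable_funB => //; exact: measurable_cst.
    - by apply: emeasurable_funD => //; exact: mk.
    - by move=> x Dx; apply: logk_scale => //; exact: psik (DA _ Dx).
  rewrite ge0_integralD //; last by move=> *; exact: logk_ge0.
  rewrite integral_cst // /C1 EFinD; apply: leeD.
    apply: le_trans (pot s); apply: ge0_subset_integral => //.
    - by move=> *; exact: logk_ge0.
    - by move=> x [].
  by rewrite -[leRHS]mule1 lee_wpmul2l.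
exact: pol nu K cK KE nuK nuT.
Qed.

End PolarUnbounded.

(** * The support of the measure *)

Section Support.
Context {R : realType}.
Variable mu : probability (borelRhat R) R.
Local Notation S := (msupport mu).

Lemma null_neighborhood x : ~ S x ->
  exists U : set (Rhat R), [/\ open U, U x & mu U = 0%E].
Proof.
move=> nSx; apply: contrapT => h; apply: nSx => U oU Ux.
by rewrite lt0e measure_ge0 andbT; apply/negP => /eqP U0; apply: h; exists U.
Qed.

Lemma closed_msupport : closed S.
Proof.
rewrite -openC openE => x /= /null_neighborhood[U [oU Ux U0]]; rewrite /interior.
apply: (filterS _ (open_nbhs_nbhs (conj oU Ux))) => y Uy /(_ U oU Uy).
by rewrite U0 ltxx.
Qed.

Lemma measurable_msupport : measurable (S : set (borelRhat R)).
Proof.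
rewrite -(setCK S); apply: measurableC; apply: sub_sigma_algebra.
by apply: closed_openC; exact: closed_msupport.
Qed.

Lemma open_measurable_Rhat (U : set (Rhat R)) : open U -> measurable (U : set (borelRhat R)).
Proof. by move=> oU; apply: sub_sigma_algebra. Qed.

Lemma open_Some (a b : R) : open (Some @` `]a, b[%classic : set (Rhat R)).
Proof.
rewrite openE => _ [s + <-]; rewrite /= in_itv /= => sab.
rewrite /interior /= /nbhs /=.
have : \forall t \near s, `]a, b[%classic t.
  by apply: open_nbhs_nbhs; split; [exact: interval_open|rewrite /= in_itv].
by apply: filterS => t tab; exists t.
Qed.

(** The complement of the support is covered by the null intervals with rational
    endpoints and, possibly, the point at infinity. *)
Lemma measure_outside_msupport : mu (~` S : set (borelRhat R)) = 0%E.
Proof.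
have mC : measurable (~` S : set (borelRhat R)) by apply: measurableC; exact: measurable_msupport.
pose I (pq : rat * rat) : set (borelRhat R) := Some @` `]ratr pq.1 : R, ratr pq.2[%classic.
pose F (pq : rat * rat) : set (borelRhat R) := if mu (I pq) == 0%E then I pq else set0.
pose P : set (borelRhat R) := if `[< S None >] then set0 else [set None].
have mI pq : measurable (I pq) by apply: open_measurable_Rhat; exact: open_Some.
have IF pq : mu.-negligible (F pq).
  by apply/negligibleP; rewrite /F; case: eqP.
have NP : mu.-negligible P.
  rewrite /P; case: asboolP => [_|nS]; first exact: negligible_set0.
  have [U [oU Ux U0]] := null_neighborhood nS.
  by exists U; split => //; [exact: open_measurable_Rhat|move=> _ ->].
have NF : mu.-negligible (\bigcup_pq F pq).
  have -> : \bigcup_pq F pq = \bigcup_k (if (unpickle k : option (rat * rat)) is Some pq then F pq else set0).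
    apply/seteqP; split => x.
      by move=> [pq _ Fx]; exists (pickle pq); [exact: Logic.I|rewrite pickleK].
    by move=> [k _]; case: unpickle => [pq Fx|[]]; exists pq; [exact: Logic.I|exact: Fx].
  apply: negligible_bigcup => k; case: unpickle => [pq|]; first exact: IF.
  exact: negligible_set0.
apply: measure_negligible => //.
apply: negligibleS (negligibleU NP NF) => -[s|] nS; last first.
  by left; rewrite /P asboolF.
right.
have [U [oU Ux U0]] := null_neighborhood nS.
have : nbhs (Some s : Rhat R) U by apply: open_nbhs_nbhs.
rewrite /nbhs /= => /nbhs_ballP[e /= e0 eU].
have [p /andP[p1 p2]] : exists p : rat, s - e < ratr p < s.
  by have [p] := @rat_in_itvoo _ (s - e) s (ltac:(lra)); rewrite in_itv; exists p.
have [q /andP[q1 q2]] : exists q : rat, s < ratr q < s + e.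
  by have [q] := @rat_in_itvoo _ s (s + e) (ltac:(lra)); rewrite in_itv; exists q.
exists (p, q) => //; rewrite /F.
have -> : mu (I (p, q)) = 0%E.
  apply/eqP; rewrite -measure_le0 -U0; apply: le_measure; rewrite ?inE //.
    exact: open_measurable_Rhat.
  move=> _ [t + <-]; rewrite /= in_itv /= => /andP[t1 t2]; apply: eU.
  by rewrite /ball /= ltr_norml; apply/andP; split; lra.
by rewrite eqxx; exists s => //; rewrite /= in_itv /= p2.
Qed.

Lemma ess_support_limit_point : ess_support mu = limit_point S.
Proof.
rewrite /ess_support; have h := closure_isolated_limit_point S.
rewrite -(closure_id S).1 in h; last exact: closed_msupport.
have d := disjoint_isolated_limit_point S.
rewrite {1}h setDUl setDv set0U; apply/setDidPl.
by rewrite setIC; apply/disj_set2P.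
Qed.

(** The coordinate is continuous except at its pole. *)
Lemma measurable_zeta_Rhat (w : Rhat R) : measurable_fun [set: borelRhat R] (zeta w).
Proof.
have open_neqw : open [set x : Rhat R | x <> w].
  rewrite openE => x xw; rewrite /interior.
  case: w x xw => [a|] [s|] //= xw; rewrite /nbhs /=.
  - have sa : s != a by apply/eqP => e; apply: xw; rewrite e.
    have : \forall t \near s, t != a by apply: open_nbhs_nbhs; split => //; exact: open_neq.
    by apply: filterS => t /eqP ta [].
  - exists [set a]; first by split; [exact: compact_set1|exact: closed_eq].
    by move=> -[t|] // [[u /= ua [<-]]|] // [e]; apply: ua.
  - exact: filterE.
have mw : measurable ([set w] : set (borelRhat R)).
  rewrite -(setCK [set w]); apply: measurableC; apply: open_measurable_Rhat.
  by rewrite (_ : ~` [set w] = [set x | x <> w]).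
apply: (measurability (@RGenOpens.G R)); first exact: RGenOpens.measurableE.
move=> _ [_ [a [b ->]] <-]; rewrite setTI.
set I := `]a, b[%classic.
have oI : open (zeta w @^-1` I `&` [set x | x <> w]).
  rewrite openE => x [Ix xw]; rewrite /interior.
  apply: filterI; last by apply: open_nbhs_nbhs; split.
  by apply: (zeta_continuous xw); apply: open_nbhs_nbhs; split; [exact: interval_open|].
have -> : zeta w @^-1` I = (zeta w @^-1` I `&` [set x | x <> w]) `|` (zeta w @^-1` I `&` [set w]).
  by rewrite -setIUr (_ : _ `|` _ = setT) ?setIT //; apply/seteqP; split => // x _; have [|] := pselect (x = w); [right|left].
apply: measurableU; first exact: open_measurable_Rhat.
have [Iw|nIw] := pselect (I (zeta w w)).
  by rewrite (_ : _ `&` _ = [set w]) //; apply/seteqP; split => [x []|x ->].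
by rewrite (_ : _ `&` _ = set0) //; apply/seteqP; split => // x [Ix xw]; apply: nIw; rewrite -{2}xw.
Qed.

End Support.

(** * Rational functions with prescribed poles *)

Section BoundedFunctions.
Context {R : realType}.
Variable mu : probability (borelRhat R) R.
Local Notation S := (msupport mu).
Implicit Types (f h : Rhat R -> R).

(** The class of functions on which integration against mu is linear without
    further conditions; it contains all rational functions with poles off the
    support. *)
Definition supp_bounded f : Prop :=
  measurable_fun [set: borelRhat R] f /\ exists C, forall x, S x -> `|f x| <= C.

Lemma supp_boundedD f h : supp_bounded f -> supp_bounded h -> supp_bounded (fun x => f x + h x).
Proof.
move=> [mf [C fC]] [mh [D hD]]; split; first exact: measurable_funD.
by exists (C + D) => x Sx; rewrite (le_trans (ler_normD _ _)) // lerD ?fC ?hD.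
Qed.

Lemma supp_boundedM f h : supp_bounded f -> supp_bounded h -> supp_bounded (fun x => f x * h x).
Proof.
move=> [mf [C fC]] [mh [D hD]]; split; first exact: measurable_funM.
by exists (C * D) => x Sx; rewrite normrM ler_pM ?fC ?hD.
Qed.

Lemma supp_bounded_cst (a : R) : supp_bounded (fun=> a).
Proof. by split; [exact: measurable_cst|exists `|a|]. Qed.

Lemma supp_boundedZ (a : R) f : supp_bounded f -> supp_bounded (fun x => a * f x).
Proof. by move=> Bf; apply: supp_boundedM => //; exact: supp_bounded_cst. Qed.

Lemma supp_bounded_sum (I : Type) (r : seq I) (F : I -> Rhat R -> R) :
  (forall i, supp_bounded (F i)) -> supp_bounded (fun x => \sum_(i <- r) F i x).
Proof.
move=> FB; elim: r => [|i r ih].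
  by under eq_fun do rewrite big_nil; exact: supp_bounded_cst.
by under eq_fun do rewrite big_cons; exact: supp_boundedD.
Qed.

Lemma supp_boundedX f n : supp_bounded f -> supp_bounded (fun x => f x ^+ n).
Proof.
move=> Bf; elim: n => [|n ih].
  by under eq_fun do rewrite expr0; exact: supp_bounded_cst.
by under eq_fun do rewrite exprS; exact: supp_boundedM.
Qed.

Lemma supp_bounded_zeta (w : Rhat R) : ~ S w -> supp_bounded (zeta w).
Proof.
move=> Sw; split; first exact: measurable_zeta_Rhat.
have [B _ BP] := bounded_zetainv (@closed_msupport _ mu) Sw.
by exists B => x Sx; apply: BP; rewrite zetaK // => xw; apply: Sw; rewrite -xw.
Qed.

Lemma supp_bounded_integrable f : supp_bounded f -> mu.-integrable [set: borelRhat R] (EFin \o f).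
Proof.
move=> [mf [C fC]]; apply/integrableP; split; first exact/measurable_EFinP.
have mC : measurable (~` S : set (borelRhat R)) by apply: measurableC; exact: measurable_msupport.
rewrite (@ge0_negligible_integral _ _ _ mu _ (~` S)) //; last 2 first.
- by apply: measurableT_comp => //; exact/measurable_EFinP.
- exact: measure_outside_msupport.
rewrite setTD setCK.
apply: (@le_lt_trans _ _ (\int[mu]_(x in S) (`|C|)%:E)%E).
  apply: ge0_le_integral => //.
  - exact: measurable_msupport.
  - by apply: measurable_funTS; apply: measurableT_comp => //; exact/measurable_EFinP.
  - by move=> x Sx; rewrite lee_fin (le_trans (fC x Sx)) // ler_norm.
rewrite integral_cst; last exact: measurable_msupport.
apply: (@le_lt_trans _ _ ((`|C|)%:E * 1)%E); last by rewrite mule1 ltry.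
by apply: lee_wpmul2l => //; apply: probability_le1; exact: measurable_msupport.
Qed.

Lemma innerC f h : inner mu f h = inner mu h f.
Proof. by rewrite /inner; under eq_Rintegral do rewrite mulrC. Qed.

Lemma innerDl f1 f2 h : supp_bounded f1 -> supp_bounded f2 -> supp_bounded h ->
  inner mu (fun x => f1 x + f2 x) h = inner mu f1 h + inner mu f2 h.
Proof.
move=> B1 B2 Bh; rewrite /inner; under eq_Rintegral do rewrite mulrDl.
by apply: RintegralD => //; apply: supp_bounded_integrable; exact: supp_boundedM.
Qed.

Lemma innerZl (a : R) f h : supp_bounded f -> supp_bounded h ->
  inner mu (fun x => a * f x) h = a * inner mu f h.
Proof.
move=> Bf Bh; rewrite /inner; under eq_Rintegral do rewrite -mulrA.
by apply: RintegralZl => //; apply: supp_bounded_integrable; exact: supp_boundedM.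
Qed.

Lemma inner_suml (I : Type) (r : seq I) (F : I -> Rhat R -> R) h :
  (forall i, supp_bounded (F i)) -> supp_bounded h ->
  inner mu (fun x => \sum_(i <- r) F i x) h = \sum_(i <- r) inner mu (F i) h.
Proof.
move=> FB Bh; elim: r => [|i r ih].
  rewrite big_nil /inner; under eq_Rintegral do rewrite big_nil mul0r.
  by rewrite Rintegral_cst // mul0r.
rewrite big_cons -ih -innerDl //; last exact: supp_bounded_sum.
by congr inner; apply/funext => x; rewrite big_cons.
Qed.

Lemma inner_ge0 f : 0 <= inner mu f f.
Proof. by apply: Rintegral_ge0 => x _; rewrite -expr2 sqr_ge0. Qed.

Lemma inner_le_bound f (C : R) : supp_bounded f -> (forall x, S x -> `|f x| <= C) ->
  inner mu f f <= C ^+ 2.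
Proof.
move=> Bf fC.
have mC : measurable (~` S : set (borelRhat R)) by apply: measurableC; exact: measurable_msupport.
have Iff := supp_bounded_integrable (supp_boundedM Bf Bf).
have [mf _] := Bf.
rewrite /inner -lee_fin /Rintegral fineK; last exact: integrable_fin_num.
rewrite (@ge0_negligible_integral _ _ _ mu _ (~` S)) //; first last.
- exact: measure_outside_msupport.
- by move=> x _; rewrite lee_fin -expr2 sqr_ge0.
- by apply/measurable_EFinP; exact: measurable_funM.
rewrite setTD setCK.
apply: (@le_trans _ _ (\int[mu]_(x in S) (C ^+ 2)%:E)%E).
  apply: ge0_le_integral => //.
  - exact: measurable_msupport.
  - by move=> x _; rewrite lee_fin -expr2 sqr_ge0.
  - by apply: measurable_funTS; apply/measurable_EFinP; exact: measurable_funM.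
  - move=> x Sx; rewrite lee_fin -expr2 -real_normK ?num_real //.
    by rewrite lerXn2r ?nnegrE ?fC // (le_trans _ (fC x Sx)).
rewrite integral_cst; last exact: measurable_msupport.
rewrite -[leRHS]mule1; apply: lee_wpmul2l; first by rewrite lee_fin sqr_ge0.
by apply: probability_le1; exact: measurable_msupport.
Qed.

End BoundedFunctions.

(** The coefficients are the residues: the coefficient of zeta_w is the value at w
    of the other factor. *)
Lemma zeta_partial_fractions {R : realType} (w w' : Rhat R) : w <> w' ->
  exists d : R, forall x, x <> w -> x <> w' ->
    zeta w x * zeta w' x = zeta w' w * zeta w x + zeta w w' * zeta w' x + d.
Proof.
have h (a b : R) : Some a <> Some b -> a - b != 0.
  by move=> ab; apply/eqP => e; apply: ab; congr Some; lra.
case: w w' => [a|] [b|] //= ww.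
- have ba : b - a != 0 by apply: h => e; apply: ww.
  have ab := h _ _ ww.
  exists 0 => -[s|] /= xa xb; last by ring.
  have as0 : a - s != 0 by apply: h => e; apply: xa.
  have bs0 : b - s != 0 by apply: h => e; apply: xb.
  by field; rewrite ba ab as0 bs0.
- exists (-1) => -[s|] //= xa _.
  have as0 : a - s != 0 by apply: h => e; apply: xa.
  by field.
- exists (-1) => -[s|] //= _ xb.
  have bs0 : b - s != 0 by apply: h => e; apply: xb.
  by field.
Qed.

Section RationalFunctions.
Context {R : realType}.
Variables (g : nat) (c : 'I_g.+1 -> Rhat R).

Definition pole (m : nat) : 'I_g.+1 := inord (m %% g.+1).

Lemma rfunS m : rfun c m.+1 = fun x => zeta (c (pole m)) x ^+ (m %/ g.+1).+1.
Proof.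
apply/funext => x; rewrite /rfun /zeta /pole.
by case: (c _) => [a|]; case: x => [s|] //; rewrite ?expr0n // exprVn.
Qed.

Lemma rspan_rfun n i : (i < n)%N -> rspan c n (rfun c i).
Proof.
move=> ni; exists (fun j => (j == i)%:R); apply/funext => x.
rewrite big_mkord (bigD1 (Ordinal ni)) //= eqxx mul1r big1 ?addr0 // => j ji.
by rewrite (_ : (j == i :> nat) = false) ?mul0r //; apply/negbTE; apply: contraNneq ji => e; apply/eqP/val_inj.
Qed.

Lemma rspanZD n (a : R) f h : rspan c n f -> rspan c n h -> rspan c n (fun x => a * f x + h x).
Proof.
move=> [u ->] [v ->]; exists (fun i => a * u i + v i); apply/funext => x.
by rewrite mulr_sumr -big_split /=; apply: eq_bigr => i _; rewrite mulrDl mulrA.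
Qed.

Lemma rspan0 n : rspan c n (fun=> 0).
Proof. by exists (fun=> 0); apply/funext => x; rewrite big1 // => i _; rewrite mul0r. Qed.

Lemma rspanZ n (a : R) f : rspan c n f -> rspan c n (fun x => a * f x).
Proof.
move=> hf; have := rspanZD a hf (rspan0 n).
by congr rspan; apply/funext => x; rewrite addr0.
Qed.

Lemma rspanD n f h : rspan c n f -> rspan c n h -> rspan c n (fun x => f x + h x).
Proof.
move=> hf hh; have := rspanZD 1 hf hh.
by congr rspan; apply/funext => x; rewrite mul1r.
Qed.

Lemma rspan_sum n (I : Type) (r : seq I) (F : I -> Rhat R -> R) :
  (forall i, rspan c n (F i)) -> rspan c n (fun x => \sum_(i <- r) F i x).
Proof.
move=> FB; elim: r => [|i r ih].
  by under eq_fun do rewrite big_nil; exact: rspan0.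
by under eq_fun do rewrite big_cons; exact: rspanD.
Qed.

Lemma rspan_widen n n' f : (n <= n')%N -> rspan c n f -> rspan c n' f.
Proof.
move=> nn [a ->].
have H : forall r : seq nat, (forall i, i \in r -> (i < n)%N) -> rspan c n' (fun x => \sum_(i <- r) a i * rfun c i x).
  elim=> [|i r ih] h; first by under eq_fun do rewrite big_nil; exact: rspan0.
  under eq_fun do rewrite big_cons.
  apply: rspanD; last by apply: ih => j jr; apply: h; rewrite inE jr orbT.
  by apply: rspanZ; apply: rspan_rfun; apply: leq_trans nn; apply: h; rewrite inE eqxx.
by apply: H => i; rewrite mem_index_iota.
Qed.

Hypothesis c_inj : injective c.

(** At the pole of r_n all preceding functions grow more slowly than r_n. *)
Lemma rfun_notin_rspan n : ~ rspan c n (rfun c n).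
Proof.
case: n => [|m].
  by move=> [a] /(congr1 (fun f => f None)); rewrite big_geq //= => /eqP; rewrite oner_eq0.
set k := pole m; set j := (m %/ g.+1)%N.
move=> [a aE].
have near_pole_bound i : (i < m.+1)%N -> exists M : R, exists s0 : R, forall s : R, 1 <= s -> s0 <= s ->
    `|rfun c i (zetainv (c k) s)| <= M * s ^+ j.
  case: i => [|i] im.
    by exists 1, 1 => s s1 _; rewrite /= normr1 mul1r exprn_ege1.
  rewrite rfunS; have [ik|ik] := eqVneq (pole i) k.
    exists 1, 1 => s s1 _; rewrite ik zetainvK mul1r ger0_norm ?exprn_ge0 ?(le_trans _ s1) //.
    apply: ler_weXn2l => //.
    have ij : (i %/ g.+1 <= j)%N by apply: leq_div2r; lia.
    rewrite ltn_neqAle ij andbT; apply/eqP => e.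
    have : (i = m)%N.
      rewrite (divn_eq i g.+1) (divn_eq m g.+1) e; congr addn.
      by have /(congr1 val) := ik; rewrite /= !inordK ?ltn_mod.
    lia.
  have cc : c k <> c (pole i) by move=> /c_inj e; rewrite e eqxx in ik.
  have [d dP] := zeta_partial_fractions cc.
  set al := zeta (c (pole i)) (c k) in dP; set be := zeta (c k) (c (pole i)) in dP.
  exists ((2 * (`|al| + `|d|)) ^+ (i %/ g.+1).+1), (2 * `|be| + 1) => s s1 ss.
  have be0 := normr_ge0 be.
  have xl : zetainv (c k) s <> c (pole i).
    move=> e; have : zeta (c k) (zetainv (c k) s) = be by rewrite e.
    by rewrite zetainvK => sE; have := ler_norm be; lra.
  have := dP _ (@zetainv_neq _ (c k) s) xl.
  rewrite zetainvK; set z := zeta (c (pole i)) _ => E.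
  rewrite normrX; apply: (@le_trans _ _ ((2 * (`|al| + `|d|)) ^+ (i %/ g.+1).+1)); last first.
    by rewrite ler_peMr ?exprn_ege1 ?exprn_ge0 ?mulr_ge0 ?addr_ge0.
  apply: lerXn2r; rewrite ?nnegrE ?mulr_ge0 ?addr_ge0 //.
  have sb : s / 2 <= `|s - be| by have := lerB_dist s be; rewrite ger0_norm; lra.
  have E2 : `|s - be| * `|z| <= s * (`|al| + `|d|).
    rewrite -normrM mulrBl (_ : s * z - be * z = al * s + d); last by rewrite E; ring.
    apply: le_trans (ler_normD _ _) _; rewrite normrM (ger0_norm (_ : 0 <= s)); last lra.
    by rewrite mulrDr [s * _]mulrC lerD2l ler_peMl.
  have : s / 2 * `|z| <= s * (`|al| + `|d|) by apply: le_trans E2; rewrite ler_wpM2r.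
  rewrite -mulrA ler_pM2l; last lra.
  by rewrite ler_pdivrMl.
(* s is taken beyond all thresholds and above the sum of all coefficients *)
have /choice[M MP] : forall i, exists M : R, (i < m.+1)%N -> exists s0 : R, forall s : R, 1 <= s -> s0 <= s ->
    `|rfun c i (zetainv (c k) s)| <= M * s ^+ j.
  move=> i; case: (ltnP i m.+1) => im; last by exists 0.
  by have [M [s0 h]] := near_pole_bound i im; exists M => _; exists s0.
have /choice[s0 s0P] : forall i, exists s0 : R, (i < m.+1)%N -> forall s : R, 1 <= s -> s0 <= s ->
    `|rfun c i (zetainv (c k) s)| <= M i * s ^+ j.
  move=> i; case: (ltnP i m.+1) => im; last by exists 0.
  by have [s1 h] := MP i im; exists s1.
pose K := \sum_(0 <= i < m.+1) `|a i| * M i.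
pose s := 1 + `|K| + \sum_(0 <= i < m.+1) `|s0 i|.
have S0 : 0 <= \sum_(0 <= i < m.+1) `|s0 i| by apply: sumr_ge0.
have s1 : 1 <= s by rewrite /s -addrA lerDl addr_ge0.
have ss i : (i < m.+1)%N -> s0 i <= s.
  move=> im; apply: le_trans (ler_norm _) _.
  rewrite /s big_mkord (bigD1 (Ordinal im)) //=.
  have : 0 <= \sum_(i0 < m.+1 | i0 != Ordinal im) `|s0 i0| by apply: sumr_ge0.
  have := normr_ge0 K; lra.
have sj : 0 < s ^+ j by rewrite exprn_gt0 // (lt_le_trans ltr01).
have E : rfun c m.+1 (zetainv (c k) s) = \sum_(0 <= i < m.+1) a i * rfun c i (zetainv (c k) s).
  by rewrite {1}aE.
rewrite rfunS -/k -/j zetainvK exprS in E.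
have : s * s ^+ j <= K * s ^+ j.
  rewrite E; apply: le_trans (ler_norm _) _; apply: le_trans (ler_norm_sum _ _ _) _.
  rewrite mulr_suml; apply: ler_sum_nat => i /andP[_ im].
  by rewrite normrM -mulrA ler_wpM2l // s0P // ss.
rewrite ler_pM2r //; have := ler_norm K; rewrite /s; lra.
Qed.

End RationalFunctions.

(** * Extremality of the leading coefficients *)

Section GramSchmidt.
Context {R : realType}.
Variables (mu : probability (borelRhat R) R) (g : nat) (c : 'I_g.+1 -> Rhat R).
Hypotheses (c_inj : injective c) (c_supp : forall k, ~ msupport mu (c k)).
Variable kappa : nat -> R.
Hypothesis kappaP : forall n, is_leading_coef mu c n (kappa n).
Local Notation S := (msupport mu).
Local Notation r := (rfun c).
Local Notation tau := (tau mu c).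

Lemma rfun_bounded n : supp_bounded mu (r n).
Proof.
case: n => [|m]; first exact: supp_bounded_cst.
by rewrite rfunS; apply: supp_boundedX; exact: supp_bounded_zeta.
Qed.

Lemma rspan_bounded n f : rspan c n f -> supp_bounded mu f.
Proof.
by move=> [a ->]; apply: supp_bounded_sum => i; apply: supp_boundedZ; exact: rfun_bounded.
Qed.

(** The unnormalized Gram-Schmidt vector. *)
Definition residual n (x : Rhat R) : R :=
  r n x - \sum_(t <- gram_schmidt mu c n) inner mu (r n) t * t x.

Lemma size_gram_schmidt n : size (gram_schmidt mu c n) = n.
Proof. by elim: n => //= n ih; rewrite size_rcons ih. Qed.

Lemma tau_residual n : tau n = normalize mu (residual n).
Proof. by rewrite /tau /= nth_rcons size_gram_schmidt ltnn eqxx. Qed.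

Lemma gram_schmidtE n : gram_schmidt mu c n = [seq tau i | i <- iota 0 n].
Proof.
elim: n => // n ih.
rewrite -[in RHS]addn1 iotaD map_cat /= -ih add0n cats1 tau_residual //.
Qed.

Lemma residualE n : residual n =
  fun x => r n x - \sum_(0 <= i < n) inner mu (r n) (tau i) * tau i x.
Proof. by apply/funext => x; rewrite /residual gram_schmidtE big_map /index_iota subn0. Qed.

Let pnorm n : R := Num.sqrt (inner mu (residual n) (residual n)).

Lemma tauE n : tau n = fun x => (pnorm n)^-1 * residual n x.
Proof. by rewrite tau_residual; apply/funext => x; rewrite /normalize mulrC. Qed.

Lemma tau_rspan n : rspan c n.+1 (tau n).
Proof.
elim/ltn_ind: n => n ih.
rewrite tauE; apply: rspanZ; rewrite residualE.
have h : rspan c n.+1 (fun x => (-1) * (\sum_(0 <= i < n) inner mu (r n) (tau i) * tau i x) + r n x).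
  apply: rspanZD; last exact: rspan_rfun.
  rewrite (_ : (fun x => _) = (fun x => \sum_(i < n) inner mu (r n) (tau i) * tau i x)); last first.
    by apply/funext => x; rewrite big_mkord.
  apply: rspan_sum => i; apply: rspanZ.
  by apply: rspan_widen (ih _ (ltn_ord i)); exact: ltnW (ltn_ord i).
by move: h; congr rspan; apply/funext => x; rewrite mulN1r addrC.
Qed.

Lemma tau_bounded n : supp_bounded mu (tau n).
Proof. exact: rspan_bounded (tau_rspan n). Qed.

Definition projection n (x : Rhat R) : R :=
  \sum_(i < n) inner mu (r n) (tau i) * tau i x.

Lemma projection_rspan n : rspan c n (projection n).
Proof.
apply: rspan_sum => i; apply: rspanZ.
by apply: rspan_widen (tau_rspan i); exact: ltn_ord.
Qed.

Lemma rfun_residual n x : r n x = residual n x + projection n x.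
Proof. by rewrite residualE /projection big_mkord subrK. Qed.

Lemma residual_rspan n : rspan c n.+1 (residual n).
Proof.
have := rspanZD (-1) (rspan_widen (leqnSn n) (projection_rspan n)) (rspan_rfun c (ltnSn n)).
by congr rspan; apply/funext => x; rewrite rfun_residual; ring.
Qed.

Lemma residual_bounded n : supp_bounded mu (residual n).
Proof. exact: rspan_bounded (residual_rspan n). Qed.

(** If the residual had norm 0, normalization would give tau_n = 0, and the
    hypothesis on kappa_n would put r_n in the span of its predecessors. *)
Lemma pnorm_gt0 n : 0 < pnorm n.
Proof.
rewrite sqrtr_gt0 lt_neqAle inner_ge0 andbT; apply/eqP => e.
have [k0 [a aE]] := kappaP n.
apply: (@rfun_notin_rspan _ _ c c_inj n).
exists (fun i => - (kappa n)^-1 * a i); apply/funext => x.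
under eq_bigr do rewrite -mulrA.
rewrite -mulr_sumr -(congr1 (fun f => f x) aE) /= tauE /pnorm -e sqrtr0 invr0 mul0r sub0r.
by field; rewrite gt_eqF.
Qed.

Lemma residual_orthogonal n i : (i < n)%N -> inner mu (residual n) (tau i) = 0.
Proof.
move: i; elim/ltn_ind: n => n ih i ni.
have onrm a b : (a < n)%N -> (b < n)%N -> inner mu (tau a) (tau b) = (a == b)%:R.
  move=> an bn.
  have off u v : (u < n)%N -> (v < u)%N -> inner mu (tau u) (tau v) = 0.
    move=> un vu; rewrite [tau u]tauE innerZl ?ih ?mulr0 //.
      exact: residual_bounded.
    exact: tau_bounded.
  case: (ltngtP a b) => [ab|ba|->].
  - by rewrite innerC off.
  - by rewrite off.
  - have p0 := pnorm_gt0 b; have rb := residual_bounded b.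
    have -> : inner mu (tau b) (tau b) = (pnorm b)^-1 * ((pnorm b)^-1 * inner mu (residual b) (residual b)).
      rewrite [tau b]tauE innerZl //; last exact: supp_boundedZ.
      by congr (_ * _); rewrite innerC innerZl.
    have -> : inner mu (residual b) (residual b) = pnorm b ^+ 2 by rewrite sqr_sqrtr // inner_ge0.
    by rewrite (_ : true%:R = 1 :> R) //; field; rewrite gt_eqF.
have -> : residual n = fun x => r n x + \sum_(j < n) (- inner mu (r n) (tau j)) * tau j x.
  apply/funext => x; rewrite residualE big_mkord -sumrN; congr (_ + _).
  by apply: eq_bigr => j _; rewrite mulNr.
rewrite innerDl; last exact: tau_bounded.
  rewrite inner_suml; last exact: tau_bounded.
    rewrite (bigD1 (Ordinal ni)) //= innerZl; try exact: tau_bounded.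
    rewrite onrm // eqxx mulr1 big1 ?addr0 ?subrr // => j ji.
    rewrite innerZl ?onrm //; try exact: tau_bounded.
    by rewrite (_ : (j == i :> nat) = false) ?mulr0 //; apply/negbTE; apply: contraNneq ji => e; apply/eqP/val_inj.
  by move=> j; apply: supp_boundedZ; exact: tau_bounded.
exact: rfun_bounded.
by apply: supp_bounded_sum => j; apply: supp_boundedZ; exact: tau_bounded.
Qed.

Lemma residual_orthogonal_rspan n h : rspan c n h -> inner mu (residual n) h = 0.
Proof.
move=> [a ->]; rewrite innerC.
rewrite (_ : (fun x => _) = (fun x => \sum_(i < n) a i * r i x)); last first.
  by apply/funext => x; rewrite big_mkord.
have rb := residual_bounded n.
rewrite inner_suml //; last by move=> i; apply: supp_boundedZ; exact: rfun_bounded.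
apply: big1 => i _; rewrite innerZl //; last exact: rfun_bounded.
have -> : r i = fun x => pnorm i * tau i x + projection i x.
  apply/funext => x; rewrite rfun_residual tauE mulrA divff ?mul1r // gt_eqF //; exact: pnorm_gt0.
have tb := tau_bounded.
rewrite innerDl //; [|by apply: supp_boundedZ|exact: rspan_bounded (projection_rspan i)].
rewrite innerZl // [inner mu (tau i) _]innerC residual_orthogonal // mulr0 add0r.
rewrite /projection inner_suml //; last by move=> j; apply: supp_boundedZ.
rewrite big1 ?mulr0 // => j _; rewrite innerZl // [inner mu (tau j) _]innerC residual_orthogonal ?mulr0 //.
exact: ltn_trans (ltn_ord j) (ltn_ord i).
Qed.

(** Otherwise a nonzero multiple of r_n would lie in the span of its predecessors. *)
Lemma kappa_pnorm n : kappa n * pnorm n = 1.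
Proof.
have p0 := pnorm_gt0 n; have [k0 hk] := kappaP n.
apply/eqP; apply: contraT => kp; exfalso.
have e0 : (pnorm n)^-1 - kappa n != 0.
  apply: contraNneq kp => e; rewrite (_ : kappa n = (pnorm n)^-1); last lra.
  by rewrite mulVf // gt_eqF.
apply: (@rfun_notin_rspan _ _ c c_inj n).
have h1 := rspanZD (pnorm n)^-1 (projection_rspan n) hk.
have := rspanZ ((pnorm n)^-1 - kappa n)^-1 h1.
congr rspan; apply/funext => x; rewrite tauE.
have -> : residual n x = r n x - projection n x by rewrite rfun_residual addrK.
have -> : (pnorm n)^-1 * projection n x + ((pnorm n)^-1 * (r n x - projection n x) - kappa n * r n x) =
    ((pnorm n)^-1 - kappa n) * r n x by ring.
by rewrite mulrA mulVf // mul1r.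
Qed.

(** By Pythagoras ||a r_n + h|| >= |a| / kappa_n for h in the span of the
    predecessors. *)
Lemma leading_coef_extremal n (a C : R) h : 0 <= C -> rspan c n h ->
  (forall x, S x -> `|a * r n x + h x| <= C) -> `|a| <= kappa n * C.
Proof.
move=> C0 hh hC.
have p0 := pnorm_gt0 n; have kp := kappa_pnorm n.
have k0 := (kappaP n).1.
pose h' x := a * projection n x + h x.
have h'h : rspan c n h' by apply: rspanZD => //; exact: projection_rspan.
have fE : (fun x => a * r n x + h x) = fun x => a * residual n x + h' x.
  by apply/funext => x; rewrite rfun_residual /h'; ring.
have rb := residual_bounded n; have h'b := rspan_bounded h'h.
have arb := supp_boundedZ a rb.
have fb : supp_bounded mu (fun x => a * r n x + h x).
  by rewrite fE; exact: supp_boundedD.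
have fI : inner mu (fun x => a * r n x + h x) (fun x => a * r n x + h x) =
    a ^+ 2 * pnorm n ^+ 2 + inner mu h' h'.
  have -> : pnorm n ^+ 2 = inner mu (residual n) (residual n) by rewrite sqr_sqrtr // inner_ge0.
  have o := residual_orthogonal_rspan h'h.
  have e1 : inner mu (residual n) (fun x => a * residual n x + h' x) = a * inner mu (residual n) (residual n).
    by rewrite innerC innerDl // innerZl // [inner mu h' _]innerC o addr0.
  have e2 : inner mu h' (fun x => a * residual n x + h' x) = inner mu h' h'.
    by rewrite innerC innerDl // innerZl // o mulr0 add0r.
  have fb' : supp_bounded mu (fun x => a * residual n x + h' x) by exact: supp_boundedD.
  by rewrite fE innerDl // innerZl // e1 e2 mulrA.
have := inner_le_bound fb hC; rewrite fI.
have := inner_ge0 mu h' => i0 hle.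
have : (`|a| * pnorm n) ^+ 2 <= C ^+ 2.
  by rewrite exprMn real_normK ?num_real //; lra.
rewrite ler_sqr ?nnegrE //; last by rewrite mulr_ge0 // ltW.
move=> h2.
by rewrite -[`|a|]mul1r -kp -mulrA ler_pM2l // mulrC.
Qed.

End GramSchmidt.

(** * Products of polynomials in several coordinates *)

Section PoleExpansions.
Context {R : realType}.
Variables (g : nat) (c : 'I_g.+1 -> Rhat R).
Hypothesis c_inj : injective c.
Implicit Types (k l : 'I_g.+1) (d : 'I_g.+1 -> nat) (f h : Rhat R -> R).

Definition off_poles (x : Rhat R) : Prop := forall l, x <> c l.

(** Away from the poles, f is a sum of polynomials u_l in the coordinates, with
    degrees at most d l; the number a is the coefficient of zeta_k^(d k), which
    becomes the leading coefficient of a trial function. *)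
Definition pole_expansion k d (a : R) f : Prop :=
  exists u : 'I_g.+1 -> {poly R}, [/\ forall l, (size (u l) <= (d l).+1)%N,
    (u k)`_(d k) = a & forall x, off_poles x -> f x = \sum_l (u l).[zeta (c l) x]].

Lemma pole_expansion_base k (P : {poly R}) N : (size P <= N.+1)%N ->
  pole_expansion k (fun l => if l == k then N else 0) P`_N (fun x => P.[zeta (c k) x]).
Proof.
move=> sP; exists (fun l => if l == k then P else 0); split.
- by move=> l; case: eqP => // _; rewrite size_poly0.
- by rewrite eqxx.
- move=> x _; rewrite (bigD1 k) //= eqxx big1 ?addr0 // => l /negbTE ->.
  by rewrite horner0.
Qed.

Lemma pole_expansion_widen k d d' a f : (forall l, (d l <= d' l)%N) -> d k = d' k ->
  pole_expansion k d a f -> pole_expansion k d' a f.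
Proof.
move=> dd dk [u [su uk uE]]; exists u; split => // [l|]; last by rewrite -dk.
by rewrite (leq_trans (su l)) // ltnS.
Qed.

Lemma pole_expansion_linear k d (b a a' : R) f f' : pole_expansion k d a f -> pole_expansion k d a' f' ->
  pole_expansion k d (b * a + a') (fun x => b * f x + f' x).
Proof.
move=> [u [su uk uE]] [v [sv vk vE]]; exists (fun l => b *: u l + v l); split.
- move=> l; rewrite (leq_trans (size_polyD _ _)) // geq_max sv andbT.
  by rewrite (leq_trans (size_scale_leq _ _)).
- by rewrite coefD coefZ uk vk.
- move=> x xo; rewrite uE // vE // mulr_sumr -big_split /=.
  by apply: eq_bigr => l _; rewrite hornerD hornerZ.
Qed.

Lemma poly_split (P : {poly R}) : exists q (c0 : R), P = q * 'X + c0%:P.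
Proof.
elim/poly_ind: P => [|q c0 _]; last by exists q, c0.
by exists 0, 0; rewrite mul0r add0r.
Qed.

(** The new top coefficient is the old one times the value of zeta_w at the pole
    w'.  The case N = 0 records the exact outcome, on which the step to N = 1
    depends. *)
Lemma zeta_mul_poly (w w' : Rhat R) N (p : {poly R}) : w <> w' -> (size p <= N.+1)%N ->
  exists b, exists p' : {poly R}, [/\ (size p' <= N.+1)%N,
    if N == 0 then b = p`_0 /\ p' = 0 else p'`_N = zeta w w' * p`_N &
    forall x, x <> w -> x <> w' ->
      zeta w x * p.[zeta w' x] = b * zeta w x + p'.[zeta w' x]].
Proof.
move=> ww; have [d dP] := zeta_partial_fractions ww.
elim: N p => [|N ih] p sp.
  exists p`_0, 0; split => //; first by rewrite size_poly0.
  by move=> x _ _; rewrite [p]size1_polyC // hornerC horner0 coefC eqxx addr0 mulrC.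
have [q [c0 pE]] := poly_split p.
have sq : (size q <= N.+1)%N.
  by move: sp; rewrite pE size_MXaddC; case: ifP => // /andP[/eqP -> _]; rewrite size_poly0.
have [b [q' [sq' lq' qE]]] := ih _ sq.
exists (c0 + b * zeta w' w), (q' * 'X + b *: (zeta w w' *: 'X + d%:P)); split.
- rewrite (leq_trans (size_polyD _ _)) // geq_max; apply/andP; split.
    have [->|q0] := eqVneq q' 0; first by rewrite mul0r size_poly0.
    by rewrite size_mulX.
  rewrite (leq_trans (size_scale_leq _ _)) // (leq_trans (size_polyD _ _)) // geq_max.
  by rewrite (leq_trans (size_scale_leq _ _)) ?size_polyX // (leq_trans (size_polyC_leq1 _)).
- rewrite pE /= !coefD coefZ coefD coefZ !coefMX !coefC coefX /= !addr0.
  case: (N) lq' => [[-> ->]|n ->] /=; last by rewrite !mulr0 addr0.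
  by rewrite coef0 mulr1 add0r mulrC.
- move=> x xw xw'; rewrite pE !(hornerD, hornerM, hornerZ, hornerX, hornerC).
  have := dP x xw xw'; have := qE x xw xw'.
  set z := zeta w x; set z' := zeta w' x => E1 E2.
  rewrite mulrDr mulrA E1 (_ : (b * z + q'.[z']) * z' = b * (z * z') + q'.[z'] * z'); last by ring.
  by rewrite E2; ring.
Qed.

(** Multiplying by another coordinate multiplies the leading coefficient at c_k by
    the value of that coordinate at c_k. *)
Lemma pole_expansion_mul_zeta k d a f l : l != k -> (0 < d k)%N -> pole_expansion k d a f ->
  pole_expansion k (fun i => if i == l then (d i).+1 else d i) (zeta (c l) (c k) * a)
    (fun x => zeta (c l) x * f x).
Proof.
move=> lk dk [u [su uk uE]].
have cc i : i != l -> c l <> c i by move=> il /c_inj e; rewrite e eqxx in il.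
have /choice[bv bvP] : forall i, exists bv : R * {poly R}, i != l ->
    [/\ (size bv.2 <= (d i).+1)%N, i = k -> bv.2`_(d k) = zeta (c l) (c k) * a &
      forall x, off_poles x -> zeta (c l) x * (u i).[zeta (c i) x] = bv.1 * zeta (c l) x + bv.2.[zeta (c i) x]].
  move=> i; have [->|il] := eqVneq i l; first by exists (0, 0).
  have [b [p' [sp lp pE]]] := zeta_mul_poly (cc _ il) (su i).
  exists (b, p') => _; split => //= [ik|x xo]; last by apply: pE; exact: xo.
  by move: lp; rewrite ik gtn_eqF // uk.
pose B := \sum_(i | i != l) (bv i).1.
exists (fun i => if i == l then 'X * u l + B *: 'X else (bv i).2); split.
- move=> i; case: eqVneq => [->|il]; last by case: (bvP i il).
  rewrite (leq_trans (size_polyD _ _)) // geq_max; apply/andP; split.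
    have [->|u0] := eqVneq (u l) 0; first by rewrite mulr0 size_poly0.
    by rewrite mulrC size_mulX // ltnS.
  by rewrite (leq_trans (size_scale_leq _ _)) // size_polyX.
- rewrite [k == l]eq_sym (negbTE lk); have kl : k != l by rewrite eq_sym.
  by have [_ h _] := bvP k kl; exact: h.
- move=> x xo; rewrite uE // (bigD1 l) //= mulrDr mulr_sumr.
  rewrite [RHS](bigD1 l) //= eqxx hornerD hornerM hornerZ hornerX.
  rewrite (eq_bigr (fun i => (bv i).1 * zeta (c l) x + (bv i).2.[zeta (c i) x])); last first.
    by move=> i il; have [_ _ ->] := bvP i il.
  rewrite big_split /= -mulr_suml -/B addrA; congr (_ + _).
  by apply: eq_bigr => i /negbTE ->.
Qed.

Lemma pole_expansion_mul_poly k d a f l N (P : {poly R}) : l != k -> (0 < d k)%N -> (size P <= N.+1)%N ->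
    pole_expansion k d a f ->
  pole_expansion k (fun i => if i == l then (N + d i)%N else d i) (P.[zeta (c l) (c k)] * a)
    (fun x => P.[zeta (c l) x] * f x).
Proof.
move=> lk dk; have kl : (k == l) = false by rewrite eq_sym (negbTE lk).
elim: N P => [|N ih] P sP hf.
  have h0 : pole_expansion k (fun i => if i == l then (0 + d i)%N else d i) a f.
    by apply: pole_expansion_widen hf => [i|]; rewrite add0n if_same.
  have z0 : pole_expansion k (fun i => if i == l then (0 + d i)%N else d i) 0 (fun=> 0).
    exists (fun=> 0); split => // [i||x _]; [by rewrite size_poly0|by rewrite coef0|].
    by rewrite big1 // => i _; rewrite horner0.
  have := pole_expansion_linear P`_0 h0 z0.
  rewrite [P]size1_polyC // hornerC coefC eqxx addr0.
  by congr pole_expansion; apply/funext => x; rewrite hornerC addr0.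
have [q [c0 PE]] := poly_split P.
have sq : (size q <= N.+1)%N.
  by move: sP; rewrite PE size_MXaddC; case: ifP => // /andP[/eqP -> _]; rewrite size_poly0.
have h1 := pole_expansion_mul_zeta lk _ (ih q sq hf).
rewrite kl in h1; have {}h1 := h1 dk.
have h2 : pole_expansion k (fun i => if i == l then (N.+1 + d i)%N else d i) (zeta (c l) (c k) * (q.[zeta (c l) (c k)] * a))
    (fun x => zeta (c l) x * (q.[zeta (c l) x] * f x)).
  by apply: pole_expansion_widen h1 => [i|]; [case: (i == l)|rewrite kl].
have h3 : pole_expansion k (fun i => if i == l then (N.+1 + d i)%N else d i) a f.
  by apply: pole_expansion_widen hf => [i|]; [case: ifP => // _; rewrite leq_addl|rewrite kl].
have := pole_expansion_linear c0 h3 h2.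
rewrite PE !(hornerD, hornerM, hornerX, hornerC).
rewrite (_ : c0 * a + _ = (q.[zeta (c l) (c k)] * zeta (c l) (c k) + c0) * a); last by ring.
congr pole_expansion; apply/funext => x; rewrite !(hornerD, hornerM, hornerX, hornerC); ring.
Qed.

Lemma pole_expansion_prod k (s : seq 'I_g.+1) N M (P0 : {poly R}) (P : 'I_g.+1 -> {poly R}) :
    uniq s -> k \notin s -> (0 < N)%N -> (size P0 <= N.+1)%N -> (forall l, (size (P l) <= M.+1)%N) ->
  pole_expansion k (fun l => if l == k then N else if l \in s then M else 0)
    (\prod_(l <- s) (P l).[zeta (c l) (c k)] * P0`_N)
    (fun x => \prod_(l <- s) (P l).[zeta (c l) x] * P0.[zeta (c k) x]).
Proof.
move=> + + N0 sP0 sP; elim: s => [|l s ih] /= us ks.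
  have := pole_expansion_base k sP0.
  rewrite big_nil mul1r; congr pole_expansion; apply/funext => x.
  by rewrite big_nil mul1r.
have /andP[ls us'] := us; move: ks; rewrite inE negb_or => /andP[kl ks].
have h := @pole_expansion_mul_poly k _ _ _ l M (P l) _ _ (sP l) (ih us' ks).
rewrite eqxx eq_sym in h; have {}h := h kl N0.
rewrite big_cons -mulrA.
have -> : (fun x => \prod_(l0 <- l :: s) (P l0).[zeta (c l0) x] * P0.[zeta (c k) x]) =
   fun x => (P l).[zeta (c l) x] * (\prod_(l0 <- s) (P l0).[zeta (c l0) x] * P0.[zeta (c k) x]).
  by apply/funext => x; rewrite big_cons mulrA.
apply: pole_expansion_widen h.
  move=> i; case: eqVneq => [->|il]; last by rewrite inE (negbTE il).
  by rewrite eq_sym (negbTE kl) inE eqxx (negbTE ls) addn0.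
by rewrite (negbTE kl) eqxx.
Qed.

Lemma rfun_zeta l i : rfun c (i * g.+1 + l).+1 = fun x => zeta (c l) x ^+ i.+1.
Proof.
by rewrite rfunS /pole modnMDl modn_small // divnMDl // divn_small // addn0 inord_val.
Qed.

Lemma rspan_zeta_pow l i n : (if i is i'.+1 then (i' * g.+1 + l).+1 < n else 0 < n)%N ->
  rspan c n (fun x => zeta (c l) x ^+ i).
Proof.
case: i => [|i] n0; first by under eq_fun do rewrite expr0; exact: (rspan_rfun c n0).
by rewrite -rfun_zeta; exact: rspan_rfun.
Qed.

(** The function r_n is the power zeta_k^(j+1) of maximal degree, and all other
    powers that occur have smaller index. *)
Lemma pole_expansion_rspan k d a f j : pole_expansion k d a f -> d k = j.+1 ->
    (forall l, l != k -> (d l <= j)%N) ->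
  exists2 h, rspan c (j * g.+1 + k).+1 h &
    forall x, off_poles x -> f x = a * rfun c (j * g.+1 + k).+1 x + h x.
Proof.
move=> [u [su uk uE]] dk dl.
exists (fun x => \sum_l \sum_(i < (if l == k then j.+1 else (d l).+1)) (u l)`_i * zeta (c l) x ^+ i).
  apply: rspan_sum => l; apply: rspan_sum => i; apply: rspanZ; apply: rspan_zeta_pow.
  case: i => -[|i] //= il.
  case: eqVneq il => [->|lk] il; first by rewrite ltnS ltn_add2r ltn_mul2r /=; lia.
  have ij : (i.+1 <= j)%N by apply: leq_trans (dl _ lk).
  have : (i.+1 * g.+1 <= j * g.+1)%N by rewrite leq_mul2r ij orbT.
  have := ltn_ord l; rewrite mulSn; lia.
move=> x xo; rewrite uE // rfun_zeta (bigD1 k) //= [in RHS](bigD1 k) //= eqxx addrA.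
congr (_ + _).
  rewrite (horner_coef_wide _ (su k)) dk big_ord_recr /= addrC; congr (_ + _).
  by rewrite -dk uk.
by apply: eq_bigr => l /negbTE ->; rewrite (horner_coef_wide _ (su l)).
Qed.

End PoleExpansions.

(** * Trial functions *)

Section TrialPolynomials.
Context {R : realType}.
Variables (S : set (Rhat R)) (g : nat) (c : 'I_g.+1 -> Rhat R).
Hypotheses (Scl : closed S) (c_inj : injective c) (c_supp : forall k, ~ S (c k)).
Hypothesis Ene : limit_point S !=set0.
Variables (cc : 'I_g.+1 -> nat -> R) (ts : 'I_g.+1 -> nat -> seq R).
Hypothesis data : forall l m, fekete_data (c l) S m (cc l m) (ts l m).
Variable k : 'I_g.+1.

Let value l m : R := if l == k then robin_approx (cc k) (ts k) m
  else pot (c l) (cc l) (ts l) m (to_sphere (c k)).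

Lemma off_ess_pole l : l != k -> off_ess (c l) S (to_sphere (c k)).
Proof.
move=> lk; split; first by move=> /to_sphere_inj/c_inj e; rewrite e eqxx in lk.
by move=> [x Ex /to_sphere_inj xk]; apply: (c_supp (k := k)); rewrite -xk; exact: limit_point_sub.
Qed.

(** For polar E the other poles contribute at least -1 each, which is compensated by
    an arbitrarily large Robin approximation at c_k. *)
Lemma approximate_lambda (La : R) : ((expR La)%:E < lambda (limit_point S) c k)%E ->
  exists v : 'I_g.+1 -> R, La <= \sum_l v l /\
    forall l, exists m, v l <= value l m /\
      (l != k -> 0 < abs_poly (c l) (cc l m) (ts l m) (to_sphere (c k))).
Proof.
rewrite /lambda; case: asboolP => [pol _|npol].
  exists (fun l => if l == k then La + g.+1%:R else -1); split.
    rewrite (bigD1 k) //= eqxx.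
    rewrite (eq_bigr (fun=> -1)); last by move=> l /negbTE ->.
    rewrite sumr_const mulNrn -addrA lerDl subr_ge0 ler_nat.
    by rewrite (leq_trans (max_card _)) // card_ord.
  move=> l; rewrite /value; case: eqVneq => [->|lk].
    apply: contrapT => h; apply: (bounded_robin_nonpolar Scl (@c_supp k) (data k) (Gam := La + g.+1%:R) _ pol).
    move=> m; rewrite leNgt; apply/negP => hm; apply: h; exists m; split; [exact: ltW|by []].
  have [m0 m0P] := pot_lower Scl (@c_supp l) (data l) (off_ess_pole lk) ltr01.
  by exists m0; have [] := m0P m0 (leqnn _).
rewrite lte_fin ltr_expR => h.
set G := _ + _ in h.
pose e := (G - La) / g.+1%:R.
have g0 : 0 < g.+1%:R :> R by rewrite ltr0n.
have e0 : 0 < e by rewrite divr_gt0 // subr_gt0.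
pose v0 l := if l == k then robin_const (limit_point S) (to_sphere (c k))
  else green (limit_point S) (to_sphere (c k)) (to_sphere (c l)).
exists (fun l => v0 l - e); split.
  rewrite sumrB sumr_const card_ord -mulr_natr divfK ?gt_eqF // (bigD1 k) //= /v0 eqxx.
  rewrite (eq_bigr (fun l => green (limit_point S) (to_sphere (c k)) (to_sphere (c l)))); last first.
    by move=> l /negbTE ->.
  by rewrite -/G; lra.
move=> l; have [Gam GamP] := nonpolar_robin_bounded Scl (@c_supp l) (data l) npol.
rewrite /value /v0; case: eqVneq => [lk|lk].
  rewrite lk in GamP *.
  (* the Robin constant is approximated independently of the point; any point
     off the real circle will do *)
  have offi : off_ess (c k) S (Some (0, 1) : Chat R).
    have im x : to_sphere x <> (Some (0, 1) : Chat R).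
      by case: x => [s|] // [_ /eqP]; rewrite eq_sym oner_eq0.
    by split=> [/esym/im//|[x _ /im]].
  have [[m hm] _] := fekete_approximates_green Scl (@c_supp k) (data k) Ene e0 GamP offi.
  by exists m.
have [_ [m [hm m0]]] := fekete_approximates_green Scl (@c_supp l) (data l) Ene e0 GamP (off_ess_pole lk).
by exists m.
Qed.

(** Fekete polynomials of possibly different degrees, raised to powers so that all
    degrees become equal to N. *)
Lemma exists_trial_polynomials (La : R) : ((expR La)%:E < lambda (limit_point S) c k)%E ->
  exists N : nat, exists Q : 'I_g.+1 -> {poly R}, exists A : 'I_g.+1 -> R,
  [/\ (0 < N)%N,
      forall l, (size (Q l) <= N.+1)%N /\ finite_set [set x | S x /\ 1 < `|(Q l).[zeta (c l) x]|],
      forall l, `|if l == k then (Q l)`_N else (Q l).[zeta (c l) (c k)]| = A l,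
      forall l, 0 < A l & N%:R * La <= \sum_l ln (A l)].
Proof.
move=> /approximate_lambda[v [vLa vP]].
have {vP}/choice[m mP] := vP.
pose n l := size (ts l (m l)).
have n0 l : (0 < n l)%N by rewrite /n; have [_ -> _ _ _] := data l (m l); rewrite fact_gt0.
pose N := (\prod_l n l)%N.
have N0 : (0 < N)%N by rewrite /N prodn_gt0.
have nN l : (N %/ n l * n l)%N = N by rewrite divnK // /N (bigD1 l) //= dvdn_mulr.
pose Q0 l : {poly R} := cc l (m l) *: \prod_(t <- ts l (m l)) ('X - t%:P).
pose e l := (N %/ n l)%N.
have c0 l : 0 < cc l (m l) by have [] := data l (m l).
have sQ0 l : size (Q0 l) = (n l).+1 by rewrite size_scale ?gt_eqF // size_prod_XsubC.
have lQ0 l : lead_coef (Q0 l) = cc l (m l) by rewrite lead_coefZ lead_coef_prod_XsubC mulr1.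
have Q0E l x : `|(Q0 l).[zeta (c l) x]| = cc l (m l) * \prod_(t <- ts l (m l)) `|zeta (c l) x - t|.
  rewrite hornerZ normrM gtr0_norm // horner_prod normr_prod; congr (_ * _).
  by apply: eq_bigr => t _; rewrite !hornerE.
have sQ l : size (Q0 l ^+ e l) = N.+1.
  have := size_exp (Q0 l) (e l); rewrite sQ0 /= mulnC nN => <-.
  by rewrite prednK // lt0n size_poly_eq0 expf_neq0 // -size_poly_eq0 sQ0.
pose A l := (if l == k then cc l (m l) else abs_poly (c l) (cc l (m l)) (ts l (m l)) (to_sphere (c k))) ^+ e l.
have A0 l : 0 < (if l == k then cc l (m l) else abs_poly (c l) (cc l (m l)) (ts l (m l)) (to_sphere (c k))).
  by case: eqVneq => // lk; have [_ ->] := mP l.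
exists N, (fun l => Q0 l ^+ e l), A; split => //.
- move=> l; rewrite sQ leqnn; split => //.
  have := finite_far Scl (@c_supp l) (m l).
  move=> /(finite_image (zetainv (c l))); apply: sub_finite_set => x [Sx hx].
  have xl : x <> c l by move=> xc; apply: (@c_supp l); rewrite -xc.
  exists (zeta (c l) x); last by rewrite zetaK.
  split; first by rewrite /= zetaK.
  move=> near; have [_ _ _ Fle _] := data l (m l).
  move: hx; rewrite horner_exp normrX ltNge => /negP; apply.
  by apply: exprn_ile1 => //; rewrite Q0E; exact: Fle.
- move=> l; rewrite /A; case: eqVneq => [->|lk].
    have -> : (Q0 k ^+ e k)`_N = lead_coef (Q0 k ^+ e k) by rewrite lead_coefE sQ.
    by rewrite lead_coef_exp lQ0 normrX gtr0_norm.
  by rewrite horner_exp normrX Q0E abs_poly_real.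
- by move=> l; rewrite exprn_gt0.
- apply: (@le_trans _ _ (N%:R * \sum_l v l)); first by rewrite ler_wpM2l.
  rewrite mulr_sumr; apply: ler_sum => l _; rewrite /A lnXn //.
  have [vl _] := mP l.
  apply: (@le_trans _ _ (N%:R * value l (m l))); first by rewrite ler_wpM2l.
  have -> : N%:R = (e l)%:R * (n l)%:R :> R by rewrite -natrM /e nN.
  rewrite -[leRHS]mulr_natl -mulrA ler_wpM2l //.
  have nl : (n l)%:R != 0 :> R by rewrite pnatr_eq0 -lt0n.
  rewrite /value; case: eqVneq => [lk|lk].
    by move: nl; rewrite lk /robin_approx -/(n k) => nl; rewrite mulrC divfK.
  by rewrite /pot -/(n l) mulrC divfK.
Qed.

End TrialPolynomials.

Lemma exponent_division (N D j : nat) : (0 < N)%N -> (0 < D)%N -> (D <= j)%N ->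
  exists q, exists r, [/\ (q * N + r + D = j.+1)%N, (r < N)%N, (q * N <= j)%N & (j - q * N <= D + N)%N].
Proof.
move=> N0 D0 Dj; exists ((j.+1 - D) %/ N)%N, ((j.+1 - D) %% N)%N.
have rN : ((j.+1 - D) %% N < N)%N by rewrite ltn_mod.
have jE : ((j.+1 - D) %/ N * N + (j.+1 - D) %% N + D = j.+1)%N by rewrite -divn_eq subnK // leqW.
move: rN jE; move: ((j.+1 - D) %% N)%N ((j.+1 - D) %/ N * N)%N => r qN rN jE.
split => //; lia.
Qed.

Section LowerBound.
Context {R : realType}.
Variables (mu : probability (borelRhat R) R) (g : nat) (c : 'I_g.+1 -> Rhat R).
Hypotheses (E_neq0 : ess_support mu !=set0) (c_inj : injective c).
Hypothesis c_supp : forall k, ~ msupport mu (c k).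
Variable kappa : nat -> R.
Hypothesis kappaP : forall n, is_leading_coef mu c n (kappa n).
Variable k : 'I_g.+1.
Local Notation S := (msupport mu).

(** The factor X makes the degree positive, so that the remaining factors of a trial
    function have degree at most j. *)
Lemma killing_polynomial (w : Rhat R) (F : set (Rhat R)) (B : R) : finite_set F -> 0 <= B ->
  exists D : nat, exists P : {poly R}, exists C : R, [/\ (0 < D)%N, P \is monic, size P = D.+1,
    forall x, F x -> P.[zeta w x] = 0 & 0 <= C /\ forall y, `|y| <= B -> `|P.[y]| <= C].
Proof.
move=> /(finite_image (zeta w)) /finite_seqP[zs zsE] B0.
pose P0 : {poly R} := \prod_(t <- zs) ('X - t%:P).
have m0 : P0 \is monic by exact: monic_prod_XsubC.
exists (size zs).+1, (P0 * 'X), (\prod_(t <- zs) (B + `|t|) * B); split => //.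
- by rewrite rpredM // monicX.
- by rewrite size_mulX ?monic_neq0 // size_prod_XsubC.
- move=> x Fx; have : zeta w x \in zs.
    have : (zeta w @` F) (zeta w x) by exists x.
    by rewrite zsE.
  move=> xz; rewrite hornerM horner_prod (big_rem _ xz) /= !hornerE subrr.
  by rewrite !mul0r.
- split; first by rewrite mulr_ge0 // prodr_ge0 // => t _; rewrite addr_ge0.
  move=> y yB; rewrite hornerM hornerX normrM ler_pM // horner_prod normr_prod.
  apply: ler_prod => t _; rewrite normr_ge0 !hornerE (le_trans (ler_normB _ _)) // lerD2r //.
Qed.

(** The trial function is prod_l Q_l(zeta_l)^q times zeta_k^r times the polynomial
    vanishing at the exceptional points, with q and r chosen so that its degree
    in zeta_k is j + 1. *)
Lemma kappa_lower (La : R) : ((expR La)%:E < lambda (ess_support mu) c k)%E ->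
  exists C : R, exists j0, forall j, (j0 <= j)%N -> j%:R * La - C <= ln (kappa (j * g.+1 + k).+1).
Proof.
have Scl := @closed_msupport _ mu.
rewrite ess_support_limit_point => laE.
have Ene : limit_point S !=set0 by rewrite -ess_support_limit_point.
have /choice[cc0 cc0P] : forall lm : 'I_g.+1 * nat, exists cts : R * seq R,
    fekete_data (c lm.1) S lm.2 cts.1 cts.2.
  by move=> [l m]; have [c0 [t0 h]] := exists_fekete_data Scl (@c_supp l) m Ene; exists (c0, t0).
have data l m := cc0P (l, m).
have [N [Q [A [N0 QP QA A0 sumA]]]] := exists_trial_polynomials Scl c_inj c_supp Ene data laE.
have [B B0 BP] := bounded_zetainv Scl (@c_supp k).
have {}BP x : S x -> `|zeta (c k) x| <= B.
  by move=> Sx; apply: BP; rewrite zetaK // => xk; apply: (@c_supp k); rewrite -xk.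
pose F : set (Rhat R) := \bigcup_(l in [set: 'I_g.+1]) [set x | S x /\ 1 < `|(Q l).[zeta (c l) x]|].
have finF : finite_set F.
  by apply: bigcup_finite => // l _; have [_] := QP l.
have [D [PZ [C2 [D0 PZm sPZ PZ0 [C20 PZC]]]]] := killing_polynomial (c k) finF (ltW B0).
pose C1 := (1 + B) ^+ N * C2 + 1.
have C1p : 0 < C1 by rewrite /C1 ltr_wpDl // mulr_ge0 // exprn_ge0 // addr_ge0 // ltW.
have sQk : size (Q k) = N.+1.
  apply/eqP; rewrite eqn_leq (QP k).1 /= ltnNge; apply/negP => h.
  by have := A0 k; rewrite -QA eqxx nth_default // normr0 ltxx.
have Qk0 : Q k != 0 by rewrite -size_poly_eq0 sQk.
exists ((D + N)%:R * `|La| + ln C1), D => j Dj.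
(* D is the degree of the killing polynomial *)
have [q [r [jE rN qj jq]]] := exponent_division N0 D0 Dj.
pose P0 := Q k ^+ q * ('X^r * PZ).
have XZm : 'X^r * PZ \is monic by rewrite rpredM // monicXn.
have sXZ : size ('X^r * PZ) = (r + D).+1.
  by rewrite size_Mmonic ?monic_neq0 ?monicXn // size_polyXn sPZ addSn addnS.
have sQq : size (Q k ^+ q) = (q * N).+1.
  have := size_exp (Q k) q; rewrite sQk /= mulnC => <-.
  by rewrite prednK // lt0n size_poly_eq0 expf_neq0.
have sP0 : size P0 = j.+2.
  by rewrite size_Mmonic ?expf_neq0 // sXZ sQq addSn addnS addnA jE.
have lP0 : P0`_(j.+1) = (Q k)`_N ^+ q.
  rewrite (_ : P0`_(j.+1) = lead_coef P0); last by rewrite lead_coefE sP0.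
  by rewrite lead_coef_Mmonic // lead_coef_exp lead_coefE sQk.
pose s := [seq l <- enum 'I_g.+1 | l != k].
have us : uniq s by rewrite filter_uniq // enum_uniq.
have ks : k \notin s by rewrite mem_filter eqxx.
have sP l : (size (Q l ^+ q) <= (q * N).+1)%N.
  apply: leq_trans (size_poly_exp_leq _ _) _; rewrite ltnS mulnC leq_mul2l.
  by apply/orP; right; have := (QP l).1; case: (size (Q l)).
have sP0' : (size P0 <= j.+2)%N by rewrite sP0.
have exq := pole_expansion_prod c_inj us ks (ltn0Sn j) sP0' sP.
have [||h hh fE] := pole_expansion_rspan exq (j := j).
- by rewrite eqxx.
- by move=> l /negbTE ->; case: ifP.
have prodA (G : 'I_g.+1 -> R) : \prod_l G l = G k * \prod_(l <- s) G l.
  by rewrite (bigD1 k) //= /s big_filter big_enum_cond.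
set a := \prod_(l <- s) _ * _ in fE.
have aA : `|a| = (\prod_l A l) ^+ q.
  rewrite /a lP0 normrM normr_prod normrX.
  have := QA k; rewrite eqxx => ->.
  rewrite prodA exprMn mulrC; congr (_ * _).
  rewrite -prodrXl big_seq [RHS]big_seq; apply: eq_bigr => l.
  rewrite mem_filter => /andP[lk _]; rewrite horner_exp normrX.
  by have := QA l; rewrite (negbTE lk) => ->.
have bound x : S x -> `|a * rfun c (j * g.+1 + k).+1 x + h x| <= C1.
  move=> Sx; have xo : off_poles c x by move=> l xl; apply: (@c_supp l); rewrite -xl.
  rewrite -fE //.
  have [Fx|nFx] := pselect (F x).
    by rewrite !hornerM (PZ0 _ Fx) !mulr0 normr0 ltW.
  have Q1 l : `|(Q l).[zeta (c l) x]| <= 1.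
    by rewrite leNgt; apply/negP => h1; apply: nFx; exists l.
  rewrite normrM normr_prod.
  apply: (@le_trans _ _ (1 * `|P0.[zeta (c k) x]|)).
    rewrite ler_wpM2r // big_seq; apply: prodr_ile1 => l _.
    by rewrite normr_ge0 horner_exp normrX exprn_ile1.
  rewrite mul1r /P0 !hornerM horner_exp hornerXn !normrM !normrX.
  apply: (@le_trans _ _ (1 * ((1 + B) ^+ N * C2))); last by rewrite mul1r /C1 lerDl.
  apply: ler_pM; [by rewrite exprn_ge0|by rewrite mulr_ge0 ?exprn_ge0|by rewrite exprn_ile1|].
  apply: ler_pM; [by rewrite exprn_ge0|by []| |by apply: PZC; exact: BP].
  apply: (@le_trans _ _ ((1 + B) ^+ r)).
    have B1 : 0 <= 1 + B by rewrite addr_ge0 // ltW.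
    by apply: lerXn2r; rewrite ?nnegrE //; apply: le_trans (BP _ Sx) _; rewrite lerDr.
  by rewrite ler_weXn2l ?lerDl ?(ltW B0) // ltnW.
have := leading_coef_extremal c_inj c_supp kappaP (ltW C1p) hh bound.
have [k0 _] := kappaP (j * g.+1 + k).+1.
have pA : 0 < \prod_l A l by apply: prodr_gt0.
rewrite aA -ler_ln ?posrE ?exprn_gt0 ?mulr_gt0 // lnXn // lnM ?posrE // ln_prod // => hk.
have h1 : (q * N)%:R * La <= (\sum_l ln (A l)) *+ q.
  by rewrite -[leRHS]mulr_natl natrM -mulrA ler_wpM2l.
have h2 : j%:R * La - (D + N)%:R * `|La| <= (q * N)%:R * La.
  have jqR : `|j%:R - (q * N)%:R| <= (D + N)%:R :> R by rewrite -natrB // ger0_norm // ler_nat.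
  rewrite lerBlDr -lerBlDl -mulrBl.
  by apply: le_trans (ler_norm _) _; rewrite normrM ler_wpM2r.
lra.
Qed.

End LowerBound.

(** * Root asymptotics *)

Lemma eventually_le_limn_einf {R : realType} (u : nat -> \bar R) (x : \bar R) (j0 : nat) :
  (forall j, (j0 <= j)%N -> (x <= u j)%E) -> (x <= limn_einf u)%E.
Proof.
move=> h; rewrite limn_einf_lim.
apply: lime_ge; first exact: is_cvg_einfs.
exists j0 => // n /= jn; apply: le_ereal_inf_tmp => _ [p /= np <-].
by apply: h; exact: leq_trans np.
Qed.

Section Conclusion.
Context {R : realType}.
Variables (mu : probability (borelRhat R) R) (g : nat) (c : 'I_g.+1 -> Rhat R).
Hypotheses (E_neq0 : ess_support mu !=set0) (c_inj : injective c).
Hypothesis c_supp : forall k, ~ msupport mu (c k).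
Variable kappa : nat -> R.
Hypothesis kappaP : forall n, is_leading_coef mu c n (kappa n).
Variable k : 'I_g.+1.
Let n j := (j * g.+1 + k.+1)%N.
Let u j : \bar R := (kappa (n j) `^ ((n j)%:R^-1))%:E.

(** Since n(j) = j (g+1) + k + 1, the exponent (j La - C) / n(j) tends to
    La / (g+1). *)
Lemma limn_einf_kappa_lower (La y : R) : ((expR La)%:E < lambda (ess_support mu) c k)%E ->
  y < La / g.+1%:R -> ((expR y)%:E <= limn_einf u)%E.
Proof.
move=> laE yLa.
have [C [j0 h]] := kappa_lower E_neq0 c_inj c_supp kappaP laE.
have g0 : 0 < g.+1%:R :> R by rewrite ltr0n.
pose K := `|C| + `|La|.
have K0 : 0 <= K by rewrite addr_ge0.
pose e := La / g.+1%:R - y.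
have e0 : 0 < e by rewrite subr_gt0.
apply: (@eventually_le_limn_einf _ _ _ (maxn j0 (Num.bound (K / e)))) => j.
rewrite geq_max => /andP[jj0 jK].
rewrite /u; have nE : n j = (j * g.+1 + k).+1 by rewrite /n addnS.
have [k0 _] := kappaP (n j).
rewrite lee_fin /powR gt_eqF // ler_expR.
have n0 : 0 < (n j)%:R :> R by rewrite nE ltr0n.
have := h _ jj0; rewrite -nE => hj.
rewrite mulrC ler_pdivlMr //; apply: le_trans hj.
have nR : (n j)%:R = j%:R * g.+1%:R + k.+1%:R :> R by rewrite /n natrD natrM.
have jn : j%:R <= (n j)%:R :> R by rewrite ler_nat nE leqW // (leq_trans (leq_pmulr j (ltn0Sn g))) // leq_addr.
have yE : y = La / g.+1%:R - e by rewrite /e; ring.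
have eK : K <= e * (n j)%:R.
  rewrite mulrC -ler_pdivrMr //; apply: le_trans jn.
  apply: le_trans (ltW (archi_boundP _)) _; first by rewrite divr_ge0 // ltW.
  by rewrite ler_nat.
have kg : k.+1%:R / g.+1%:R <= 1 :> R by rewrite ler_pdivrMr // mul1r ler_nat.
have kg0 : 0 <= k.+1%:R / g.+1%:R :> R by rewrite divr_ge0.
have E : La / g.+1%:R * (n j)%:R = j%:R * La + La * (k.+1%:R / g.+1%:R).
  by rewrite nR; field; rewrite gt_eqF.
rewrite yE mulrBl E.
have : La * (k.+1%:R / g.+1%:R) <= `|La|.
  by apply: le_trans (ler_norm _) _; rewrite normrM (ger0_norm kg0) ler_piMr.
have := ler_norm C; move: eK; rewrite /K.
move: (e * _) (La * (_ / _)) => X Y; lra.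
Qed.

Lemma limn_einf_kappa :
  (lambda (ess_support mu) c k `^ (g.+1%:R^-1) <= limn_einf u)%E.
Proof.
have g0 : 0 < g.+1%:R :> R by rewrite ltr0n.
have ginv : g.+1%:R^-1 != 0 :> R by rewrite invr_eq0 gt_eqF.
have low := limn_einf_kappa_lower.
have below (La : R) : ((expR La)%:E < lambda (ess_support mu) c k)%E ->
    ((expR (La / g.+1%:R - 1))%:E <= limn_einf u)%E.
  by move=> laE; apply: low laE _; rewrite ltrBlDr ltrDl.
move: low below; rewrite /lambda; case: asboolP => _; last first.
  set L := _ + _ => low below.
  have -> : ((expR L)%:E `^ (g.+1%:R^-1))%E = (expR (L / g.+1%:R))%:E.
    by rewrite poweR_EFin -expRM.
  have [b bE] : exists b : R, b = L / g.+1%:R by exists (L / g.+1%:R).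
  rewrite -bE.
  have pos : (0 < limn_einf u)%E.
    have LL : ((expR (L - 1))%:E < (expR L)%:E)%E by rewrite lte_fin ltr_expR; lra.
    by apply: lt_le_trans (below _ LL); rewrite lte_fin expR_gt0.
  case E : (limn_einf u) pos => [v| |] // v0; last by rewrite leey.
  rewrite lte_fin in v0; rewrite lee_fin leNgt; apply/negP => vL.
  (* an exponent y strictly between ln v and b is still reached *)
  have lnv : ln v < b by rewrite -ltr_expR lnK.
  pose y := (ln v + b) / 2.
  pose La := (y + b) / 2 * g.+1%:R.
  have LaL : La < L.
    by rewrite /La -ltr_pdivlMr // -bE /y; lra.
  have LaE : ((expR La)%:E < (expR L)%:E)%E by rewrite lte_fin ltr_expR.
  have yLa : y < La / g.+1%:R by rewrite /La mulfK ?gt_eqF // /y; lra.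
  have := low _ _ LaE yLa; rewrite E lee_fin -ler_ln ?posrE ?expR_gt0 // expRK /y; lra.
move=> low _; rewrite poweRyr //.
suff -> : limn_einf u = +oo%E by [].
apply/eqyP => A A0.
have h := low ((ln A + 1) * g.+1%:R) (ln A) (ltry _).
rewrite mulfK ?gt_eqF // ltrDl in h.
by have := h ltr01; rewrite lnK.
Qed.

End Conclusion.

Theorem theorem1p3 (R : realType) (mu : probability (borelRhat R) R)
    (E_neq0 : ess_support mu !=set0)
    (g : nat) (c : 'I_g.+1 -> Rhat R)
    (c_inj : injective c)
    (c_supp : forall k, ~ msupport mu (c k))
    (kappa : nat -> R)
    (kappaP : forall n, is_leading_coef mu c n (kappa n))
    (k : 'I_g.+1) :
  let n (j : nat) := (j * g.+1 + k.+1)%N in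
  (lambda (ess_support mu) c k `^ (g.+1%:R^-1)
     <= limn_einf (fun j => (kappa (n j) `^ ((n j)%:R^-1))%:E))%E.
Proof. exact: limn_einf_kappa. Qed.
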